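(* Let $p,q>2$. For $\mu>0$ consider the problem $$(P^\mu)\qquad \begin{cases} u''-|u|^{p-2}u=\lambda u & \text{on }\mathbb{R}\setminus\{0\},\\ u'(0^-)-u'(0^+)=|u(0)|^{q-2}u(0),\\ \|u\|_{L^2(\mathbb{R})}^2=\mu.\end{cases}$$ The following holds: (i) if $2<p<6$ and $2<q<\frac p2+1$, or if $2<p<6$ and $q>4$, then there exists $\mu_{p,q}>0$ such that $(P^\mu)$ admits a solution if and only if $\mu\leq\mu_{p,q}$; (ii) if $p\geq6$ and $2<q<4$, or if $p\geq6$ and $q>\frac p2+1$, then $(P^\mu)$ admits a solution for every $\mu>0$; (iii) if $p>6$ and $4<q<\frac p2+1$, or if $2<p<6$ and $\frac p2+1<q<4$, then there exists $\mu_{p,q}>0$ such that $(P^\mu)$ admits a solution if and only if $\mu\geq\mu_{p,q}$; (iv) if $2<p<6$ and $q=4$, then there exists $\mu_{p,4}>2$ such that $(P^\mu)$ admits a solution if and only if $\mu\in(2,\mu_{p,4}]$; (v) if $p>6$ and $q=4$, then $(P^\mu)$ admits a solution if and only if $\mu>2$; (vi) if $p>2$ and $q=\frac p2+1$, then $(P^\mu)$ has no solution for every $\mu>0$ when $p\leq8$, whereas it admits a solution for every $\mu>0$ when $p>8$. Furthermore, if $p,q,\mu$ are as in (i), (ii), (iv), (v) or (vi) (with $\mu$ such that a solution exists), then up to a change of sign the solution of $(P^\mu)$ is unique.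
   Context: Functions are real-valued. $u'(0^-),u'(0^+)$ denote the left and right derivatives of $u$ at the origin. Given $\mu>0$, ''$(P^\mu)$ admits a solution'' means that there exist $u\in H^1(\mathbb{R})$ and $\lambda\geq0$ for which $(P^\mu)$ is satisfied; $\lambda$ is part of the unknowns. Solutions are understood in the weak sense: $\int_{\mathbb{R}}u'\varphi'\,dx+\int_{\mathbb{R}}|u|^{p-2}u\varphi\,dx-|u(0)|^{q-2}u(0)\varphi(0)=-\lambda\int_{\mathbb{R}}u\varphi\,dx$ for every $\varphi\in H^1(\mathbb{R})$. *)

(* Defs.v *)
From HB Require Import structures.
From mathcomp Require Import all_boot all_order all_algebra.
From mathcomp Require Import all_classical all_reals all_analysis.
Set Implicit Arguments.
Unset Strict Implicit.
Unset Printing Implicit Defensive.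
Import Order.TTheory GRing.Theory Num.Theory.
Import numFieldNormedType.Exports.

Local Open Scope classical_set_scope.
Local Open Scope ring_scope.

Section definitions.
Context {R : realType}.
Implicit Types (u v phi : R -> R) (p q l m : R).

Local Notation leb := (@lebesgue_measure R).

Definition C1c phi : Prop :=
  [/\ forall x, derivable phi x 1,
      continuous (derive1 phi)
    & compact (closure [set x | phi x != 0])].

(* On the line, C^1 test functions with compact support define the same weak
   derivatives as smooth ones (this is the convention of Brezis' textbook). *)
Definition is_weak_derivative u (u' : R -> R) : Prop :=
  forall phi, C1c phi ->
    \int[leb]_(x in setT) (u x * derive1 phi x) =
    - \int[leb]_(x in setT) (u' x * phi x).

(* [is_H1 u u']: u belongs to H^1(R) and u' is (a representative of) its weak
   derivative.  An element of H^1(R) is represented by its unique continuous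
   representative, so that u(0) is meaningful and equality in H^1(R) is equality
   of functions. *)
Definition is_H1 u (u' : R -> R) : Prop :=
  [/\ continuous u,
      u \in Lfun leb 2%:E,
      u' \in Lfun leb 2%:E
    & is_weak_derivative u u'].

Definition signed_power (r s : R) : R := `|s| `^ (r - 2) * s.

Definition is_weak_solution p q l u : Prop :=
  exists2 u', is_H1 u u' &
  forall phi phi', is_H1 phi phi' ->
    \int[leb]_(x in setT) (u' x * phi' x)
    + \int[leb]_(x in setT) (signed_power p (u x) * phi x)
    - signed_power q (u 0) * phi 0
    = - l * \int[leb]_(x in setT) (u x * phi x).

Definition solves p q m u l : Prop :=
  [/\ 0 <= l,
      is_weak_solution p q l u
    & ('N[leb]_2[EFin \o u] ^+ 2 = m%:E)%E].

Definition admits_solution p q m : Prop := exists u l, solves p q m u l.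

Definition unique_up_to_sign p q m : Prop :=
  forall u l v k, solves p q m u l -> solves p q m v k ->
    k = l /\ (v = u \/ v = (fun x => - u x)).

End definitions.

(* Main.v *)
(* Let [u] be a solution.  Testing the weak equation against piecewise affine
   "tents" shows that [u] is C^2 on each closed half-line and satisfies the jump
   condition at 0.  There [u^2] is convex and integrable, hence nonincreasing and
   vanishing at infinity, the energy [u'^2 - l u^2 - 2/p |u|^p] is zero, and so
   [Y = |u|] satisfies [Y' = - Y sqrt (l + 2/p Y^(p-2))]: up to sign [u] is even and
   determined by [l] and [a = |u 0|], and conversely all such profiles are explicit.
   The jump condition becomes [2 sqrt (l + 2/p a^(p-2)) = a^(q-2)], so
   [l = a^(2q-4) (1 - t) / 4] with [t = 8/p a^(p+2-2q)], and the substitution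
   [s = Y x] gives the mass [4 a^(4-q) G t] with
     [G t = integral_0^1 1 / (2 sqrt (1 - t + t s^n)) ds],  [n = (p - 2) / 2].
   For [q != p/2 + 1] the mass is a constant multiple of [t^k G t] with
   [k = (4 - q) / (p + 2 - 2q)].  [G] is continuous and increasing with limit 1/2 at
   [t = 0], and as [t] tends to 1 it tends to [1 / (2 - n)] if [p < 6], in which case
   [t = 1] is admissible, and to infinity if [p >= 6].  The sign of [k] then decides
   the range of the mass, which is injective in [t] for [k >= 0].  For [q = p/2 + 1]
   the parameter [t = 8/p] is constant and only the factor [a^(4-q)] varies. *)
Require Import Defs.
From HB Require Import structures.
From mathcomp Require Import all_boot all_order all_algebra.
From mathcomp Require Import all_classical all_reals all_analysis.
From mathcomp Require Import measurable_realfun ring lra.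
Import Order.TTheory GRing.Theory Num.Theory.
Import numFieldNormedType.Exports.
Set Implicit Arguments.
Unset Strict Implicit.
Unset Printing Implicit Defensive.
Local Open Scope classical_set_scope.
Local Open Scope ring_scope.

(** * Derivatives and integrals *)

Section derivation.
Context {R : realType}.
Implicit Types (f g : R -> R) (x a b c r : R).

(** Square integrability of [Y] on a half-line is encoded as a bounded primitive [W] of [Y^2], and
    the half mass is the limit of [W] at infinity. The first-order equation makes [W] an explicit
    function of [Y], so masses are computed without improper integrals, and bounds on [G] come from
    comparing derivatives. The delicate point is [t = 1], zero frequency: the density of [G] becomes
    [s^(-n/2) / 2], singular at [s = 0] and integrable there exactly when [n < 2], that is [p < 6].
    The formula for [G] through [L] breaks down at this point, so its value is a separate clause and
    continuity is recovered by a squeeze. The end point [t = 1], when admissible, is attained and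
    gives non-strict thresholds; the limit at [t = 0] is never attained, whence the strict bound
    [2 < m] for [q = 4]. Uniqueness reduces to injectivity of the mass in the height. For [k < 0]
    the decreasing factor [t^k] competes with the increasing [G], and only the minimum of the
    product is located. *)

Lemma is_derive_congr f x a b : is_derive x 1 f a -> a = b -> is_derive x 1 f b.
Proof. by move=> + <-. Qed.

Lemma is_deriveR_cst c x : is_derive x 1 (fun _ : R => c) 0.
Proof. exact: is_derive_cst. Qed.

Lemma is_deriveR_id x : is_derive x 1 (fun y : R => y) 1.
Proof. exact: is_derive_id. Qed.

Lemma is_deriveR_D f g x a b : is_derive x 1 f a -> is_derive x 1 g b ->
  is_derive x 1 (fun y => f y + g y) (a + b).
Proof. by move=> fa gb; exact: is_deriveD. Qed.

Lemma is_deriveR_N f x a : is_derive x 1 f a -> is_derive x 1 (fun y => - f y) (- a).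
Proof. by move=> fa; exact: is_deriveN. Qed.

Lemma is_deriveR_M f g x a b : is_derive x 1 f a -> is_derive x 1 g b ->
  is_derive x 1 (fun y => f y * g y) (f x * b + a * g x).
Proof.
move=> fa gb; apply: (is_derive_congr (is_deriveM fa gb)).
by rewrite /GRing.scale/= (mulrC a).
Qed.

Lemma is_deriveR_X f n x a : is_derive x 1 f a ->
  is_derive x 1 (fun y => f y ^+ n.+1) (n.+1%:R * f x ^+ n * a).
Proof.
move=> fa; rewrite (_ : (fun y => _) = f ^+ n.+1); last by rewrite exprfctE.
exact: (is_derive_congr (is_deriveX n.+1 fa)).
Qed.

Lemma is_deriveR_comp f g x a b : is_derive (g x) 1 f a -> is_derive x 1 g b ->
  is_derive x 1 (fun y => f (g y)) (a * b).
Proof.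
by move=> fa gb; apply: (is_derive_congr (@is_derive1_comp _ f g _ _ _ fa gb)).
Qed.

Lemma is_deriveR_exp f x a : is_derive x 1 f a ->
  is_derive x 1 (fun y => expR (f y)) (expR (f x) * a).
Proof. by move=> fa; apply: is_deriveR_comp. Qed.

Lemma is_deriveR_powR f x a r : 0 < f x -> is_derive x 1 f a ->
  is_derive x 1 (fun y => f y `^ r) (r * f x `^ (r - 1) * a).
Proof.
by move=> fx fa; apply: (is_deriveR_comp (f := fun y => y `^ r)); exact: is_derive1_powR.
Qed.

Lemma is_deriveR_ln f x a : 0 < f x -> is_derive x 1 f a ->
  is_derive x 1 (fun y => ln (f y)) ((f x)^-1 * a).
Proof. by move=> fx fa; apply: is_deriveR_comp; exact: is_derive1_ln. Qed.

Lemma is_deriveR_sqrt f x a : 0 < f x -> is_derive x 1 f a ->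
  is_derive x 1 (fun y => Num.sqrt (f y)) ((2 * Num.sqrt (f x))^-1 * a).
Proof. by move=> fx fa; apply: is_deriveR_comp; exact: is_derive1_sqrt. Qed.

Lemma is_derive_continuous f x a : is_derive x 1 f a -> {for x, continuous f}.
Proof.
by move=> [fx _]; apply: differentiable_continuous; apply/derivable1_diffP.
Qed.

Lemma derive1_is_derive f x a : is_derive x 1 f a -> derive1 f x = a.
Proof. by move=> fa; rewrite derive1E; exact: derive_val. Qed.

Lemma mean_value f (f' : R -> R) a b : a <= b ->
  (forall x, a <= x <= b -> is_derive x 1 f (f' x)) ->
  exists2 c, a <= c <= b & f b - f a = f' c * (b - a).
Proof.
move=> ab df; have [|x|c cab E] := @MVT_segment _ f f' a b ab.
- by move=> x xab; apply: df; rewrite !ltW ?(itvP xab).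
- apply: derivable_within_continuous => y yab.
  by apply: @ex_derive; apply: df; move: yab; rewrite in_itv.
- by exists c => //; move: cab; rewrite in_itv.
Qed.

Lemma ge0_derive_le f (f' : R -> R) a b : a <= b ->
  (forall x, a <= x <= b -> is_derive x 1 f (f' x)) ->
  (forall x, a <= x <= b -> 0 <= f' x) -> f a <= f b.
Proof.
move=> ab df f0; have [c cab E] := mean_value ab df.
by rewrite -subr_ge0 E mulr_ge0 ?f0// subr_ge0.
Qed.

Lemma le_derive_le f g (f' g' : R -> R) a b : a <= b ->
  (forall x, a <= x <= b -> is_derive x 1 f (f' x)) ->
  (forall x, a <= x <= b -> is_derive x 1 g (g' x)) ->
  (forall x, a <= x <= b -> f' x <= g' x) -> f b - f a <= g b - g a.
Proof.
move=> ab df dg fg.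
suff : g a - f a <= g b - f b by lra.
apply: (@ge0_derive_le (fun x => g x - f x) (fun x => g' x - f' x)) => // x xab.
  by apply: is_deriveR_D; [exact: dg|apply: is_deriveR_N; exact: df].
by rewrite subr_ge0 fg.
Qed.

Lemma eq_derive_eq f g (f' : R -> R) a b : a <= b ->
  (forall x, a <= x <= b -> is_derive x 1 f (f' x)) ->
  (forall x, a <= x <= b -> is_derive x 1 g (f' x)) -> f b - f a = g b - g a.
Proof.
by move=> ab df dg; apply/eqP; rewrite eq_le; apply/andP; split;
  apply: (le_derive_le ab); eauto.
Qed.

Lemma eq_derive_eq0 f g (f' : R -> R) x :
  (forall y : R, 0 <= y -> is_derive y 1 f (f' y)) ->
  (forall y : R, 0 <= y -> is_derive y 1 g (f' y)) -> 0 <= x -> f x - f 0 = g x - g 0.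
Proof.
move=> df dg x0; have H (h : R -> R) : (forall y : R, 0 <= y -> is_derive y 1 h (f' y)) ->
    forall y : R, 0 <= y <= x -> is_derive y 1 h (f' y).
  by move=> dh y /andP[y0 _]; exact: dh.
exact: (eq_derive_eq x0 (H f df) (H g dg)).
Qed.

Lemma continuous_intermediate f a b v : a <= b ->
  (forall x, a <= x <= b -> {for x, continuous f}) ->
  (f a <= v <= f b) || (f b <= v <= f a) -> exists2 c, a <= c <= b & f c = v.
Proof.
move=> ab cf v_in; have [||c cab fc] := @IVT _ f a b v ab.
- apply: continuous_in_subspaceT => x; rewrite inE/= in_itv/=; exact: cf.
- by rewrite ge_min le_max; case/orP : v_in => /andP[-> ->]; rewrite ?orbT.
- by exists c => //; move: cab; rewrite in_itv.
Qed.

End derivation.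

(** The derivative is assembled along the syntax of the function and left unsimplified;
    [is_derive_congr] then reduces the claim to an identity for [ring] or [field]. *)
Ltac derivs := repeat (first
  [ eassumption
  | notypeclasses refine (is_deriveR_D _ _) | notypeclasses refine (is_deriveR_N _)
  | notypeclasses refine (is_deriveR_M _ _) | notypeclasses refine (is_deriveR_X _ _)
  | notypeclasses refine (is_deriveR_exp _) | notypeclasses refine (is_deriveR_cst _ _)
  | notypeclasses refine (is_deriveR_id _) | notypeclasses refine (is_deriveR_powR _ _ _)
  | notypeclasses refine (is_deriveR_ln _ _) | notypeclasses refine (is_deriveR_sqrt _ _) ]).

(** * Integrals over bounded intervals and primitives *)

Section integration.
Context {R : realType}.
Local Notation leb := (@lebesgue_measure R).
Implicit Types (f g : R -> R) (x a b c r : R).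

Lemma continuous_integrable_itv f a b :
  (forall x, a <= x <= b -> {for x, continuous f}) ->
  leb.-integrable `[a, b] (EFin \o f).
Proof.
move=> cf; apply: continuous_compact_integrable; first exact: segment_compact.
apply: continuous_in_subspaceT => x; rewrite inE/= in_itv/=; exact: cf.
Qed.

Lemma integral_derive f g a b : a <= b ->
  (forall x, a <= x <= b -> is_derive x 1 g (f x)) ->
  (forall x, a <= x <= b -> {for x, continuous f}) ->
  \int[leb]_(x in `[a, b]) f x = g b - g a.
Proof.
rewrite le_eqVlt => /predU1P[<- _ _|ab dg cf].
  by rewrite set_itv1 Rintegral_set1 subrr.
rewrite /Rintegral (continuous_FTC2 (F := g))//.
- apply: continuous_in_subspaceT => x; rewrite inE/= in_itv/=; exact: cf.
- split.
  + move=> x; rewrite in_itv/= => /andP[/ltW ax /ltW xb].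
    by apply: @ex_derive; apply: dg; rewrite ax.
  + apply: cvg_at_right_filter; apply: (is_derive_continuous (dg _ _)).
    by rewrite lexx ltW.
  + apply: cvg_at_left_filter; apply: (is_derive_continuous (dg _ _)).
    by rewrite lexx ltW.
- move=> x; rewrite in_itv/= => /andP[/ltW ax /ltW xb].
  by apply: derive1_is_derive; apply: dg; rewrite ax.
Qed.

Lemma Rintegral_itv_split f a b c : a <= b <= c ->
  leb.-integrable `[a, c] (EFin \o f) ->
  \int[leb]_(x in `[a, c]) f x =
  \int[leb]_(x in `[a, b]) f x + \int[leb]_(x in `[b, c]) f x.
Proof.
move=> /andP[ab bc] fi; have := @Rintegral_itvB _ f (BLeft a) (BRight c) b fi.
rewrite !bnd_simp => /(_ ab bc) E; rewrite -[X in _ + X]Rintegral_itv_obnd_cbnd.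
  by rewrite -E; ring.
apply: integrableS fi => //; apply: subset_itvr; by rewrite bnd_simp.
Qed.

Lemma primitive_exists f : continuous f ->
  exists F : R -> R, F 0 = 0 /\ forall x, is_derive x 1 F (f x).
Proof.
move=> cf; pose I a b := \int[leb]_(x in `[a, b]) f x.
have fi a b : leb.-integrable `[a, b] (EFin \o f).
  by apply: continuous_integrable_itv => x _; exact: cf.
pose F x := if 0 <= x then I 0 x else - I x 0.
(* To the right of [- M] both branches of [F] are one integral from [- M] up to a constant, so the
   fundamental theorem on an interval applies at every point, 0 included. *)
have FE M x : 0 <= M -> - M <= x -> F x = I (- M) x - I (- M) 0.
  move=> M0 Mx; rewrite /F; case: leP => x0.
    by rewrite /I (@Rintegral_itv_split f (-M) 0 x) ?oppr_le0 ?M0//; ring.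
  rewrite /I [X in _ - X](@Rintegral_itv_split f (-M) x 0) ?Mx ?(ltW x0)//; ring.
exists F; split; first by rewrite /F lexx /I set_itv1 Rintegral_set1.
move=> x; pose M := `|x| + 1.
have Mx : - M < x by rewrite /M; have := ler_norm (- x); rewrite normrN; lra.
have [] := @continuous_FTC1_closed _ f (- M) x (x + 1) _ (fi _ _) Mx (cf x).
  by rewrite ltrDl.
move=> dI eI.
have dF : is_derive x 1 (fun y => I (- M) y - I (- M) 0) (f x).
  apply: (@is_derive_congr _ _ _ (f x + 0)); last by rewrite addr0.
  apply: is_deriveR_D.
  by rewrite derive1E in eI; exact: (DeriveDef dI eI).
apply: (near_eq_is_derive _ dF).
near=> y; rewrite (FE M)//; first by rewrite addr_ge0.
apply: ltW; near: y; exact: lt_nbhsr.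
Unshelve. all: by end_near. Qed.

End integration.

(** * Integrability on the line and compactly supported test functions *)

Section lebesgue.
Context {R : realType}.
Local Notation leb := (@lebesgue_measure R).
Implicit Types (f g u v phi : R -> R) (x a b c r : R).

Lemma Lfun_measurable f p : f \in Lfun leb p -> measurable_fun setT f.
Proof. by move=> /andP[]; rewrite !inE. Qed.

Lemma Lfun2_integrable_mul f g : f \in Lfun leb 2%:E -> g \in Lfun leb 2%:E ->
  leb.-integrable setT (EFin \o (fun x => f x * g x)).
Proof. by move=> fL gL; apply/Lfun1_integrable; exact: Lfun2_mul_Lfun1. Qed.

Lemma le_integrable_real (D : set R) f g : measurable D -> measurable_fun D f ->
  (forall x, D x -> `|f x| <= g x) -> leb.-integrable D (EFin \o g) ->
  leb.-integrable D (EFin \o f).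
Proof.
move=> mD mf fg; apply: le_integrable => //; first exact/measurable_EFinP.
by move=> x Dx /=; rewrite lee_fin (le_trans (fg x Dx))// ler_norm.
Qed.

Lemma Lfun2_integrable_itv f a b : f \in Lfun leb 2%:E ->
  leb.-integrable `[a, b] (EFin \o f).
Proof.
move=> fL; have mf := Lfun_measurable fL.
apply: (@le_integrable_real _ _ (fun x => 1 + f x ^+ 2)) => //.
- exact: measurable_funTS.
- by move=> x _; rewrite -[f x ^+ 2]real_normK ?num_real//; nra.
- apply: (@integrableD _ _ _ leb _ _ (EFin \o cst 1) (EFin \o (fun x => f x ^+ 2))) => //.
    by apply: continuous_integrable_itv => x _; exact: cvg_cst.
  exact: integrableS (Lfun2_integrable_sqr fL).
Qed.

Lemma Rintegral_supp f (A : set R) : (forall x, ~ A x -> f x = 0) ->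
  \int[leb]_(x in setT) f x = \int[leb]_(x in A) f x.
Proof.
move=> f0; rewrite [RHS]Rintegral_mkcond; apply: eq_Rintegral => x _.
by rewrite patchE; case: ifPn => // /negP; rewrite inE => /f0.
Qed.

Lemma integrable_supp f (A : set R) : measurable A ->
  (forall x, ~ A x -> f x = 0) -> leb.-integrable A (EFin \o f) ->
  leb.-integrable setT (EFin \o f).
Proof.
move=> mA f0 fi; rewrite (_ : EFin \o f = (EFin \o f) \_ A).
  exact: (proj1 (@integrable_mkcond _ _ R leb A (EFin \o f) mA) fi).
apply/funext => x; rewrite patchE; case: ifPn => // /negP; rewrite inE => Ax.
by rewrite /= f0.
Qed.

Lemma integrable_mul_cont f v a b : leb.-integrable `[a, b] (EFin \o f) ->
  continuous v -> leb.-integrable `[a, b] (EFin \o (fun x => f x * v x)).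
Proof.
move=> fi cv; apply: (@integrableMl _ _ _ leb _ _ (EFin \o f) v) => //.
  by apply: measurable_funTS; exact: continuous_measurable_fun.
have := @continuous_compact _ _ v _ (continuous_subspaceT cv) (@segment_compact _ a b).
move=> /compact_bounded [M [Mr HM]]; exists M; split => // N MN x xab.
by apply: (HM N MN); exists x.
Qed.

Lemma Rintegral_dominated_cvg (D : set R) (f_ : nat -> R -> R) f g :
  measurable D -> (forall n, measurable_fun D (f_ n)) ->
  (forall x, D x -> f_ n x @[n --> \oo] --> f x) ->
  leb.-integrable D (EFin \o g) ->
  (forall n x, D x -> `|f_ n x| <= g x) ->
  leb.-integrable D (EFin \o f) /\
  \int[leb]_(x in D) f_ n x @[n --> \oo] --> \int[leb]_(x in D) f x.
Proof.
move=> mD mf_ cf ig fg.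
have cf' x : D x -> (f_ n x)%:E @[n --> \oo] --> (f x)%:E.
  by move=> Dx; apply: cvg_comp (cf x Dx) _; exact: cvg_refl.
have mf : measurable_fun D (EFin \o f).
  by apply: (@emeasurable_fun_cvg _ _ _ _ (fun n x => (f_ n x)%:E)) => // n;
    exact/measurable_EFinP.
have [|||fi _ cI] := @dominated_convergence _ _ R leb D mD (fun n x => (f_ n x)%:E)
  (EFin \o f) (EFin \o g) _ mf _ ig.
- by move=> n; apply/measurable_EFinP; exact: mf_.
- exact: aeW.
- by apply: aeW => x n Dx; rewrite /= lee_fin; exact: fg.
split => //; apply: fine_cvg; rewrite fineK//.
exact: integrable_fin_num.
Qed.

Lemma Rintegral_growing_cvg f : leb.-integrable setT (EFin \o f) ->
  \int[leb]_(x in `[- n%:R, n%:R]) f x @[n --> \oo] --> \int[leb]_(x in setT) f x.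
Proof.
move=> fi; have mf : measurable_fun setT f.
  by apply/measurable_EFinP; exact: measurable_int fi.
under eq_fun do rewrite Rintegral_mkcond.
have [||||//] := @Rintegral_dominated_cvg setT
  (fun n => f \_ `[- n%:R, n%:R]) f (fun x => `|f x|) measurableT.
- by move=> n; apply/(measurable_restrictT _ _).1 => //; exact: measurable_funTS.
- move=> x _; apply: cvg_near_cst; near=> n; rewrite patchE mem_set//= in_itv/=.
  by rewrite -ler_norml ltW//; near: n; exact: nbhs_infty_gtr.
- exact: integrable_norm.
- by move=> n x _; rewrite patchE; case: ifP => // _; rewrite normr0.
Unshelve. all: by end_near. Qed.

Lemma C1cI f (f' : R -> R) a b : (forall x, is_derive x 1 f (f' x)) ->
  continuous f' -> (forall x, ~ (a <= x <= b) -> f x = 0) -> C1c f.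
Proof.
move=> df cf' f0; split.
- by move=> x; exact: (@ex_derive _ _ _ _ _ _ _ (df x)).
- by rewrite (_ : derive1 f = f')//; apply/funext => x; exact: derive1_is_derive.
- have cl : closed `[a, b] by exact: interval_closed.
  apply: (subclosed_compact _ (@segment_compact _ a b)); first exact: closed_closure.
  rewrite [X in _ `<=` X](proj1 (closure_id _) cl).
  apply: closureS => x /= /eqP fx; apply: contrapT; rewrite in_itv/= => /f0.
  exact: fx.
Qed.

Lemma C1c_derive f x : C1c f -> is_derive x 1 f (derive1 f x).
Proof. by move=> [df _ _]; apply: DeriveDef; [exact: df|rewrite derive1E]. Qed.

Lemma C1c_continuous f : C1c f -> continuous f.
Proof. by move=> fc x; exact: is_derive_continuous (C1c_derive x fc). Qed.

Lemma C1c_supp f : C1c f -> exists K : R, [/\ 0 < K,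
  (forall x, ~ (- K <= x <= K) -> f x = 0) &
  (forall x, ~ (- K <= x <= K) -> derive1 f x = 0)].
Proof.
move=> fc; have [_ _ /compact_bounded [M [Mr HM]]] := fc.
pose K := `|M| + 1.
have H x : K <= `|x| -> f x = 0.
  move=> Kx; apply: contrapT => /eqP fx.
  have : `|x| <= `|M| + 2^-1.
    apply: HM; first by rewrite (le_lt_trans (ler_norm M))// ltrDl invr_gt0.
    exact: subset_closure.
  by move: Kx; rewrite /K; lra.
have KK x : ~ (- K <= x <= K) -> K < `|x|.
  by move=> /negP; rewrite -ler_norml -ltNge.
exists K; split; first by rewrite ltr_wpDl.
  by move=> x /KK /ltW /H.
move=> x /KK Kx; apply: derive1_is_derive.
apply: (near_eq_is_derive _ (is_deriveR_cst 0 x)); near=> y; apply/esym/H/ltW.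
by near: y; apply: (cvgr_gt _ (cvg_norm cvg_id) _ Kx).
Unshelve. all: by end_near. Qed.

End lebesgue.

(** * Weak derivatives *)

Section weak_derivative.
Context {R : realType}.
Local Notation leb := (@lebesgue_measure R).
Implicit Types (f g u v w phi : R -> R) (x a b c k : R).

(** The factor 6 gives total integral 1, so the primitive is the C^1 step equal to [3 t^2 - 2 t^3]
    on [[0, 1]]. *)
Definition bump (t : R) : R := 6 * Num.max 0 (t * (1 - t)).

Lemma continuous_bump : continuous bump.
Proof.
move=> t; apply: cvgM; first exact: cvg_cst.
apply: (@continuous_max _ _ (fun _ => 0) (fun t : R => t * (1 - t))).
  exact: cvg_cst.
by apply: cvgM; [exact: cvg_id|apply: cvgB; [exact: cvg_cst|exact: cvg_id]].
Qed.

Lemma bump_ge0 t : 0 <= bump t.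
Proof. by rewrite /bump mulr_ge0// le_max lexx. Qed.

Lemma bump_out t : t <= 0 \/ 1 <= t -> bump t = 0.
Proof. by move=> t01; rewrite /bump max_l ?mulr0//; case: t01 => ?; nra. Qed.

Lemma smoothstep_exists : exists S : R -> R, [/\
  forall t : R, is_derive t 1 S (bump t), forall t : R, t <= 0 -> S t = 0,
  forall t : R, 1 <= t -> S t = 1 & forall t : R, 0 <= S t <= 1].
Proof.
have [S [S0 dS]] := primitive_exists continuous_bump.
have Sle0 (t : R) : t <= 0 -> S t = 0.
  move=> t0; have := @eq_derive_eq _ S (fun _ => 0) (fun _ => 0) t 0 t0.
  rewrite S0 subrr => /(_ _ _)/eqP; rewrite sub0r oppr_eq0 => H; apply/eqP/H.
    move=> x /andP[_ x0]; apply: (is_derive_congr (dS x)).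
    by rewrite bump_out//; left.
have S1 : S 1 = 1.
  have E : S 1 - S 0 = (3 * 1 ^+ 2 - 2 * 1 ^+ 3) - (3 * 0 ^+ 2 - 2 * 0 ^+ 3).
    apply: (@eq_derive_eq _ S (fun t => 3 * t ^+ 2 - 2 * t ^+ 3) bump 0 1 ler01) => //.
    move=> x /andP[x0 x1]; eapply is_derive_congr; first by derivs.
    by rewrite /bump max_r; [ring|nra].
  by move: E; rewrite S0; lra.
have Sge1 (t : R) : 1 <= t -> S t = 1.
  move=> t1; have := @eq_derive_eq _ S (fun _ => 0) (fun _ => 0) 1 t t1.
  rewrite S1 subrr => /(_ _ _)/eqP; rewrite subr_eq0 => H; apply/eqP/H.
    move=> x /andP[x1 _]; apply: (is_derive_congr (dS x)).
    by rewrite bump_out//; right.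
have Smono (x y : R) : x <= y -> S x <= S y.
  by move=> xy; apply: (ge0_derive_le xy (fun z _ => dS z)) => z _; exact: bump_ge0.
exists S; split => // t; apply/andP; split.
  by have [/Sle0 ->//|/ltW/Smono] := leP t 0; rewrite S0.
by have [/Sge1 ->//|/ltW/Smono] := leP 1 t; rewrite S1.
Qed.

Lemma is_derive_scaled (S S' : R -> R) a k x : (forall t : R, is_derive t 1 S (S' t)) ->
  is_derive x 1 (fun y => S (k * (y - a))) (k * S' (k * (x - a))).
Proof.
move=> dS; apply: (is_derive_congr (is_deriveR_comp (g := fun y => k * (y - a)) (dS _) _)).
by rewrite /GRing.scale/=; ring.
Qed.

Lemma continuous_scaled w a k : continuous w -> continuous (fun x => w (k * (x - a))).
Proof.
move=> cw x; apply: (@continuous_comp _ _ _ (fun x => k * (x - a)) w); last exact: cw.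
apply: cvgM; first exact: cvg_cst.
by apply: cvgB; [exact: cvg_id|exact: cvg_cst].
Qed.

(** The kernel is nonnegative, lives on [[a, a + k^-1]] and has primitive [S (k * (x - a))], so the
    integral is squeezed between those of [w a - eta] and [w a + eta] times the kernel. Being
    one-sided, it allows [a] to be the left end of the interval. *)
Lemma approximate_identity w a (A B eta : R) k : continuous w -> 0 < eta -> 0 < k ->
  A <= a -> a + k^-1 <= B ->
  (forall x, a <= x <= a + k^-1 -> `|w x - w a| <= eta) ->
  `|\int[leb]_(x in `[A, B]) (w x * (k * bump (k * (x - a)))) - w a| <= eta.
Proof.
move=> cw eta0 k0 Aa aB wa.
have [S [dS S0 S1 _]] := smoothstep_exists.
have cf : continuous (fun x => w x * (k * bump (k * (x - a)))).
  move=> x; apply: cvgM; first exact: cw.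
  apply: cvgM; first exact: cvg_cst.
  by apply: continuous_scaled; exact: continuous_bump.
have [P [_ dP]] := primitive_exists cf.
have k'0 : 0 < k^-1 by rewrite invr_gt0.
have AB : A <= B by lra.
have kk : k * k^-1 = 1 by rewrite mulfV// gt_eqF.
rewrite (integral_derive AB (fun x _ => dP x) (fun x _ => cf x)).
have SA : S (k * (A - a)) = 0 by apply: S0; nra.
have SB : S (k * (B - a)) = 1.
  by apply: S1; rewrite -kk ler_pM2l//; lra.
have dSc c (x : R) : A <= x <= B -> is_derive x 1 (fun y => c * S (k * (y - a)))
    (c * (k * bump (k * (x - a)))).
  move=> _; apply: (is_derive_congr
    (is_deriveR_M (is_deriveR_cst c x) (is_derive_scaled a k x dS))).
  by rewrite mul0r addr0.
have bnd x : k * bump (k * (x - a)) = 0 \/ `|w x - w a| <= eta.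
  have [xa|xa] := leP x a; first by left; rewrite bump_out ?mulr0//; left; nra.
  have [ax|ax] := leP x (a + k^-1); first by right; apply: wa; rewrite ax ltW.
  left; rewrite bump_out ?mulr0//; right.
  by rewrite -kk ler_pM2l//; lra.
have kb x : 0 <= k * bump (k * (x - a)) by rewrite mulr_ge0 ?bump_ge0// ltW.
have := le_derive_le AB (fun x _ => dP x) (dSc (w a + eta)).
have := le_derive_le AB (dSc (w a - eta)) (fun x _ => dP x).
rewrite SA SB !mulr1 !mulr0 !subr0 => lo up.
rewrite ler_distl lo ?up//.
- move=> x _; have [->|] := bnd x; first by rewrite !mulr0.
  rewrite ler_norml => /andP[w1 w2]; apply: ler_wpM2r => //; lra.
- move=> x _; have [->|] := bnd x; first by rewrite !mulr0.
  rewrite ler_norml => /andP[w1 w2]; apply: ler_wpM2r => //; lra.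
Qed.

Lemma approximate_identity_cvg w a (A B : R) : continuous w -> A <= a -> a < B ->
  \int[leb]_(x in `[A, B]) (w x * (n.+1%:R * bump (n.+1%:R * (x - a))))
    @[n --> \oo] --> w a.
Proof.
move=> cw Aa aB; apply/cvgrPdist_le => /= e e0.
have := cw a; move/cvgrPdist_le => /(_ _ e0).
rewrite -filter_from_ballE => -[d /= d0 Hd].
near=> n; rewrite distrC; apply: approximate_identity => //.
- rewrite -lerBrDl; apply: ltW.
  rewrite -[ltRHS]invrK ltf_pV2 ?posrE ?invr_gt0 ?subr_gt0//.
  apply: (@lt_trans _ _ n%:R); last by rewrite ltr_nat.
  by near: n; exact: nbhs_infty_gtr.
- move=> x /andP[ax xa]; rewrite distrC; apply: Hd.
  rewrite /ball/= ler0_norm ?subr_le0// opprB.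
  apply: (@le_lt_trans _ _ (n.+1%:R)^-1); first by rewrite lerBlDl.
  rewrite -[ltRHS]invrK ltf_pV2 ?posrE ?invr_gt0//.
  apply: (@lt_trans _ _ n%:R); last by rewrite ltr_nat.
  by near: n; exact: nbhs_infty_gtr.
Unshelve. all: by end_near. Qed.

(* Testing against [chi_n * v], with [chi_n] a C^1 cutoff converging pointwise
   to the indicator function of ]a, b], turns the distributional definition
   into an integration by parts on a bounded interval. *)
Lemma weak_derivative_parts u u' v v' a b :
  continuous u -> (forall a b, leb.-integrable `[a, b] (EFin \o u')) ->
  is_weak_derivative u u' ->
  (forall x, is_derive x 1 v (v' x)) -> continuous v' -> a < b ->
  \int[leb]_(x in `[a, b]) (u x * v' x + u' x * v x) = u b * v b - u a * v a.
Proof.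
move=> cu iu' wd dv cv' ab.
have cv : continuous v by move=> x; exact: is_derive_continuous (dv x).
have [S [dS S0 S1 S01]] := smoothstep_exists.
have cS : continuous S by move=> x; exact: is_derive_continuous (dS x).
(* Difference of two steps, one rising just after [a] and one just after [b]; each ramp has length
   at most 1, whence the enlarged interval [[a, b + 1]]. *)
pose chi n x := S (n.+1%:R * (x - a)) - S (n.+1%:R * (x - b)).
pose chi' n x := n.+1%:R * bump (n.+1%:R * (x - a)) - n.+1%:R * bump (n.+1%:R * (x - b)).
have cchi n : continuous (chi n).
  by move=> x; apply: cvgB; apply: continuous_scaled.
have cb n c : continuous (fun x => n.+1%:R * bump (n.+1%:R * (x - c))).
  move=> x; apply: cvgM; first exact: cvg_cst.
  by apply: continuous_scaled; exact: continuous_bump.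
have cchi' n : continuous (chi' n) by move=> x; apply: cvgB; exact: cb.
have dchi n (x : R) : is_derive x 1 (chi n) (chi' n x).
  by apply: is_deriveR_D; [|apply: is_deriveR_N]; exact: is_derive_scaled.
have n1 n : 1 <= n.+1%:R :> R by rewrite ler1n.
have out n x : ~ (a <= x <= b + 1) -> chi n x = 0 /\ chi' n x = 0.
  move=> /negP; rewrite negb_and -!ltNge => /orP[xa|xb].
    by rewrite /chi /chi' !S0 ?bump_out ?mulr0 ?subrr//;
      [left|left| |]; have := n1 n; nra.
  by rewrite /chi /chi' !S1 ?bump_out ?mulr0 ?subrr//;
      [right|right| |]; have := n1 n; nra.
have ab1 : a <= b <= b + 1 by apply/andP; split; lra.
have test n : \int[leb]_(x in `[a, b + 1]) ((u x * v' x + u' x * v x) * chi n x) =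
    - (\int[leb]_(x in `[a, b + 1]) (u x * v x * (n.+1%:R * bump (n.+1%:R * (x - a))))
      - \int[leb]_(x in `[a, b + 1]) (u x * v x * (n.+1%:R * bump (n.+1%:R * (x - b))))).
  have dphi (x : R) : is_derive x 1 (fun x => chi n x * v x) (chi n x * v' x + chi' n x * v x).
    exact: is_deriveR_M.
  have cphi' : continuous (fun x => chi n x * v' x + chi' n x * v x).
    by move=> x; apply: cvgD; apply: cvgM;
      [exact: cchi|exact: cv'|exact: cchi'|exact: cv].
  have phiC : C1c (fun x => chi n x * v x).
    apply: (C1cI dphi cphi' (a := a) (b := b + 1)) => x /out -/(_ n)[-> _].
    by rewrite mul0r.
  have := wd _ phiC.
  rewrite (@Rintegral_supp _ _ `[a, b + 1]%classic); last first.
    move=> x; rewrite /= in_itv/= => xab; rewrite (derive1_is_derive (dphi x)).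
    by have [-> ->] := out n x xab; rewrite !mul0r addr0 mulr0.
  rewrite (@Rintegral_supp _ (fun x => u' x * _) `[a, b + 1]%classic); last first.
    move=> x; rewrite /= in_itv/= => xab.
    by have [-> _] := out n x xab; rewrite !mul0r mulr0.
  have ic f : continuous f -> leb.-integrable `[a, b + 1] (EFin \o f).
    by move=> cf; apply: continuous_integrable_itv => x _; exact: cf.
  under eq_Rintegral => x _ do rewrite (derive1_is_derive (dphi x)).
  move=> E.
  have cuv : continuous (fun x => u x * v x).
    by move=> x; apply: cvgM; [exact: cu|exact: cv].
  rewrite -RintegralB//; last 2 first.
  - by apply: ic => x; apply: cvgM; [exact: cuv|exact: cb].
  - by apply: ic => x; apply: cvgM; [exact: cuv|exact: cb].
  transitivity (\int[leb]_(x in `[a, b + 1])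
    ((u x * (v' x * chi n x)) + u' x * (chi n x * v x))).
    by apply: eq_Rintegral => x _; ring.
  rewrite [LHS]RintegralD//; last 2 first.
  - apply: ic => x; apply: cvgM; first exact: cu.
    by apply: cvgM; [exact: cv'|exact: cchi].
  - apply: integrable_mul_cont => // x.
    by apply: cvgM; [exact: cchi|exact: cv].
  rewrite -[X in _ + X]opprK -E -RintegralB//; last 2 first.
  - apply: ic => x; apply: cvgM; first exact: cu.
    by apply: cvgM; [exact: cv'|exact: cchi].
  - apply: ic => x; apply: cvgM; first exact: cu.
    exact: cphi'.
  rewrite -[LHS]opprK; congr (- _).
  rewrite -[LHS]mulN1r -RintegralZl//; last first.
    apply: ic => x; apply: cvgB; (apply: cvgM; first exact: cu); last exact: cphi'.
    by apply: cvgM; [exact: cv'|exact: cchi].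
  by apply: eq_Rintegral => x _; rewrite /chi'; ring.
have ig : leb.-integrable `[a, b + 1] (EFin \o (fun x => u x * v' x + u' x * v x)).
  apply: (@integrableD _ _ _ leb _ _ (EFin \o (fun x => u x * v' x))
    (EFin \o (fun x => u' x * v x))) => //.
    apply: continuous_integrable_itv => x _.
    by apply: cvgM; [exact: cu|exact: cv'].
  exact: integrable_mul_cont.
have lim1 : \int[leb]_(x in `[a, b + 1]) ((u x * v' x + u' x * v x) * chi n x)
   @[n --> \oo] --> u b * v b - u a * v a.
  under eq_fun do rewrite test.
  rewrite -opprB; apply: cvgN; apply: cvgB.
    apply: (@approximate_identity_cvg (fun x => u x * v x)); [|lra|lra].
    by move=> x; apply: cvgM; [exact: cu|exact: cv].
  apply: (@approximate_identity_cvg (fun x => u x * v x)); [|lra|lra].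
  by move=> x; apply: cvgM; [exact: cu|exact: cv].
have lim2 : \int[leb]_(x in `[a, b + 1]) ((u x * v' x + u' x * v x) * chi n x)
   @[n --> \oo] --> \int[leb]_(x in `[a, b + 1])
      ((fun x => u x * v' x + u' x * v x) \_ `]a, b]) x.
  have [|||||_] := @Rintegral_dominated_cvg _ `[a, b + 1]
    (fun n x => (u x * v' x + u' x * v x) * chi n x)
    ((fun x => u x * v' x + u' x * v x) \_ `]a, b])
    (fun x => `|u x * v' x + u' x * v x|); last exact.
  - exact: measurable_itv.
  - move=> n; apply/measurable_EFinP; apply: (measurable_int leb).
    exact: integrable_mul_cont.
  - move=> x; rewrite /= in_itv/= => /andP[ax xb]; apply: cvg_near_cst.
    have ev c : c < x -> \forall n \near \oo, S (n.+1%:R * (x - c)) = 1.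
      move=> cx; near=> n; apply: S1.
      have xc : 0 < x - c by rewrite subr_gt0.
      rewrite -ler_pdivrMr// mul1r; apply: ltW.
      apply: (@lt_trans _ _ n%:R); last by rewrite ltr_nat.
      by near: n; exact: nbhs_infty_gtr.
    have ev0 c n : x <= c -> S (n.+1%:R * (x - c)) = 0.
      by move=> xc; apply: S0; have := n1 n; nra.
    rewrite patchE; case: ifPn; rewrite ?inE ?notin_setE/= in_itv/=.
      move=> /andP[a_x x_b]; near=> n; rewrite /chi.
      by rewrite (ev0 _ _ x_b) subr0 (near (ev _ a_x)) ?mulr1.
    move=> /negP; rewrite negb_and -leNgt -ltNge => /orP[xa|bx].
      near=> n; rewrite /chi !ev0 ?subrr ?mulr0//; lra.
    have a_x : a < x by lra.
    by near=> n; rewrite /chi (near (ev _ bx) n)// (near (ev _ a_x) n)// subrr mulr0.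
  - exact: integrable_norm.
  - move=> n x _; rewrite normrM ler_piMr// /chi.
    have := S01 (n.+1%:R * (x - a)); have := S01 (n.+1%:R * (x - b)).
    by rewrite ler_norml; lra.
have <- := cvg_unique _ lim2 lim1.
rewrite -Rintegral_mkcondr (_ : _ `&` _ = `]a, b]%classic); last first.
  apply/seteqP; split => x /=; rewrite !in_itv/=; first by case.
  by move=> /andP[ax xb]; split; [lra|rewrite ax].
rewrite Rintegral_itv_obnd_cbnd//.
apply: integrableS ig => //; apply: subset_itv; rewrite bnd_simp//; lra.
Unshelve. all: by end_near. Qed.

End weak_derivative.

(** * Tent functions and integration by parts in H^1 *)

Section h1.
Context {R : realType}.
Local Notation leb := (@lebesgue_measure R).
Implicit Types (f g u v w phi psi : R -> R) (x a b c k p q l : R).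

Lemma continuous_sqr f x : {for x, continuous f} ->
  {for x, continuous (fun x => f x ^+ 2)}.
Proof.
move=> cf; rewrite (_ : (fun x => _) = (fun x => f x * f x)); first exact: cvgM.
by apply/funext => y; rewrite expr2.
Qed.

Lemma Lnorm2_sqr f : leb.-integrable setT (EFin \o (fun x => f x ^+ 2)) ->
  ('N[leb]_2[EFin \o f] ^+ 2 = (\int[leb]_(x in setT) f x ^+ 2)%:E)%E.
Proof.
move=> fi; rewrite unlock /=.
have -> : (\int[leb]_x `|(f x)%:E| `^ 2 = (\int[leb]_(x in setT) f x ^+ 2)%:E)%E.
  rewrite /Rintegral fineK; last exact: integrable_fin_num.
  apply: eq_integral => x _ /=; congr EFin.
  by rewrite (powR_mulrn 2 (normr_ge0 _)) real_normK ?num_real.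
have I0 : 0 <= \int[leb]_(x in setT) f x ^+ 2.
  by apply: Rintegral_ge0 => x _; exact: sqr_ge0.
by rewrite poweR_EFin -EFinM powR12_sqrt// -expr2 sqr_sqrtr.
Qed.

Lemma Lfun2I f : measurable_fun setT f ->
  leb.-integrable setT (EFin \o (fun x => f x ^+ 2)) -> f \in Lfun leb 2%:E.
Proof.
move=> mf fi; rewrite inE; apply/andP; split; rewrite inE//=.
rewrite /finite_norm unlock /=; apply: poweR_lty.
move: fi => /integrableP[_]; apply: le_lt_trans.
rewrite le_eqVlt; apply/orP; left; apply/eqP; apply: eq_integral => x _ /=.
by rewrite (powR_mulrn 2 (normr_ge0 _)) real_normK ?num_real// ger0_norm// sqr_ge0.
Qed.

Lemma Rintegral_two_pieces f f1 f2 (A B : set R) : measurable A -> measurable B ->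
  leb.-integrable A (EFin \o f1) -> leb.-integrable B (EFin \o f2) ->
  (forall x, f x = (f1 \_ A) x + (f2 \_ B) x) ->
  \int[leb]_(x in setT) f x = \int[leb]_(x in A) f1 x + \int[leb]_(x in B) f2 x.
Proof.
move=> mA mB i1 i2 fE; rewrite [in RHS]Rintegral_mkcond [X in _ + X]Rintegral_mkcond.
rewrite -RintegralD//.
- exact: eq_Rintegral.
- by rewrite -restrict_EFin; exact: (proj1 (@integrable_mkcond _ _ R leb A (EFin \o f1) mA) i1).
- by rewrite -restrict_EFin; exact: (proj1 (@integrable_mkcond _ _ R leb B (EFin \o f2) mB) i2).
Qed.

Definition tent a b c x : R :=
  Num.max 0 (Num.min ((x - a) / (b - a)) ((c - x) / (c - b))).

(** At the node [b] both restrictions contribute; a representative of a weak derivative may take any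
    value at one point. *)
Definition tent' a b c x : R :=
  ((fun=> (b - a)^-1) \_ `[a, b]) x + ((fun=> - (c - b)^-1) \_ `[b, c]) x.

Section tent.
Variables (a b c : R).
Hypotheses (ab : a < b) (bc : b < c).

Let ab0 : 0 < b - a. Proof. by rewrite subr_gt0. Qed.
Let bc0 : 0 < c - b. Proof. by rewrite subr_gt0. Qed.

Lemma tentl x : a <= x <= b -> tent a b c x = (x - a) / (b - a).
Proof.
move=> /andP[ax xb]; rewrite /tent min_l; last first.
  apply: (@le_trans _ _ 1).
    by rewrite ler_pdivrMr// mul1r lerB.
  by rewrite ler_pdivlMr// mul1r lerB.
by rewrite max_r// divr_ge0 ?(ltW ab0)// subr_ge0.
Qed.

Lemma tentr x : b <= x <= c -> tent a b c x = (c - x) / (c - b).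
Proof.
move=> /andP[bx xc]; rewrite /tent min_r; last first.
  apply: (@le_trans _ _ 1).
    by rewrite ler_pdivrMr// mul1r lerB.
  by rewrite ler_pdivlMr// mul1r lerB.
by rewrite max_r// divr_ge0 ?(ltW bc0)// subr_ge0.
Qed.

Lemma tent_out x : ~ (a <= x <= c) -> tent a b c x = 0.
Proof.
move=> /negP; rewrite negb_and -!ltNge /tent => xo; rewrite max_l// ge_min.
apply/orP; case/orP : xo => x_o; [left|right].
  by rewrite pmulr_lle0 ?invr_gt0//; lra.
by rewrite pmulr_lle0 ?invr_gt0//; lra.
Qed.

Lemma continuous_tent : continuous (tent a b c).
Proof.
move=> x; apply: (@continuous_max _ _ (fun _ => 0)
  (fun x => Num.min ((x - a) / (b - a)) ((c - x) / (c - b)))).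
  exact: cvg_cst.
apply: (@continuous_min _ _ (fun x => (x - a) / (b - a)) (fun x => (c - x) / (c - b))).
  by apply: cvgM; [apply: cvgB; [exact: cvg_id|exact: cvg_cst]|exact: cvg_cst].
by apply: cvgM; [apply: cvgB; [exact: cvg_cst|exact: cvg_id]|exact: cvg_cst].
Qed.

Lemma Rintegral_tent' f : leb.-integrable `[a, b] (EFin \o f) ->
  leb.-integrable `[b, c] (EFin \o f) ->
  \int[leb]_(x in setT) (f x * tent' a b c x) =
  (\int[leb]_(x in `[a, b]) f x) / (b - a) - (\int[leb]_(x in `[b, c]) f x) / (c - b).
Proof.
move=> i1 i2; rewrite (@Rintegral_two_pieces _ (fun x => f x * (b - a)^-1)
  (fun x => f x * - (c - b)^-1) `[a, b] `[b, c]).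
- by rewrite !RintegralZr// mulrN.
- exact: measurable_itv.
- exact: measurable_itv.
- apply: (@integrableZr _ _ R leb _ _ (b - a)^-1 (EFin \o f)) => //.
- apply: (@integrableZr _ _ R leb _ _ (- (c - b)^-1) (EFin \o f)) => //.
- by move=> x; rewrite /tent' mulrDr !patchE; do 2 case: ifP => _; rewrite ?mulr0.
Qed.

(** Integrating by parts twice moves the derivatives onto the tent, whose second derivative is a
    combination of three point masses: the difference of the mean slopes of [f2] on the two sides of
    [b] remains. *)
Lemma Rintegral_tent f f1 f2 : continuous f -> (forall x, is_derive x 1 f1 (f x)) ->
  (forall x, is_derive x 1 f2 (f1 x)) ->
  \int[leb]_(x in `[a, c]) (f x * tent a b c x) =
  (f2 c - f2 b) / (c - b) - (f2 b - f2 a) / (b - a).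
Proof.
move=> cf df1 df2.
have ib : leb.-integrable `[a, c] (EFin \o (fun x => f x * tent a b c x)).
  by apply: continuous_integrable_itv => x _; apply: cvgM; [exact: cf|exact: continuous_tent].
rewrite (@Rintegral_itv_split _ _ a b c) ?(ltW ab) ?(ltW bc)//.
transitivity (\int[leb]_(x in `[a, b]) (f x * ((x - a) / (b - a))) +
   \int[leb]_(x in `[b, c]) (f x * ((c - x) / (c - b)))).
  congr (_ + _); apply: eq_Rintegral => x; rewrite inE/= in_itv/= => xab.
    by rewrite tentl.
  by rewrite tentr.
have -> : \int[leb]_(x in `[a, b]) (f x * ((x - a) / (b - a))) =
    (f1 b * (b - a) - f2 b) / (b - a) - (f1 a * (a - a) - f2 a) / (b - a).
  apply: (@integral_derive _ _ (fun x => (f1 x * (x - a) - f2 x) / (b - a)) _ _ (ltW ab)).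
    move=> x _; eapply is_derive_congr.
      by derivs; [exact: df1|exact: df2].
    by rewrite /=; ring.
  move=> x _; apply: cvgM; first exact: cf.
  by apply: cvgM; [apply: cvgB; [exact: cvg_id|exact: cvg_cst]|exact: cvg_cst].
have -> : \int[leb]_(x in `[b, c]) (f x * ((c - x) / (c - b))) =
    (f1 c * (c - c) + f2 c) / (c - b) - (f1 b * (c - b) + f2 b) / (c - b).
  apply: (@integral_derive _ _ (fun x => (f1 x * (c - x) + f2 x) / (c - b)) _ _ (ltW bc)).
    move=> x _; eapply is_derive_congr.
      by derivs; [exact: df1|exact: df2].
    by rewrite /=; ring.
  move=> x _; apply: cvgM; first exact: cf.
  by apply: cvgM; [apply: cvgB; [exact: cvg_cst|exact: cvg_id]|exact: cvg_cst].
by field; rewrite !gt_eqF.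
Qed.

Lemma weak_derivative_tent : is_weak_derivative (tent a b c) (tent' a b c).
Proof.
move=> psi psiC; have cpsi := C1c_continuous psiC.
have [Psi [_ dPsi]] := primitive_exists cpsi.
have icont a' b' f : continuous f -> leb.-integrable `[a', b'] (EFin \o f).
  by move=> cf; apply: continuous_integrable_itv => x _; exact: cf.
rewrite (@Rintegral_supp _ _ `[a, c]%classic); last first.
  by move=> x; rewrite /= in_itv/= => xac; rewrite tent_out// mul0r.
under eq_Rintegral do rewrite mulrC.
have cdpsi : continuous (derive1 psi) by case: psiC.
rewrite (Rintegral_tent cdpsi (fun x => C1c_derive x psiC) dPsi).
under [in RHS]eq_Rintegral do rewrite mulrC.
rewrite Rintegral_tent'; [|exact: icont|exact: icont].
have icp y z : y <= z -> \int[leb]_(x in `[y, z]) psi x = Psi z - Psi y.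
  by move=> yz; apply: integral_derive => // x _; exact: cpsi.
by rewrite !icp ?(ltW ab) ?(ltW bc)// opprB.
Qed.

Lemma H1_tent : is_H1 (tent a b c) (tent' a b c).
Proof.
split.
- exact: continuous_tent.
- apply: Lfun2I; first exact: (continuous_measurable_fun continuous_tent).
  apply: (@integrable_supp _ _ `[a, c]%classic); first exact: measurable_itv.
    by move=> x; rewrite /= in_itv/= => xac; rewrite tent_out// expr0n.
  apply: continuous_integrable_itv => x _.
  by apply: continuous_sqr; exact: continuous_tent.
- have mt : measurable_fun setT (tent' a b c).
    apply: measurable_funD; apply/(measurable_restrictT _ _).1; try exact: measurable_itv.
      exact: measurable_cst.
    exact: measurable_cst.
  apply: Lfun2I => //.
  apply: (@integrable_supp _ _ `[a, c]%classic); first exact: measurable_itv.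
    move=> x; rewrite /= in_itv/= => xac; rewrite /tent' !patchE !memNset ?addr0 ?expr0n//=.
      by rewrite in_itv/= => /andP[bx xc]; apply: xac; rewrite (le_trans (ltW ab) bx).
    by rewrite in_itv/= => /andP[ax xb]; apply: xac; rewrite ax (le_trans xb (ltW bc)).
  apply: (@le_integrable_real _ _ _ (fun _ => ((b - a)^-1 + (c - b)^-1) ^+ 2)).
  + exact: measurable_itv.
  + by apply: measurable_funTS; apply: measurable_funX.
  + have ? : 0 < (b - a)^-1 by rewrite invr_gt0.
    have ? : 0 < (c - b)^-1 by rewrite invr_gt0.
    move=> x _; rewrite ger0_norm ?sqr_ge0// /tent' !patchE (_ : point = 0 :> R)//.
    by do 2 case: ifP => _; nra.
  + by apply: continuous_integrable_itv => x _; exact: cvg_cst.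
- exact: weak_derivative_tent.
Qed.

End tent.

Lemma H1_parts u u' v v' a b : is_H1 u u' ->
  (forall x, is_derive x 1 v (v' x)) -> continuous v' -> a < b ->
  \int[leb]_(x in `[a, b]) (u x * v' x + u' x * v x) = u b * v b - u a * v a.
Proof.
move=> [cu _ u'L wd]; apply: weak_derivative_parts => // y z.
exact: Lfun2_integrable_itv.
Qed.

Lemma H1_increment u u' a b : is_H1 u u' -> a < b ->
  \int[leb]_(x in `[a, b]) u' x = u b - u a.
Proof.
move=> uH ab; have := @H1_parts _ _ (fun _ => 1) (fun _ => 0) a b uH
  (fun x => is_deriveR_cst 1 x) (fun x => cvg_cst _) ab.
by rewrite !mulr1 => <-; apply: eq_Rintegral => x _; rewrite mulr0 mulr1 add0r.
Qed.

End h1.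

(** * Regularity of weak solutions *)

Section classical.
Context {R : realType}.
Local Notation leb := (@lebesgue_measure R).
Implicit Types (f g u v w Y Z : R -> R) (x a b c k p q l m s : R).

Lemma powR_cvg_at0 k : 0 < k -> {for 0, continuous (fun s : R => `|s| `^ k)}.
Proof.
move=> k0; rewrite /prop_for/continuous_at normr0 powR0 ?gt_eqF//.
apply/cvgrPdist_le => /= e e0; near=> t.
rewrite sub0r normrN ger0_norm ?powR_ge0//.
have -> : e = (e `^ k^-1) `^ k by rewrite -powRrM mulVf ?gt_eqF// powRr1// ltW.
apply: ge0_ler_powR; rewrite ?nnegrE ?powR_ge0 ?(ltW k0)//.
near: t; have : 0 < e `^ k^-1 by exact: powR_gt0.
move=> d0; have := @cvg_id _ (nbhs (0:R)); move/cvgrPdist_le => /(_ _ d0).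
by apply: filterS => t /=; rewrite sub0r normrN.
Unshelve. all: by end_near. Qed.

Lemma powR_continuous k x : 0 < x -> {for x, continuous (fun s : R => s `^ k)}.
Proof. by move=> x0; exact: is_derive_continuous (is_derive1_powR k x0). Qed.

Lemma continuous_norm_powR k : 0 < k -> continuous (fun s : R => `|s| `^ k).
Proof.
move=> k0 x; have [->|x0] := eqVneq x 0; first exact: powR_cvg_at0.
apply: (@continuous_comp _ _ _ (fun s : R => `|s|) (fun s => s `^ k)).
  exact: norm_continuous.
by apply: powR_continuous; rewrite normr_gt0.
Qed.

Lemma continuous_signed_power p : 2 < p -> continuous (@signed_power R p).
Proof.
move=> p2 x; apply: cvgM; last exact: cvg_id.
by apply: continuous_norm_powR; rewrite subr_gt0.
Qed.

Lemma signed_powerN p s : signed_power p (- s) = - signed_power p s.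
Proof. by rewrite /signed_power normrN mulrN. Qed.

Lemma signed_power_pos p s : 0 < s -> signed_power p s = s `^ (p - 1).
Proof.
move=> s0; rewrite /signed_power gtr0_norm//.
rewrite -{2}(powRr1 (ltW s0)) -powRD; first by congr (_ `^ _); ring.
by apply/implyP => _; rewrite gt_eqF.
Qed.

Lemma signed_powerM p s : signed_power p s * s = `|s| `^ (p - 2) * s ^+ 2.
Proof. by rewrite /signed_power -mulrA -expr2. Qed.

(** The derivative of a tent is piecewise constant, so [u'] enters only through increments of [u]:
    the weak equation becomes an identity on difference quotients in which no weak derivative
    appears. *)
Lemma weak_solution_tent p q l u a b c : 2 < p -> is_weak_solution p q l u ->
  a < b -> b < c ->
  (u b - u a) / (b - a) - (u c - u b) / (c - b) +
  \int[leb]_(x in `[a, c]) ((l * u x + signed_power p (u x)) * tent a b c x) =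
  signed_power q (u 0) * tent a b c 0.
Proof.
move=> p2 [u' uH weak] ab bc; have := weak _ _ (H1_tent ab bc).
have [cu _ u'L _] := uH.
have csp : continuous (fun x => signed_power p (u x)).
  by move=> x; apply: continuous_comp; [exact: cu|exact: continuous_signed_power].
rewrite Rintegral_tent'; [|exact: Lfun2_integrable_itv|exact: Lfun2_integrable_itv].
rewrite !(H1_increment uH)//.
have ct := @continuous_tent R a b c.
rewrite (@Rintegral_supp _ (fun x => signed_power p (u x) * _) `[a, c]%classic); last first.
  by move=> x; rewrite /= in_itv/= => xac; rewrite tent_out// mulr0.
rewrite (@Rintegral_supp _ (fun x => u x * _) `[a, c]%classic); last first.
  by move=> x; rewrite /= in_itv/= => xac; rewrite tent_out// mulr0.
have i1 : leb.-integrable `[a, c] (EFin \o (fun x => u x * tent a b c x)).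
  by apply: continuous_integrable_itv => x _; apply: cvgM; [exact: cu|exact: ct].
have i2 : leb.-integrable `[a, c] (EFin \o (fun x => signed_power p (u x) * tent a b c x)).
  by apply: continuous_integrable_itv => x _; apply: cvgM; [exact: csp|exact: ct].
have i3 : leb.-integrable `[a, c] (EFin \o (fun x => l * (u x * tent a b c x))).
  apply: continuous_integrable_itv => x _; apply: cvgM; first exact: cvg_cst.
  by apply: cvgM; [exact: cu|exact: ct].
have -> : \int[leb]_(x in `[a, c]) ((l * u x + signed_power p (u x)) * tent a b c x) =
    l * \int[leb]_(x in `[a, c]) (u x * tent a b c x) +
    \int[leb]_(x in `[a, c]) (signed_power p (u x) * tent a b c x).
  rewrite -RintegralZl//= -RintegralD//=.
  by apply: eq_Rintegral => x _; ring.
lra.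
Qed.

(* [ode p l Y Z]: on the closed half-line, [Y] solves [Y'' = l Y + |Y|^(p-2) Y]
   with [Z = Y'].  Derivatives at 0 are two-sided: [Y] and [Z] are extended to the
   left of 0 in an arbitrary differentiable way. *)
Definition ode p l Y Z : Prop := forall x, 0 <= x ->
  is_derive x 1 Y (Z x) /\ is_derive x 1 Z (l * Y x + signed_power p (Y x)).

(* Applied to the difference of a weak solution and a second primitive of
   [l u + |u|^(p-2) u]; the right-hand side is the contribution of the jump at 0. *)
Lemma affine_of_slopes (h : R -> R) (K : R) :
  (forall a b c, a < b -> b < c ->
    (h c - h b) / (c - b) - (h b - h a) / (b - a) = - K * tent a b c 0) ->
  exists sp sm, [/\ sp - sm = - K, forall x, 0 <= x -> h x = h 0 + sp * x &
    forall x, x <= 0 -> h x = h 0 + sm * x].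
Proof.
(* A tent with 0 as an end of its support vanishes at 0, so slopes agree within each half-line and
   can be read off at the nodes 1 and -1; the tent centred at 0 gives the jump between them. *)
move=> H; exists (h 1 - h 0), (h 0 - h (-1)); split.
- have N10 : (-1 : R) < 0 by lra.
  have := H (-1) 0 1 N10 ltr01; rewrite tentl ?lexx ?(ltW N10)//.
  by rewrite !sub0r !opprK !subr0 !divr1 mulr1.
- have t0 b c : 0 < b -> b < c -> tent 0 b c 0 = 0 :> R.
    by move=> b0 bc; rewrite tentl ?lexx ?ltW// subrr mul0r.
  move=> x; rewrite le_eqVlt => /predU1P[<-|x0]; first by rewrite /=; ring.
  have [x1|x1|->] := ltgtP x 1; last by rewrite /=; ring.
  + have := H 0 x 1 x0 x1; rewrite t0// mulr0 !subr0.
    have x1' : 1 - x != 0 by lra.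
    have x0' : x != 0 by lra.
    move=> /eqP; rewrite subr_eq0 => /eqP E.
    have : (h 1 - h x) * x = (h x - h 0) * (1 - x).
      have -> : (h 1 - h x) * x = (h 1 - h x) / (1 - x) * (x * (1 - x)) by field.
      by rewrite E; field.
    by lra.
  + have := H 0 1 x ltr01 x1; rewrite t0// mulr0 !subr0 divr1.
    have x1' : x - 1 != 0 by lra.
    move=> /eqP; rewrite subr_eq0 => /eqP E.
    have : h x - h 1 = (h 1 - h 0) * (x - 1) by rewrite -E divfK.
    by lra.
- have t0 a b : a < b -> b < 0 -> tent a b 0 0 = 0 :> R.
    by move=> ab b0; rewrite tentr ?lexx ?ltW// subrr mul0r.
  have N10 : (-1 : R) < 0 by lra.
  move=> x; rewrite le_eqVlt => /predU1P[->|x0]; first by rewrite /=; ring.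
  have [x1|x1|->] := ltgtP x (-1); last by rewrite /=; ring.
  + have := H x (-1) 0 x1 N10; rewrite t0// mulr0 !sub0r opprK divr1.
    have x1' : -1 - x != 0 by lra.
    move=> /eqP; rewrite subr_eq0 => /eqP E.
    have : h (-1) - h x = (h 0 - h (-1)) * (-1 - x) by rewrite E divfK.
    by lra.
  + have := H (-1) x 0 x1 x0; rewrite t0// mulr0 !sub0r !opprK.
    have x1' : x + 1 != 0 by lra.
    have x0' : x != 0 by lra.
    move=> /eqP; rewrite subr_eq0 => /eqP E.
    have : (h 0 - h x) * (x + 1) = - x * (h x - h (-1)).
      have -> : (h 0 - h x) * (x + 1) = (h 0 - h x) / (- x) * (- x * (x + 1)).
        by field.
      by rewrite E; field.
    by lra.
Qed.

Lemma weak_solution_classical p q l u : 2 < p -> is_weak_solution p q l u ->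
  exists Yp Zp Ym Zm, [/\ ode p l Yp Zp, ode p l Ym Zm,
    forall x, 0 <= x -> Yp x = u x, forall x, 0 <= x -> Ym x = u (- x) &
    - Zp 0 - Zm 0 = signed_power q (u 0)].
Proof.
move=> p2 weak; have [_ [cu _ _ _] _] := weak.
pose g x := l * u x + signed_power p (u x).
have cg : continuous g.
  move=> x; apply: cvgD; first by apply: cvgM; [exact: cvg_cst|exact: cu].
  by apply: continuous_comp; [exact: cu|exact: continuous_signed_power].
have [G [_ dG]] := primitive_exists cg.
have cG : continuous G by move=> x; exact: is_derive_continuous (dG x).
have [w [w0 dw]] := primitive_exists cG.
have [|sp [sm [spm hp hm]]] := @affine_of_slopes (fun x => u x - w x) (signed_power q (u 0)).
  move=> a b c ab bc; have := weak_solution_tent p2 weak ab bc.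
  rewrite (Rintegral_tent ab bc cg dG dw) => E.
  by rewrite mulNr -E; ring.
(* These formulas are differentiable on the whole line, which provides the two-sided derivatives at
   0 that [ode] asks for. The left half-line is reflected onto the right one. *)
exists (fun x => w x + (u 0 - w 0 + sp * x)), (fun x => G x + sp),
  (fun x => w (- x) + (u 0 - w 0 + - sm * x)), (fun x => - G (- x) + - sm).
have Ep x : 0 <= x -> w x + (u 0 - w 0 + sp * x) = u x.
  by move=> x0; rewrite -hp//; ring.
have Em x : 0 <= x -> w (- x) + (u 0 - w 0 + - sm * x) = u (- x).
  by move=> x0; have := hm (- x); rewrite oppr_le0 => /(_ x0); lra.
split => //.
- move=> x x0; split.
    eapply is_derive_congr; first by derivs; exact: dw.
    by rewrite /=; ring.
  eapply is_derive_congr; first by derivs; exact: dG.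
  by rewrite Ep// /g; ring.
- move=> x x0; split.
    eapply is_derive_congr.
      derivs; notypeclasses refine (is_deriveR_comp _ _); [exact: dw|by derivs].
    by rewrite /=; ring.
  eapply is_derive_congr.
    derivs; notypeclasses refine (is_deriveR_comp _ _); [exact: dG|by derivs].
  by rewrite Em// /g; ring.
- by rewrite oppr0; lra.
Qed.

End classical.

(** * The equation on a half-line *)

Section halfline.
Context {R : realType}.
Implicit Types (Y Z W : R -> R) (x y a p l m s t : R).

(** The difference quotient at 0 is [k] itself, so continuity of [k] there suffices. This
    differentiates [|t|^p] at 0, where the rule for positive bases does not apply. *)
Lemma derive_mul_id (k : R -> R) : {for 0, continuous k} ->
  is_derive (0 : R) 1 (fun t => t * k t) (k 0).
Proof.
move=> ck.
have H : (fun h : R => h^-1 *: (((fun t : R => t * k t) \o shift 0) (h *: 1) - 0 * k 0))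
    @ 0^' --> k 0.
  apply: (@cvg_trans _ (k @ 0^')); last exact: cvg_within_filter.
  apply: near_eq_cvg; near=> h.
  have h0 : h != 0 by near: h; exact: nbhs_dnbhs_neq.
  by rewrite /GRing.scale/= mulr1 addr0 mul0r subr0 mulKf.
by apply: DeriveDef; [exact: cvgP H|exact: cvg_lim].
Unshelve. all: by end_near. Qed.

Lemma norm_powR_split p s : 2 < p -> `|s| `^ p = s * signed_power p s.
Proof.
move=> p2; have [->|s0] := eqVneq s 0.
  by rewrite mul0r normr0 powR0//; lra.
rewrite mulrC signed_powerM -(real_normK (num_real s)).
rewrite -(powR_mulrn 2 (normr_ge0 _)) -powRD; first by congr (_ `^ _); ring.
by apply/implyP => _; rewrite normr_eq0.
Qed.

Lemma is_derive_norm_powR p s : 2 < p ->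
  is_derive s 1 (fun t : R => `|t| `^ p) (p * signed_power p s).
Proof.
move=> p2; have [s0|s0|->] := ltgtP s 0.
- have d : is_derive s 1 (fun t : R => (- t) `^ p) (p * (- s) `^ (p - 1) * - 1).
    by apply: (is_deriveR_powR (f := fun t => - t) _ _
      (is_deriveR_N (is_deriveR_id s))); rewrite oppr_gt0.
  have := near_eq_is_derive (f := fun t : R => (- t) `^ p) (g := fun t : R => `|t| `^ p) _ d.
  move=> /(_ _)/is_derive_congr; apply.
    near=> t; rewrite ler0_norm//; apply: ltW; near: t; exact: lt_nbhsl.
  rewrite -[in RHS](opprK s) signed_powerN signed_power_pos ?oppr_gt0//.
  by ring.
- have d : is_derive s 1 (fun t : R => t `^ p) (p * s `^ (p - 1) * 1).
    exact: (is_deriveR_powR (f := fun t => t) _ s0 (is_deriveR_id s)).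
  have := near_eq_is_derive (f := fun t : R => t `^ p) (g := fun t : R => `|t| `^ p) _ d.
  move=> /(_ _)/is_derive_congr; apply.
    near=> t; rewrite ger0_norm//; apply: ltW; near: t; exact: lt_nbhsr.
  by rewrite signed_power_pos// mulr1.
- rewrite (_ : (fun t => _) = fun t => t * signed_power p t); last first.
    by apply/funext => t; exact: norm_powR_split.
  apply: is_derive_congr.
    by apply: derive_mul_id; exact: continuous_signed_power.
  by rewrite /signed_power !mulr0.
Unshelve. all: by end_near. Qed.

Definition speed p l s : R := s * Num.sqrt (l + 2 / p * s `^ (p - 2)).

Section decay.
Variables (p l m : R) (Y Z W : R -> R).
Hypotheses (p2 : 2 < p) (l0 : 0 <= l) (YZ : ode p l Y Z).
(** Square integrability of [Y] on the half-line, stated as boundedness of a primitive of [Y^2]. *)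
Hypotheses (dW : forall x, 0 <= x -> is_derive x 1 W (Y x ^+ 2)) (W0 : W 0 = 0)
  (Wm : forall x, 0 <= x -> W x <= m).

Let dY x : 0 <= x -> is_derive x 1 Y (Z x). Proof. by move=> /YZ[]. Qed.
Let dZ x : 0 <= x -> is_derive x 1 Z (l * Y x + signed_power p (Y x)).
Proof. by move=> /YZ[]. Qed.

Let m0 : 0 <= m. Proof. by rewrite -W0; exact: Wm. Qed.

Let W_ge0 x : 0 <= x -> 0 <= W x.
Proof.
move=> x0; rewrite -W0; apply: (@ge0_derive_le _ W (fun x => Y x ^+ 2)) => // y.
  by move=> /andP[y0 _]; exact: dW.
by move=> _; exact: sqr_ge0.
Qed.

(* [Y^2] is convex: if its derivative were positive at [x], then [Y^2] would grow at
   least linearly, and its primitive [W] would be unbounded. *)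
Lemma ode_sqr_nonincreasing_at x : 0 <= x -> Y x * Z x <= 0.
Proof.
have l0' := l0; have m0' := m0.
move=> x0; rewrite leNgt; apply/negP => c0; set c := Y x * Z x in c0.
have cle y : x <= y -> c <= Y y * Z y.
  move=> xy; apply: (@ge0_derive_le _ (fun y => Y y * Z y)
    (fun y => Y y * (l * Y y + signed_power p (Y y)) + Z y * Z y)) => // z /andP[xz _].
    by apply: is_deriveR_M; [apply: dY|apply: dZ]; exact: le_trans xz.
  rewrite mulrDr (mulrC _ (signed_power _ _)) signed_powerM -expr2.
  have := mulr_ge0 l0 (sqr_ge0 (Y z)).
  have := mulr_ge0 (powR_ge0 `|Y z| (p - 2)) (sqr_ge0 (Y z)).
  by have := sqr_ge0 (Z z); set P := _ `^ _; lra.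
have Vle y : x <= y -> 2 * c * (y - x) <= Y y ^+ 2.
  move=> xy; suff : 2 * c * (y - x) - 2 * c * (x - x) <= Y y ^+ 2 - Y x ^+ 2.
    by have := sqr_ge0 (Y x); lra.
  apply: (@le_derive_le _ (fun y => 2 * c * (y - x)) (fun y => Y y ^+ 2)
    (fun _ => 2 * c) (fun y => 2 * (Y y * Z y))) => // z /andP[xz _].
  - by eapply is_derive_congr; [derivs|rewrite /=; ring].
  - have dYz := dY (le_trans x0 xz).
    by eapply is_derive_congr; [derivs|rewrite /=; ring].
  - by have := cle _ xz; lra.
have Wle y : x <= y -> c * (y - x) ^+ 2 <= m.
  move=> xy; suff : c * (y - x) ^+ 2 - c * (x - x) ^+ 2 <= W y - W x.
    by have := W_ge0 x0; have := Wm (le_trans x0 xy); rewrite subrr; lra.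
  apply: (@le_derive_le _ (fun y => c * (y - x) ^+ 2) W
    (fun y => 2 * c * (y - x)) (fun y => Y y ^+ 2)) => // z /andP[xz _].
  - by eapply is_derive_congr; [derivs|rewrite /=; ring].
  - by apply: dW; exact: le_trans xz.
  - exact: Vle.
(* At this distance the lower bound [c * (m / c + 1) ^+ 2] is at least [2 * m + c], which exceeds
   [m]. *)
have := Wle (x + (m / c + 1)); have mc : 0 <= m / c by rewrite divr_ge0// ltW.
rewrite lerDl addr_ge0// (addrC x) addrK => /(_ isT).
have E : c * (m / c) = m by rewrite mulrC divfK// gt_eqF.
set d := m / c in mc E *; nra.
Qed.

Lemma ode_sqr_nonincreasing x y : 0 <= x -> x <= y -> Y y ^+ 2 <= Y x ^+ 2.
Proof.
move=> x0 xy; rewrite -lerN2; apply: (@ge0_derive_le _ (fun y => - Y y ^+ 2)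
  (fun y => - (2 * (Y y * Z y)))) => // z /andP[xz _].
  have dYz := dY (le_trans x0 xz).
  by eapply is_derive_congr; [derivs|rewrite /=; ring].
by have := ode_sqr_nonincreasing_at (le_trans x0 xz); lra.
Qed.

(** As [Y^2] is nonincreasing, [W x] is at least the area of a rectangle with base [x] and height
    [Y x ^+ 2]. *)
Lemma ode_sqr_decay x : 0 <= x -> x * Y x ^+ 2 <= m.
Proof.
move=> x0; apply: le_trans (Wm x0).
suff : x * Y x ^+ 2 - 0 * Y x ^+ 2 <= W x - W 0 by rewrite W0 mul0r !subr0.
apply: (@le_derive_le _ (fun y => y * Y x ^+ 2) W (fun _ => Y x ^+ 2)
  (fun y => Y y ^+ 2)) => // y /andP[y0 yx].
- by eapply is_derive_congr; [derivs|rewrite /=; ring].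
- exact: dW.
- exact: ode_sqr_nonincreasing.
Qed.

(** The energy [e] is constant, so it is enough to make it small somewhere. The mean value theorem
    on an interval of length 1 starting at [N] gives a point where [Z^2] is at most [4 * Y N ^+ 2],
    and [N * Y N ^+ 2 <= m] then makes the energy of order [1 / N]. *)
Lemma ode_energy x : 0 <= x -> Z x ^+ 2 = l * Y x ^+ 2 + 2 / p * `|Y x| `^ p.
Proof.
have p2' := p2; have l0' := l0.
pose e y := Z y ^+ 2 - (l * Y y ^+ 2 + 2 / p * `|Y y| `^ p).
have p0 : p != 0 by rewrite gt_eqF//; lra.
have econst y : 0 <= y -> e y = e 0.
  move=> y0; suff : e y - e 0 = 0 - 0 :> R by lra.
  apply: (@eq_derive_eq _ e (fun _ => 0) (fun _ => 0)) => // z /andP[z0 _].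
  have dYz := dY z0; have dZz := dZ z0.
  have dPz : is_derive z 1 (fun y => `|Y y| `^ p) (p * signed_power p (Y z) * Z z).
    exact: (is_deriveR_comp (f := fun t : R => `|t| `^ p) (is_derive_norm_powR _ p2) dYz).
  by eapply is_derive_congr; [rewrite /e; derivs|rewrite /=; field].
suff e0 : e 0 = 0 by move=> x0; have := econst _ x0; rewrite e0 /e; lra.
(* The constant collects 4 from [Z^2], [l] from the linear term and 1 from the power term, since
   [2 / p <= 1] and [|Y|^p <= Y^2] once [m <= n.+1%:R] has forced [|Y| <= 1]. *)
have bound n : m <= n.+1%:R -> `|e 0| * n.+1%:R <= (5 + l) * m.
  move=> mn; have n0 : 0 < n.+1%:R :> R by rewrite ltr0n.
  have nn : n.+1%:R <= n.+1%:R + 1 :> R by rewrite lerDl.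
  have dYn (z : R) : n.+1%:R <= z <= n.+1%:R + 1 -> is_derive z 1 Y (Z z).
    by move=> /andP[nx _]; apply: dY; exact: le_trans nx.
  have [t /andP[nt tn] E] := mean_value nn dYn.
  have t0 : 0 <= t by exact: le_trans nt.
  rewrite (addrC n.+1%:R) addrK mulr1 in E.
  have Vn := ode_sqr_decay (ltW n0); set N : R := n.+1%:R in n0 mn E nt tn Vn *.
  have Vn1 : Y (1 + N) ^+ 2 <= Y N ^+ 2.
    by apply: ode_sqr_nonincreasing; [exact: ltW|rewrite lerDr].
  have Vt : Y t ^+ 2 <= Y N ^+ 2 by apply: ode_sqr_nonincreasing => //; exact: ltW.
  have Z2 : Z t ^+ 2 <= 4 * Y N ^+ 2.
    by rewrite -E; have := sqr_ge0 (Y (1 + N) + Y N); nra.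
  have Pt : `|Y t| `^ p <= Y N ^+ 2.
    have [->|Yt0] := eqVneq (Y t) 0; first by rewrite normr0 powR0// sqr_ge0.
    apply: (le_trans _ Vt); rewrite -(real_normK (num_real (Y t))).
    rewrite -(powR_mulrn 2 (normr_ge0 _)); apply: ger_powR; last exact: ltW.
    rewrite normr_gt0 Yt0/= -(ler_pXn2r (ltn0Sn 1)) ?nnegrE// expr1n.
    rewrite real_normK ?num_real//; apply: (le_trans Vt).
    by rewrite -(ler_pM2l n0) mulr1; exact: (le_trans Vn mn).
  have P0 := powR_ge0 `|Y t| p.
  have p'0 : 0 <= 2 / p <= 1.
    by rewrite divr_ge0//= ?ler_pdivrMr ?mul1r; lra.
  have el : `|e 0| <= (5 + l) * Y N ^+ 2.
    rewrite -(econst t t0) /e ler_norml.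
    have := sqr_ge0 (Y t); have := sqr_ge0 (Z t); have := sqr_ge0 (Y N).
    move: p'0 => /andP[]; set k := 2 / p; move=> *; apply/andP; split; nra.
  apply: (@le_trans _ _ ((5 + l) * (N * Y N ^+ 2))).
    by rewrite (mulrC N) mulrA ler_pM2r.
  by apply: (ler_wpM2l _ Vn); lra.
apply/eqP; rewrite -normr_eq0; apply: contraT => e0.
have {}e0 : 0 < `|e 0| by rewrite lt_def e0 normr_ge0.
pose M := m + (5 + l) * m / `|e 0|.
have MM : 0 <= (5 + l) * m / `|e 0|.
  by rewrite divr_ge0 ?normr_ge0// mulr_ge0//; lra.
have := bound (Num.bound M); have := archi_boundP (addr_ge0 m0 MM); rewrite -/M => HM.
have HM1 : M < (Num.bound M).+1%:R by apply: lt_le_trans HM _; rewrite ler_nat.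
have lt1 : (5 + l) * m < `|e 0| * (Num.bound M).+1%:R.
  rewrite (mulrC `|e 0|) -ltr_pdivrMr//; apply: le_lt_trans HM1.
  by rewrite /M lerDr.
have m_M : m <= (Num.bound M).+1%:R by apply: ltW; apply: le_lt_trans HM1; rewrite lerDl.
by move=> /(_ m_M); rewrite leNgt lt1.
Qed.

Variable a : R.
Hypotheses (a0 : 0 < a) (Y0 : Y 0 = a).

(** Zero energy gives [|Y Z| <= C Y^2], so [Y^2 exp(2 C x)] is nondecreasing and a positive height
    cannot reach 0. The summand 1 in [C] ensures [C <= C^2], which turns the bound on [(Y Z)^2] into
    one on [|Y Z|]. *)
Lemma ode_pos x : 0 <= x -> 0 < Y x.
Proof.
have p2' := p2; have l0' := l0; have a0' := a0.
pose C := l + 2 / p * a `^ (p - 2) + 1.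
have p'0 : 0 <= 2 / p by rewrite divr_ge0//; lra.
have C1 : 1 <= C.
  by rewrite /C lerDr addr_ge0// mulr_ge0// powR_ge0.
have Ya y : 0 <= y -> `|Y y| <= a.
  move=> y0; have := ode_sqr_nonincreasing (lexx 0) y0; rewrite Y0 => h.
  by rewrite -(ler_pXn2r (ltn0Sn 1)) ?nnegrE ?(ltW a0)// real_normK ?num_real.
have YZC y : 0 <= y -> - (C * Y y ^+ 2) <= Y y * Z y.
  move=> y0; suff : `|Y y * Z y| <= C * Y y ^+ 2 by rewrite ler_norml => /andP[].
  have CY : 0 <= C * Y y ^+ 2 by rewrite mulr_ge0 ?sqr_ge0//; lra.
  rewrite -(ler_pXn2r (ltn0Sn 1)) ?nnegrE// real_normK ?num_real//.
  rewrite exprMn ode_energy// norm_powR_split// (mulrC _ (signed_power _ _)) signed_powerM.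
  have : `|Y y| `^ (p - 2) <= a `^ (p - 2).
    by apply: ge0_ler_powR; rewrite ?nnegrE ?(ltW a0) ?Ya//; lra.
  have := sqr_ge0 (Y y); have := powR_ge0 `|Y y| (p - 2).
  set V := Y y ^+ 2; set P := _ `^ _; set A := _ `^ _ => P0 V0 PA.
  have -> : V * (l * V + 2 / p * (P * V)) = (l + 2 / p * P) * V ^+ 2 by ring.
  rewrite [leRHS]exprMn; apply: (ler_wpM2r (sqr_ge0 V)).
  apply: (@le_trans _ _ C); first by have := ler_wpM2l p'0 PA; rewrite /C -/A; lra.
  by rewrite expr2; nra.
have Yn0 y : 0 <= y -> Y y != 0.
  move=> y0; apply/eqP => Yy.
  have : Y 0 ^+ 2 * expR (2 * C * 0) <= Y y ^+ 2 * expR (2 * C * y).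
    apply: (@ge0_derive_le _ (fun y => Y y ^+ 2 * expR (2 * C * y))
      (fun y => expR (2 * C * y) * (2 * (Y y * Z y + C * Y y ^+ 2)))) => // z /andP[z0 _].
      have dYz := dY z0.
      by eapply is_derive_congr; [derivs|rewrite /=; ring].
    by apply: mulr_ge0; [exact: expR_ge0|have := YZC _ z0; lra].
  by rewrite Yy Y0 mulr0 expR0 mulr1 expr0n/= mul0r; have := exprn_gt0 2 a0; lra.
move=> x0; rewrite ltNge; apply/negP => Yx.
have [||c /andP[c0 _] Yc] := @continuous_intermediate _ Y 0 x 0 x0.
- by move=> y /andP[y0 _]; exact: is_derive_continuous (dY y0).
- by rewrite Yx Y0 (ltW a0) orbT.
- by have := Yn0 c c0; rewrite Yc eqxx.
Qed.

Lemma ode_speed x : 0 <= x -> Z x = - speed p l (Y x).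
Proof.
have p2' := p2; have l0' := l0.
move=> x0; have Yx := ode_pos x0.
have Zx : Z x <= 0 by have := ode_sqr_nonincreasing_at x0; rewrite pmulr_rle0.
rewrite /speed; set f := l + _.
have p'0 : 0 <= 2 / p by rewrite divr_ge0//; lra.
have f0 : 0 <= f by rewrite addr_ge0// mulr_ge0// powR_ge0.
have : (- Z x) ^+ 2 = (Y x * Num.sqrt f) ^+ 2.
  rewrite sqrrN ode_energy// exprMn sqr_sqrtr// norm_powR_split//.
  rewrite (mulrC _ (signed_power _ _)) signed_powerM gtr0_norm// /f; ring.
move=> /eqP; rewrite eqrXn2 ?oppr_ge0 ?mulr_ge0 ?sqrtr_ge0 ?(ltW Yx)// => /eqP <-.
by rewrite opprK.
Qed.

End decay.

Lemma speed_le p l s t : 2 < p -> 0 <= l -> 0 <= s -> s <= t ->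
  speed p l s <= speed p l t.
Proof.
move=> p2 l0 s0 st; have p'0 : 0 <= 2 / p by rewrite divr_ge0//; lra.
apply: ler_pM => //.
apply: ler_wsqrtr; rewrite lerD2l; apply: ler_wpM2l => //.
by apply: ge0_ler_powR; rewrite ?nnegrE//; lra.
Qed.

(* [speed] is nondecreasing, so the squared distance of two solutions of
   [Y' = - speed Y] is nonincreasing. *)
Lemma speed_ode_unique p l (Y1 Y2 : R -> R) : 2 < p -> 0 <= l -> Y1 0 = Y2 0 ->
  (forall x, 0 <= x -> 0 < Y1 x) -> (forall x, 0 <= x -> 0 < Y2 x) ->
  (forall x, 0 <= x -> is_derive x 1 Y1 (- speed p l (Y1 x))) ->
  (forall x, 0 <= x -> is_derive x 1 Y2 (- speed p l (Y2 x))) ->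
  forall x, 0 <= x -> Y1 x = Y2 x.
Proof.
move=> p2 l0 Y12 Y10 Y20 d1 d2 x x0.
have : - (Y1 0 - Y2 0) ^+ 2 <= - (Y1 x - Y2 x) ^+ 2.
  apply: (@ge0_derive_le _ (fun x => - (Y1 x - Y2 x) ^+ 2)
    (fun x => 2 * (Y1 x - Y2 x) * (speed p l (Y1 x) - speed p l (Y2 x)))) => // y /andP[y0 _].
    have e1 := d1 _ y0; have e2 := d2 _ y0.
    by eapply is_derive_congr; [derivs|rewrite /=; ring].
  have [y12|y12] := leP (Y1 y) (Y2 y).
    by have := speed_le p2 l0 (ltW (Y10 _ y0)) y12; nra.
  by have := speed_le p2 l0 (ltW (Y20 _ y0)) (ltW y12); nra.
rewrite Y12 subrr expr0n/= oppr0 oppr_ge0 => le0.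
have /eqP : (Y1 x - Y2 x) ^+ 2 = 0 by apply/eqP; rewrite eq_le le0 sqr_ge0.
by rewrite sqrf_eq0 subr_eq0 => /eqP.
Qed.

End halfline.

(** * The mass of a half-line profile, at positive and zero frequency *)

Section mass.
Context {R : realType}.
Implicit Types (Y W L : R -> R) (x y a p l m n r s t T : R).

Lemma powR_sqr s r : 0 < s -> (s ^+ 2) `^ r = s `^ (2 * r).
Proof. by move=> s0; rewrite -(powR_mulrn 2 (ltW s0)) -powRrM. Qed.

Lemma powRV s r : 0 < s -> s^-1 `^ r = (s `^ r)^-1.
Proof. by move=> s0; rewrite -(powR_inv1 (ltW s0)) -powRrM mulN1r powRN. Qed.

Lemma powR_mulD s r t : 0 < s -> s `^ r * s `^ t = s `^ (r + t).
Proof. by move=> s0; rewrite powRD// (gt_eqF s0) implybT. Qed.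

Lemma powR_mulS s r : 0 < s -> s * s `^ r = s `^ (1 + r).
Proof. by move=> s0; rewrite -powR_mulD// powRr1// ltW. Qed.

Lemma sqrt_powR s r : Num.sqrt (s `^ r) = s `^ (r / 2).
Proof. by rewrite -powR12_sqrt ?powR_ge0// -powRrM. Qed.

(** [L T] is the integral of [(1 + t^n)^(-1/2)] from 0 to [T]. The absolute value continues the
    integrand to the left, so that [L] has a two-sided derivative at 0. *)
Definition mass_primitive n L : Prop :=
  L 0 = 0 /\ forall t : R, is_derive t 1 L (Num.sqrt (1 + `|t| `^ n))^-1.

Lemma mass_primitive_exists n : 0 < n -> exists L, mass_primitive n L.
Proof.
move=> n0; apply: primitive_exists => t.
have p0 : 0 < 1 + `|t| `^ n by rewrite ltr_pwDl// powR_ge0.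
apply: cvgV; first by rewrite gt_eqF// sqrtr_gt0.
apply: continuous_comp; last exact: sqrt_continuous.
by apply: cvgD; [exact: cvg_cst|exact: continuous_norm_powR].
Qed.

Lemma ode_decay_cvg Y m : (forall x, 0 <= x -> x * Y x ^+ 2 <= m) ->
  Y x @[x --> +oo] --> 0.
Proof.
move=> H; apply/cvgrPdist_le => /= e e0; near=> x.
have x0 : 0 < x by near: x; exact: nbhs_pinfty_gt.
have xm : `|m| / e ^+ 2 < x by near: x; apply: nbhs_pinfty_gt; rewrite num_real.
rewrite sub0r normrN -(ler_pXn2r (ltn0Sn 1)) ?nnegrE ?(ltW e0)// real_normK ?num_real//.
rewrite -(ler_pM2l x0); apply: le_trans (H x (ltW x0)) _.
apply: le_trans (ler_norm m) _; apply: ltW.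
by rewrite -ltr_pdivrMr// exprn_gt0.
Unshelve. all: by end_near. Qed.

Section speed_mass.
Variables (p l a : R) (Y W : R -> R).
Hypotheses (p2 : 2 < p) (l0 : 0 <= l).
Hypotheses (Ypos : forall x, 0 <= x -> 0 < Y x) (Y0 : Y 0 = a)
  (dY : forall x, 0 <= x -> is_derive x 1 Y (- speed p l (Y x)))
  (cY : Y x @[x --> +oo] --> 0).
Hypotheses (dW : forall x, 0 <= x -> is_derive x 1 W (Y x ^+ 2)) (W0 : W 0 = 0).

Let a0 : 0 < a. Proof. by rewrite -Y0; exact: Ypos. Qed.

Lemma speed_ode_le x : 0 <= x -> Y x <= a.
Proof.
move=> x0; rewrite -Y0 -lerN2.
apply: (@ge0_derive_le _ (fun y => - Y y) (fun y => speed p l (Y y))) => // y /andP[y0 _].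
  by rewrite -[speed _ _ _]opprK; exact: (is_deriveR_N (dY y0)).
by rewrite /speed mulr_ge0 ?sqrtr_ge0// ltW// Ypos.
Qed.

Lemma mass_positive_frequency L T : 0 < l -> mass_primitive ((p - 2) / 2) L -> 0 < T ->
  T `^ ((p - 2) / 2) = 2 / (p * l) * a `^ (p - 2) ->
  W x @[x --> +oo] --> a ^+ 2 * L T / (2 * T * Num.sqrt l).
Proof.
move=> lgt0 [L0 dL] T0 TE; have p2' := p2; have a0' := a0.
(* Scaling for which [(sg * Y^2)^n = 2 / (p * l) * Y^(p-2)] with [n = (p - 2) / 2]: the root in
   [speed] becomes [sqrt l] divided by the derivative of [L] at [sg * Y^2]. *)
pose sg := T / a ^+ 2.
have a20 : 0 < a ^+ 2 by rewrite exprn_gt0.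
have sg0 : 0 < sg by rewrite divr_gt0.
have pgt0 : 0 < p by lra.
have sl0 : 0 < Num.sqrt l by rewrite sqrtr_gt0.
have sgE : sg `^ ((p - 2) / 2) = 2 / (p * l).
  rewrite /sg powRM ?(ltW T0) ?invr_ge0 ?(ltW a20)// TE.
  rewrite powRV// powR_sqr// (_ : 2 * ((p - 2) / 2) = p - 2); last by field.
  by rewrite mulfK// gt_eqF// powR_gt0.
pose c := 2 * sg * Num.sqrt l.
have c0 : 0 < c by apply: mulr_gt0 => //; exact: mulr_gt0.
pose V x := (L T - L (sg * Y x ^+ 2)) / c.
have dV (y : R) : 0 <= y -> is_derive y 1 V (Y y ^+ 2).
  move=> y0; have dYy := dY y0; have Yy := Ypos y0.
  have dLy := is_deriveR_comp (f := L) (g := fun x => sg * Y x ^+ 2) (dL _)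
    (is_deriveR_M (is_deriveR_cst sg y) (is_deriveR_X 1 dYy)).
  eapply is_derive_congr; first by rewrite /V; derivs.
  have sY : 0 <= sg * Y y ^+ 2 by apply: mulr_ge0; [exact: ltW|exact: sqr_ge0].
  have -> : `|sg * Y y ^+ 2| `^ ((p - 2) / 2) = 2 / (p * l) * Y y `^ (p - 2).
    rewrite (ger0_norm sY) powRM ?(ltW sg0) ?sqr_ge0// sgE.
    by rewrite powR_sqr//; congr (_ * _ `^ _); field.
  rewrite /speed (_ : l + 2 / p * Y y `^ (p - 2) =
    l * (1 + 2 / (p * l) * Y y `^ (p - 2))); last first.
    by field; rewrite !gt_eqF.
  rewrite sqrtrM//; set S := Num.sqrt (1 + _).
  have S0 : S != 0.
    rewrite gt_eqF// sqrtr_gt0 ltr_pwDl// mulr_ge0 ?powR_ge0// divr_ge0// mulr_ge0 ?ltW//.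
  by rewrite /c /=; field; rewrite S0 !gt_eqF.
have WE x : 0 <= x -> W x = V x.
  move=> x0; have := eq_derive_eq0 dW dV x0.
  by rewrite W0 /V Y0 (_ : sg * a ^+ 2 = T) ?subrr ?mul0r ?subr0// /sg divfK ?gt_eqF.
have -> : a ^+ 2 * L T / (2 * T * Num.sqrt l) = (L T - L 0) / c.
  by rewrite L0 /c /sg; field; rewrite !gt_eqF.
apply: (@cvg_trans _ (V @ pinfty_nbhs R)).
  apply: near_eq_cvg; near=> x.
  have x0 : 0 <= x by near: x; apply: nbhs_pinfty_ge; rewrite num_real.
  by rewrite WE.
apply: cvgM; last exact: cvg_cst.
apply: cvgB; first exact: cvg_cst.
apply: (@cvg_comp _ _ _ (fun x => sg * Y x ^+ 2) L _ (nbhs (0:R))).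
  have H : (fun x => sg * (Y x * Y x)) @ pinfty_nbhs R --> (sg * (0 * 0) : R).
    by apply: cvgM; [exact: cvg_cst|exact: cvgM].
  rewrite (_ : (fun x => _) = fun x => sg * (Y x * Y x)); last first.
    by apply/funext => x; rewrite expr2.
  by rewrite !mulr0 in H.
exact: is_derive_continuous (dL 0).
Unshelve. all: by end_near. Qed.

Let n := (p - 2) / 2.

Let speed0 x : l = 0 -> 0 <= x -> speed p l (Y x) = Num.sqrt (2 / p) * (Y x * Y x `^ n).
Proof.
move=> -> x0; have Yx := Ypos x0.
have p2' := p2.
rewrite /speed add0r sqrtrM; last by rewrite divr_ge0//; lra.
by rewrite sqrt_powR mulrCA.
Qed.

(** With [l = 0] the speed is a pure power, so [- Y^(2-n)] is a primitive of [Y^2] up to a constant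
    factor; [p < 6] makes [2 - n] positive, so this power vanishes at infinity. *)
Lemma mass_zero_frequency : l = 0 -> p < 6 ->
  W x @[x --> +oo] --> a `^ (2 - n) / ((2 - n) * Num.sqrt (2 / p)).
Proof.
move=> lE p6; have p2' := p2; have pgt0 : 0 < p by lra.
have n2 : 0 < 2 - n by rewrite /n; lra.
pose c := (2 - n) * Num.sqrt (2 / p).
have s0 : 0 < Num.sqrt (2 / p) by rewrite sqrtr_gt0 divr_gt0.
have c0 : 0 < c by rewrite mulr_gt0.
pose V x := (a `^ (2 - n) - Y x `^ (2 - n)) / c.
have dV (y : R) : 0 <= y -> is_derive y 1 V (Y y ^+ 2).
  move=> y0; have dYy := dY y0; have Yy := Ypos y0.
  have dPy := is_deriveR_powR (2 - n) Yy dYy.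
  eapply is_derive_congr; first by rewrite /V; derivs.
  have -> : Y y ^+ 2 = Y y `^ (2 - n - 1) * (Y y * Y y `^ n).
    rewrite powR_mulS// powR_mulD// -(powR_mulrn 2 (ltW Yy)).
    by congr (_ `^ _); ring.
  by rewrite speed0// /c /=; field; rewrite !gt_eqF.
have WE x : 0 <= x -> W x = V x.
  move=> x0; have := eq_derive_eq0 dW dV x0.
  by rewrite W0 /V Y0 subrr mul0r !subr0.
have -> : a `^ (2 - n) / ((2 - n) * Num.sqrt (2 / p)) = (a `^ (2 - n) - 0) / c.
  by rewrite subr0.
apply: (@cvg_trans _ ((fun x => (a `^ (2 - n) - `|Y x| `^ (2 - n)) / c) @ pinfty_nbhs R)).
  apply: near_eq_cvg; near=> x.
  have x0 : 0 <= x by near: x; apply: nbhs_pinfty_ge; rewrite num_real.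
  by rewrite WE// /V gtr0_norm// Ypos.
apply: cvgM; last exact: cvg_cst.
apply: cvgB; first exact: cvg_cst.
have : (fun s : R => `|s| `^ (2 - n)) \o Y @ pinfty_nbhs R --> `|0 : R| `^ (2 - n).
  by apply: (cvg_comp _ _ cY); exact: (@continuous_norm_powR R (2 - n) n2 0).
by rewrite normr0 powR0 ?gt_eqF.
Unshelve. all: by end_near. Qed.

(** Since [n >= 2] and [Y <= a], the logarithmic decay rate [sqrt (2/p) Y^n] is at most [C Y^2].
    Hence [ln Y + C W] is nondecreasing, and a bounded [W] would keep [Y] away from 0. *)
Lemma mass_zero_frequency_infinite m : l = 0 -> 6 <= p ->
  (forall x, 0 <= x -> W x <= m) -> False.
Proof.
move=> lE p6 Wm; have p2' := p2; have pgt0 : 0 < p by lra.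
pose C := Num.sqrt (2 / p) * a `^ (n - 2).
have C0 : 0 <= C by rewrite mulr_ge0 ?sqrtr_ge0 ?powR_ge0.
have lnY x : 0 <= x -> ln a - C * m <= ln (Y x).
  move=> x0; have : ln (Y 0) + C * W 0 <= ln (Y x) + C * W x.
    pose V x := ln (Y x) + C * W x.
    pose V' x := - (Num.sqrt (2 / p) * Y x `^ n) + C * Y x ^+ 2.
    have dV (y : R) : 0 <= y <= x -> is_derive y 1 V (V' y).
      move=> /andP[y0 _]; have dYy := dY y0; have Yy := Ypos y0; have dWy := dW y0.
      eapply is_derive_congr; first by rewrite /V; derivs.
      by rewrite /V' speed0//=; field; rewrite gt_eqF.
    apply: (ge0_derive_le x0 dV) => y /andP[y0 _].
    have Yy := Ypos y0; rewrite /V' addrC subr_ge0 /C -mulrA; apply: ler_wpM2l.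
      exact: sqrtr_ge0.
    have -> : Y y `^ n = Y y `^ (n - 2) * Y y ^+ 2.
      rewrite -(powR_mulrn 2 (ltW Yy)) -powRD ?(gt_eqF Yy) ?implybT//.
      by congr (_ `^ _); ring.
    apply: ler_wpM2r; first exact: sqr_ge0.
    apply: ge0_ler_powR; rewrite ?nnegrE ?(ltW Yy) ?(ltW a0) ?speed_ode_le//.
    by rewrite /n; lra.
  by rewrite Y0 W0 mulr0 addr0; have := ler_wpM2l C0 (Wm x x0); lra.
have e0 : 0 < expR (ln a - C * m - 1) by exact: expR_gt0.
have := cY; move/cvgrPdist_lt => /(_ _ e0) H.
have [x [x0]] := filter_ex (filterI (nbhs_pinfty_ge (num_real (0 : R))) H).
rewrite sub0r normrN gtr0_norm ?Ypos// -ltr_ln ?posrE ?Ypos// expRK.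
by have := lnY _ x0; lra.
Qed.

End speed_mass.
End mass.

(** * Construction of the solutions *)

Section profile.
Context {R : realType}.
Implicit Types (Y Z C S : R -> R) (x y a b l p : R).

(* [C x = cosh (b x)] and [S x = sinh (b x) / b], including the limit case [b = 0]. *)
Lemma hyperbolic_exists b : 0 <= b -> exists C S, [/\
  (C 0 = 1 /\ S 0 = 0),
  (forall x : R, is_derive x 1 S (C x)),
  (forall x : R, is_derive x 1 C (b ^+ 2 * S x)),
  (forall x : R, C x ^+ 2 - b ^+ 2 * S x ^+ 2 = 1) &
  (forall x : R, 0 <= x -> 1 <= C x /\ x <= S x)].
Proof.
move=> b0.
suff [C [S [C0S0 dS dC E C1]]] : exists C S, [/\ (C 0 = 1 /\ S 0 = 0),
  (forall x : R, is_derive x 1 S (C x)),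
  (forall x : R, is_derive x 1 C (b ^+ 2 * S x)),
  (forall x : R, C x ^+ 2 - b ^+ 2 * S x ^+ 2 = 1) &
  (forall x : R, 0 <= x -> 1 <= C x)].
  exists C, S; split => // x x0; split; first exact: C1.
  have [_ S0] := C0S0; suff : x - 0 <= S x - S 0 by rewrite S0 !subr0.
  apply: (@le_derive_le _ (fun x => x) S (fun _ => 1) C) => // y.
  by move=> /andP[y0 _]; exact: C1.
move: b0; rewrite le_eqVlt => /predU1P[<-|b0].
  exists (fun=> 1), (fun x => x); split => //.
  - by move=> x; exact: is_deriveR_id.
  - by move=> x; apply: (is_derive_congr (is_deriveR_cst 1 x)); rewrite expr0n/= mul0r.
  - by move=> x; rewrite expr0n/= mul0r subr0 expr1n.
have bn0 : b != 0 by rewrite gt_eqF.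
have ee x : expR (b * x) * expR (- (b * x)) = 1 by exact: expRxMexpNx_1.
exists (fun x => (expR (b * x) + expR (- (b * x))) / 2),
  (fun x => (expR (b * x) - expR (- (b * x))) / (2 * b)); split.
- by rewrite mulr0 oppr0 expR0; split; [field|rewrite subrr mul0r].
- by move=> x; eapply is_derive_congr; [derivs|rewrite /=; field].
- by move=> x; eapply is_derive_congr; [derivs|rewrite /=; field].
- move=> x; have := ee x; set e := expR _; set f := expR _ => ef.
  by rewrite -[RHS]ef; field.
- move=> x x0; have := ee x; have := expR_gt0 (b * x); have := expR_gt0 (- (b * x)).
  set e := expR _; set f := expR _ => e0 f0 ef.
  rewrite ler_pdivlMr// mul1r; have := sqr_ge0 (e - f); nra.
Qed.

(* [z = Y^(-n)], [n = (p - 2) / 2], solves the linear equation [z'' = n^2 l z]. *)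
Lemma profile_exists p l a : 2 < p -> 0 <= l -> 0 < a -> exists Y Z, [/\
  ode p l Y Z, Y 0 = a, (forall x, 0 <= x -> 0 < Y x),
  (forall x, 0 <= x -> Z x = - speed p l (Y x)) & Y x @[x --> +oo] --> 0].
Proof.
move=> p2 l0 a0; pose n := (p - 2) / 2; pose b := n * Num.sqrt l.
have n0 : 0 < n by rewrite /n; lra.
have pE : p = 2 * n + 2 by rewrite /n; field.
have b0 : 0 <= b by rewrite /b mulr_ge0 ?sqrtr_ge0// ltW.
have bE : b ^+ 2 = n ^+ 2 * l by rewrite /b exprMn sqr_sqrtr.
have [C [S [[C0 S0] dS dC CS CS1]]] := hyperbolic_exists b0.
pose c := 2 / p * n ^+ 2.
have pgt0 : 0 < p by lra.
have c0 : 0 < c by rewrite /c mulr_gt0 ?divr_gt0 ?exprn_gt0.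
(* The zero-energy relation written for [z = Y^(-n)] is [z'^2 = c + b^2 z^2]; [z1] is the initial
   slope that satisfies it. *)
pose z0 := a `^ (- n); pose z1 := Num.sqrt (c + b ^+ 2 * z0 ^+ 2).
have z0gt0 : 0 < z0 by exact: powR_gt0.
have cz0 : 0 < c + b ^+ 2 * z0 ^+ 2.
  by rewrite ltr_pwDl// mulr_ge0 ?sqr_ge0.
have z1gt0 : 0 < z1 by rewrite sqrtr_gt0.
have z1E : z1 ^+ 2 = c + b ^+ 2 * z0 ^+ 2 by rewrite sqr_sqrtr// ltW.
pose z x := z0 * C x + z1 * S x; pose zd x := z0 * (b ^+ 2 * S x) + z1 * C x.
have dz (x : R) : is_derive x 1 z (zd x).
  have dSx := dS x; have dCx := dC x.
  by eapply is_derive_congr; [rewrite /z; derivs|rewrite /zd /=; ring].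
have dzd (x : R) : is_derive x 1 zd (b ^+ 2 * z x).
  have dSx := dS x; have dCx := dC x.
  by eapply is_derive_congr; [rewrite /zd; derivs|rewrite /z /=; ring].
have zdE x : zd x ^+ 2 = c + b ^+ 2 * z x ^+ 2.
  apply/eqP; rewrite -subr_eq; apply/eqP.
  have -> : zd x ^+ 2 - b ^+ 2 * z x ^+ 2 =
      (z1 ^+ 2 - b ^+ 2 * z0 ^+ 2) * (C x ^+ 2 - b ^+ 2 * S x ^+ 2).
    by rewrite /zd /z; ring.
  by rewrite CS z1E mulr1 addrK.
have zge x : 0 <= x -> z1 * x <= z x /\ 0 < z x.
  move=> x0; have [Cx Sx] := CS1 x x0; rewrite /z.
  have h1 := ler_wpM2l (ltW z1gt0) Sx; have h2 := ler_wpM2l (ltW z0gt0) Cx.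
  by have := mulr_ge0 (ltW z1gt0) x0; split; lra.
have zdge0 x : 0 <= x -> 0 <= zd x.
  move=> x0; have [Cx Sx] := CS1 x x0.
  by rewrite addr_ge0// mulr_ge0 ?(ltW z0gt0) ?(ltW z1gt0)// ?mulr_ge0 ?sqr_ge0//; lra.
pose k := n^-1; have k0 : 0 < k by rewrite invr_gt0.
have kn : k * n = 1 by rewrite mulVf// gt_eqF.
(* All the real powers needed to check the second-order equation are [A] times an integer power of
   [z], which makes it polynomial. *)
pose A x := z x `^ (- k - 2).
have A0 x : 0 <= x -> 0 < A x by move=> /zge[_ zx]; exact: powR_gt0.
have E1 x : 0 <= x -> z x `^ (- k - 1) = A x * z x.
  move=> /zge[_ zx]; rewrite mulrC /A powR_mulS//; congr (_ `^ _); ring.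
have E0 x : 0 <= x -> z x `^ (- k) = A x * z x ^+ 2.
  move=> x0; have [_ zx] := zge _ x0.
  rewrite expr2 mulrA -E1// mulrC powR_mulS//; congr (_ `^ _); ring.
have Ypos x : 0 <= x -> 0 < z x `^ (- k) by move=> /zge[_ zx]; exact: powR_gt0.
exists (fun x => z x `^ (- k)), (fun x => - k * z x `^ (- k - 1) * zd x); split.
- move=> x x0; have [_ zx] := zge _ x0; have dzx := dz x; have dzdx := dzd x.
  split; first by eapply is_derive_congr; [derivs|rewrite /=; ring].
  eapply is_derive_congr; first by derivs.
  rewrite signed_power_pos ?Ypos// -powRrM.
  have -> : z x `^ (- k * (p - 1)) = A x.
    congr (_ `^ _); rewrite pE; transitivity (- k - 2 * (k * n)); first by ring.
    by rewrite kn mulr1.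
  have -> : z x `^ (- k - 1 - 1) = A x by congr (_ `^ _); ring.
  rewrite /= E0// E1//.
  transitivity (A x * ((k + k ^+ 2) * zd x ^+ 2 - k * b ^+ 2 * z x ^+ 2)).
    by ring.
  rewrite zdE.
  have kc : (k + k ^+ 2) * c = 1.
    have -> : (k + k ^+ 2) * c = 2 / p * ((k * n) * n + (k * n) ^+ 2) by rewrite /c; ring.
    rewrite kn mul1r expr1n (_ : n + 1 = p / 2); last by rewrite /n; field.
    by field; rewrite gt_eqF.
  have kb : k ^+ 2 * b ^+ 2 = l.
    by rewrite bE mulrA -exprMn kn expr1n mul1r.
  transitivity (A x * ((k + k ^+ 2) * c + k ^+ 2 * b ^+ 2 * z x ^+ 2)); first by ring.
  by rewrite kc kb; ring.
- rewrite /z C0 S0 mulr0 addr0 mulr1 /z0 -powRrM mulrN mulNr opprK mulrC kn.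
  by rewrite powRr1// ltW.
- exact: Ypos.
- move=> x x0; have [_ zx] := zge _ x0.
  rewrite E1// /speed E0// !mulNr; congr (- _).
  have -> : (A x * z x ^+ 2) `^ (p - 2) = (z x ^+ 2)^-1.
    rewrite -E0// -powRrM pE -(powR_mulrn 2 (ltW zx)) -powRN; congr (_ `^ _).
    transitivity (- 2 * (k * n)); first by ring.
    by rewrite kn mulr1.
  have -> : l + 2 / p * (z x ^+ 2)^-1 = (k * zd x / z x) ^+ 2.
    have kc : k ^+ 2 * c = 2 / p by rewrite /c mulrCA -exprMn kn expr1n mulr1.
    have kb : k ^+ 2 * b ^+ 2 = l by rewrite bE mulrA -exprMn kn expr1n mul1r.
    have -> : (k * zd x / z x) ^+ 2 = k ^+ 2 * zd x ^+ 2 / z x ^+ 2.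
      by rewrite expr_div_n exprMn.
    rewrite zdE mulrDr kc (mulrA (k ^+ 2)) kb mulrDl addrC; congr (_ + _).
    by rewrite mulfK// sqrf_eq0 gt_eqF.
  rewrite sqrtr_sqr ger0_norm; last first.
    by rewrite divr_ge0 ?(ltW zx)// mulr_ge0 ?zdge0// ltW.
  by field; rewrite gt_eqF.
- apply/cvgrPdist_le => /= e e0; near=> x.
  have x0 : 0 <= x by near: x; apply: nbhs_pinfty_ge; rewrite num_real.
  have xe : e `^ (- n) / z1 <= x by near: x; apply: nbhs_pinfty_ge; rewrite num_real.
  rewrite sub0r normrN gtr0_norm ?Ypos//.
  have [zx z_x] := zge _ x0.
  have ez : e `^ (- n) <= z x.
    by apply: (le_trans _ zx); rewrite mulrC -ler_pdivrMr.
  have -> : e = ((e `^ (- n)) `^ k)^-1.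
    by rewrite -powRrM -powRN -mulNr opprK mulrC kn powRr1// ltW.
  rewrite (powRN (z x)) lef_pV2 ?posrE ?powR_gt0//.
  by apply: ge0_ler_powR; rewrite ?nnegrE ?powR_ge0 ?(ltW k0) ?(ltW z_x).
Unshelve. all: by end_near. Qed.

(** As [|Z|] is nonincreasing, the mean value theorem on [[x / 2, x]] bounds [x |Z x|] by
    [2 Y (x / 2)]. This decay removes boundary terms against test functions known only to grow at
    most linearly. *)
Lemma profile_derive_cvg p l Y Z : 2 < p -> 0 <= l -> ode p l Y Z ->
  (forall x, 0 <= x -> 0 < Y x) -> (forall x, 0 <= x -> Z x = - speed p l (Y x)) ->
  Y x @[x --> +oo] --> 0 -> x * Z x @[x --> +oo] --> 0.
Proof.
move=> p2 l0 YZ Ypos ZE cY.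
have dY x : 0 <= x -> is_derive x 1 Y (Z x) by move=> /YZ[].
have sp0 x : 0 <= x -> 0 <= speed p l (Y x).
  by move=> x0; rewrite /speed mulr_ge0 ?sqrtr_ge0// ltW// Ypos.
have bound x : 0 <= x -> `|x * Z x| <= 2 * Y (x / 2).
  move=> x0; rewrite normrM ger0_norm// ZE// normrN ger0_norm ?sp0//.
  have x20 : 0 <= x / 2 by rewrite divr_ge0.
  have x2x : x / 2 <= x by lra.
  have dYx y : x / 2 <= y <= x -> is_derive y 1 Y (Z y).
    by move=> /andP[xy _]; apply: dY; exact: le_trans xy.
  have [y /andP[xy yx] E] := mean_value x2x dYx.
  have y0 : 0 <= y by exact: le_trans xy.
  have Yyx : Y x <= Y y.
    rewrite -lerN2; apply: (@ge0_derive_le _ (fun y => - Y y) (fun y => - Z y)) => // w /andP[yw _].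
      by apply: is_deriveR_N; apply: dY; exact: le_trans yw.
    by rewrite ZE ?opprK ?sp0//; exact: le_trans yw.
  have st := ler_wpM2l x0 (speed_le p2 l0 (ltW (Ypos _ x0)) Yyx); rewrite ZE// in E.
  by have := Ypos _ x0; lra.
apply/cvgrPdist_le => /= e e0.
have e20 : 0 < e / 2 by rewrite divr_gt0.
have := cY; move/cvgrPdist_le => /(_ _ e20) [M [_ HM]].
near=> x.
have x0 : 0 <= x by near: x; apply: nbhs_pinfty_ge; rewrite num_real.
have xM : `|M| * 2 < x by near: x; apply: nbhs_pinfty_gt; rewrite num_real.
rewrite sub0r normrN; apply: (le_trans (bound _ x0)).
have := HM (x / 2); rewrite sub0r normrN => /(_ _).
have -> : M < x / 2 by rewrite ltr_pdivlMr//; have := ler_norm M; lra.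
move=> /(_ isT); have : Y (x / 2) <= `|Y (x / 2)| by exact: ler_norm.
lra.
Unshelve. all: by end_near. Qed.

End profile.

(** * From half-line profiles to weak solutions *)

Section solution.
Context {R : realType}.
Local Notation leb := (@lebesgue_measure R).
Implicit Types (f g u v phi psi Y Z W G : R -> R) (x y a b l p q m : R).

(** The right end is exempt because [u'] takes its right-hand value at 0, which the formula on the
    left half-line does not match. *)
Lemma eq_Rintegral_co f g a b : (forall x, a <= x -> x < b -> f x = g x) ->
  leb.-integrable `[a, b] (EFin \o f) -> leb.-integrable `[a, b] (EFin \o g) ->
  \int[leb]_(x in `[a, b]) f x = \int[leb]_(x in `[a, b]) g x.
Proof.
move=> fg fi gi.
have sub : `[a, b[%classic `<=` `[a, b]%classic by apply: subset_itvl; rewrite bnd_simp.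
rewrite -!Rintegral_itv_bndo_bndc; [|exact: integrableS gi|exact: integrableS fi].
apply: eq_Rintegral => x; rewrite inE/= in_itv/= => /andP[ax xb]; exact: fg.
Qed.

(** Increments are bounded by integrating [|phi'| <= phi'^2 + 1]. This is weaker than the decay of
    H^1 functions but enough when paired with [x * Z x] tending to 0. *)
Lemma H1_linear_growth phi phi' : is_H1 phi phi' ->
  exists A : R, forall x, `|phi x| <= A + `|x|.
Proof.
move=> phiH; have [_ _ phi'L _] := phiH.
pose B := \int[leb]_(x in setT) phi' x ^+ 2.
have sqi := Lfun2_integrable_sqr phi'L.
have B0 : 0 <= B by apply: Rintegral_ge0 => x _; exact: sqr_ge0.
have inc a b : a < b -> `|phi b - phi a| <= B + (b - a).
  move=> ab; rewrite -(H1_increment phiH ab).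
  have i1 : leb.-integrable `[a, b] (EFin \o phi') by exact: Lfun2_integrable_itv.
  have i2 : leb.-integrable `[a, b] (EFin \o (fun x => phi' x ^+ 2)).
    by apply: integrableS sqi.
  have i3 : leb.-integrable `[a, b] (EFin \o (fun _ : R => 1 : R)).
    by apply: continuous_integrable_itv => x _; exact: cvg_cst.
  apply: (le_trans (le_normr_Rintegral _ i1)) => //.
  apply: (@le_trans _ _ (\int[leb]_(x in `[a, b]) (phi' x ^+ 2 + 1))).
    apply: le_Rintegral => //.
    - exact: integrable_norm.
    - exact: (@integrableD _ _ _ leb _ _ (EFin \o (fun x => phi' x ^+ 2)) (EFin \o (fun _ => 1))).
    - by move=> x _; rewrite -[_ ^+ 2]real_normK ?num_real//; have := sqr_ge0 (`|phi' x| - 1); nra.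
  rewrite RintegralD//; apply: lerD.
    rewrite /B [leLHS]Rintegral_mkcond; apply: le_Rintegral => //.
    - by rewrite -restrict_EFin; apply: (proj1 (@integrable_mkcond
         _ _ R leb `[a, b] (EFin \o (fun x => phi' x ^+ 2)) _) i2).
    - by move=> x _; rewrite patchE; case: ifP => // _; exact: sqr_ge0.
  rewrite (@integral_derive _ (fun _ => 1) (fun x => x) a b (ltW ab))//.
  by move=> x _; exact: cvg_cst.
exists (`|phi 0| + B) => x; have [x0|x0|->] := ltgtP x 0.
- have := inc _ _ x0; rewrite distrC sub0r => h.
  rewrite (ltr0_norm x0); apply: (le_trans _ (_ : `|phi 0| + (B - x) <= _)); last lra.
  by rewrite -lerBlDl; apply: (le_trans _ h); rewrite lerB_dist.
- have := inc _ _ x0; rewrite subr0 => h.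
  rewrite (gtr0_norm x0); apply: (le_trans _ (_ : `|phi 0| + (B + x) <= _)); last lra.
  by rewrite -lerBlDl; apply: (le_trans _ h); rewrite lerB_dist.
- by rewrite normr0 addr0 lerDl.
Qed.

Lemma continuous_even_extension Y : (forall x, 0 <= x -> {for x, continuous Y}) ->
  continuous (fun x => Y `|x|).
Proof.
move=> cY x; apply: (@continuous_comp _ _ _ (fun x : R => `|x|) Y).
  exact: norm_continuous.
exact: cY.
Qed.

Lemma even_square_integral f (M : R) W : continuous f -> (forall x, f (- x) = f x) ->
  W 0 = 0 -> (forall x, 0 <= x -> is_derive x 1 W (f x ^+ 2)) ->
  W x @[x --> +oo] --> M ->
  leb.-integrable setT (EFin \o (fun x => f x ^+ 2)) /\
  \int[leb]_(x in setT) f x ^+ 2 = 2 * M.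
Proof.
move=> cf fe W0 dW cW.
have cf2 : continuous (fun x => f x ^+ 2) by move=> x; apply: continuous_sqr; exact: cf.
have mf2 : measurable_fun setT (fun x => f x ^+ 2) by exact: continuous_measurable_fun.
have f20 x : 0 <= f x ^+ 2 by exact: sqr_ge0.
have IE : (\int[leb]_x (f x ^+ 2)%:E = (2 * M)%:E)%E.
  rewrite (@ge0_symfun_integralT R (fun x => f x ^+ 2))//; last first.
    by move=> x /=; rewrite fe.
  rewrite EFinM; congr (_ * _)%E.
  rewrite (_ : [set x | 0 <= x] = `[0, +oo[%classic); last first.
    by apply/seteqP; split => x /=; rewrite in_itv/= andbT.
  have h1 := @ge0_cvgn_integral R leb (fun x => f x ^+ 2) f20 mf2.
  have h2 : (\int[leb]_(x in `[0%R, n%:R]) (f x ^+ 2)%:E)%E @[n --> \oo] --> M%:E.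
    have En k : (\int[leb]_(x in `[0%R, k%:R]) (f x ^+ 2)%:E = (W k%:R)%:E)%E.
      have ik : leb.-integrable `[0, k%:R] (EFin \o (fun x => f x ^+ 2)).
        by apply: continuous_integrable_itv => x _; exact: cf2.
      rewrite -[LHS]fineK; last exact: integrable_fin_num ik.
      congr EFin; rewrite (_ : W k%:R = W k%:R - W 0); last by rewrite W0 subr0.
      apply: (@integral_derive _ (fun x => f x ^+ 2) W 0 k%:R) => //.
        by move=> x /andP[x0 _]; exact: dW.
      by move=> x _; exact: cf2.
    rewrite (_ : (fun n => _) = (fun n => (W n%:R)%:E)); last exact/funext.
    have cWn := proj1 (cvg_pinftyP W M) cW (fun n => n%:R) cvgr_idn.
    by apply: cvg_comp cWn _; exact: cvg_refl.
  exact: (cvg_unique _ h1 h2).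
split; last by rewrite /Rintegral IE.
apply/integrableP; split; first exact/measurable_EFinP.
under eq_integral => x _ do rewrite /= ger0_norm//.
by rewrite IE ltry.
Qed.

Lemma profile_solution p q l a (M : R) Y Z W : 2 < p -> 0 <= l -> 0 < a ->
  ode p l Y Z -> Y 0 = a -> (forall x, 0 <= x -> 0 < Y x) ->
  (forall x, 0 <= x -> Z x = - speed p l (Y x)) -> Y x @[x --> +oo] --> 0 ->
  W 0 = 0 -> (forall x, 0 <= x -> is_derive x 1 W (Y x ^+ 2)) ->
  W x @[x --> +oo] --> M -> 2 * speed p l a = a `^ (q - 1) ->
  solves p q (2 * M) (fun x => Y `|x|) l.
Proof.
move=> p2 l0 a0 YZ Y0 Ypos ZE cvgY W0 dW cW jump.
have weak_of_total (I1 I2 I3 s t : R) : I1 + I2 + l * I3 = - (2 * s * t) ->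
    I1 + I2 - - (2 * t) * s = - l * I3 by lra.
have dY x : 0 <= x -> is_derive x 1 Y (Z x) by move=> /YZ[].
have dZ x : 0 <= x -> is_derive x 1 Z (l * Y x + signed_power p (Y x)) by move=> /YZ[].
pose u x := Y `|x|.
have cu : continuous u.
  by apply: continuous_even_extension => x x0; exact: is_derive_continuous (dY x x0).
have cZ : continuous (fun x => Z `|x|).
  by apply: continuous_even_extension => x x0; exact: is_derive_continuous (dZ x x0).
have up x : 0 <= x -> u x = Y x by move=> x0; rewrite /u ger0_norm.
have um x : x <= 0 -> u x = Y (- x) by move=> x0; rewrite /u ler0_norm.
have [u2i u2E] : leb.-integrable setT (EFin \o (fun x => u x ^+ 2)) /\
    \int[leb]_(x in setT) u x ^+ 2 = 2 * M.
  apply: (even_square_integral (W := W)) => //; first by move=> x; rewrite /u normrN.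
  by move=> x x0; rewrite up//; exact: dW.
have uL : u \in Lfun leb 2%:E by apply: Lfun2I => //; exact: continuous_measurable_fun.
pose chi x : R := 2 * \1_`[0, +oo[%classic x - 1.
have chip x : 0 <= x -> chi x = 1.
  by move=> x0; rewrite /chi indicE mem_set ?mulr1 ?addrK//= in_itv/= x0.
have chim x : x < 0 -> chi x = - 1.
  move=> x0; rewrite /chi indicE memNset ?mulr0 ?sub0r//= in_itv/= andbT.
  by apply/negP; rewrite -ltNge.
pose u' x := Z `|x| * chi x.
have mu' : measurable_fun setT u'.
  apply: measurable_funM; first exact: continuous_measurable_fun.
  apply: measurable_funB; last exact: measurable_cst.
  by apply: measurable_funM; [exact: measurable_cst|exact: measurable_indic].
have u'p x : 0 <= x -> u' x = Z x.
  by move=> x0; rewrite /u' chip// mulr1 ger0_norm.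
have u'm x : x < 0 -> u' x = - Z (- x).
  by move=> x0; rewrite /u' chim// mulrN1 ltr0_norm.
have ua x : 0 < u x <= a.
  rewrite /u Ypos//= -lerN2 -Y0.
  apply: (@ge0_derive_le _ (fun y => - Y y) (fun y => - Z y) 0 `|x|) => // y /andP[y0 _].
    by apply: is_deriveR_N; exact: dY.
  by rewrite ZE// opprK /speed mulr_ge0 ?sqrtr_ge0// ltW// Ypos.
have p'0 : 0 <= 2 / p by rewrite divr_ge0//; lra.
pose B := Num.sqrt (l + 2 / p * a `^ (p - 2)).
have ZB x : `|Z `|x| | <= B * u x.
  have /andP[ux0 uxa] := ua x.
  rewrite ZE// normrN -/(u x) /speed normrM (gtr0_norm ux0) ger0_norm ?sqrtr_ge0//.
  rewrite mulrC; apply: ler_wpM2r; first exact: ltW.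
  apply: ler_wsqrtr; rewrite lerD2l; apply: ler_wpM2l => //.
  by apply: ge0_ler_powR; rewrite ?nnegrE ?(ltW ux0) ?(ltW a0)//; lra.
have u'2 x : u' x ^+ 2 <= B ^+ 2 * u x ^+ 2.
  have -> : u' x ^+ 2 = `|Z `|x| | ^+ 2.
    rewrite real_normK ?num_real// /u' exprMn.
    by have [/chip ->|/chim ->] := leP 0 x; rewrite ?sqrrN expr1n mulr1.
  rewrite -exprMn; apply: lerXn2r; rewrite ?nnegrE ?mulr_ge0 ?sqrtr_ge0//.
  by have /andP[/ltW] := ua x.
have u'L : u' \in Lfun leb 2%:E.
  apply: Lfun2I => //.
  apply: (@le_integrable_real _ _ _ (fun x => B ^+ 2 * u x ^+ 2)) => //.
  - by apply: measurable_funX.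
  - by move=> x _; rewrite ger0_norm ?sqr_ge0.
  - exact: (@integrableZl _ _ _ leb setT measurableT (B ^+ 2) (EFin \o (fun x => u x ^+ 2))).
have iu' b c : leb.-integrable `[b, c] (EFin \o u') by exact: Lfun2_integrable_itv.
pose g x := l * u x + signed_power p (u x).
have csp : continuous (fun x => signed_power p (u x)).
  by move=> x; apply: continuous_comp; [exact: cu|exact: continuous_signed_power].
have cg : continuous g.
  by move=> x; apply: cvgD; [apply: cvgM; [exact: cvg_cst|exact: cu]|exact: csp].
have [G [G0 dG]] := primitive_exists cg.
(* On the right [u'] is [Z 0 + G], on the left [- Z 0 + G]. Both are C^1 on the whole line, so each
   can be the smooth factor in [H1_parts] with the test function as the other. *)
have GE x : 0 <= x -> Z x = Z 0 + G x.
  move=> x0; have dZg (y : R) : 0 <= y -> is_derive y 1 Z (g y).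
    by move=> y0; rewrite /g up//; exact: dZ.
  have := eq_derive_eq0 dZg (fun y _ => dG y) x0.
  by rewrite G0 subr0 => <-; ring.
have ge x : g (- x) = g x by rewrite /g /u normrN.
have Godd x : 0 <= x -> G (- x) = - G x.
  move=> x0; have dGm (y : R) : 0 <= y -> is_derive y 1 (fun y => - G (- y)) (g y).
    move=> _; eapply is_derive_congr.
      by derivs; notypeclasses refine (is_deriveR_comp _ _); [exact: dG|derivs].
    by rewrite /= ge; ring.
  have := eq_derive_eq0 dGm (fun y _ => dG y) x0.
  by rewrite oppr0 G0; lra.
have GEm x : x <= 0 -> - Z (- x) = - Z 0 + G x.
  move=> x0; have x0' : 0 <= - x by rewrite oppr_ge0.
  by rewrite GE// opprD; congr (_ + _); rewrite -Godd// opprK.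
have wd : is_weak_derivative u u'.
  move=> psi psiC; have cpsi := C1c_continuous psiC.
  have [_ cdpsi _] := psiC; have dpsi x := C1c_derive x psiC.
  have [K [K0 s1 s2]] := C1c_supp psiC.
  have K1 : 0 <= K + 1 by rewrite addr_ge0// ltW.
  have NK1 : - (K + 1) <= 0 by rewrite oppr_le0.
  have KK : - (K + 1) <= 0 <= K + 1 by rewrite NK1.
  have out x : ~ `[- (K + 1), K + 1]%classic x -> ~ (- K <= x <= K).
    rewrite /= in_itv/= => h /andP[h1 h2]; apply: h; apply/andP; split; lra.
  rewrite (@Rintegral_supp _ _ `[- (K + 1), K + 1]%classic); last first.
    by move=> x /out xK; rewrite s2// mulr0.
  rewrite (@Rintegral_supp _ (fun x => u' x * psi x) `[- (K + 1), K + 1]%classic); last first.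
    by move=> x /out xK; rewrite s1// mulr0.
  have ic f b c : continuous f -> leb.-integrable `[b, c] (EFin \o f).
    by move=> cf; apply: continuous_integrable_itv => x _; exact: cf.
  have c1 : continuous (fun x => u x * derive1 psi x).
    by move=> x; apply: cvgM; [exact: cu|exact: cdpsi].
  have c2 : continuous (fun x => Z `|x| * psi x).
    by move=> x; apply: cvgM; [exact: cZ|exact: cpsi].
  have i2 b c : leb.-integrable `[b, c] (EFin \o (fun x => u' x * psi x)).
    exact: integrable_mul_cont.
  apply/eqP; rewrite -subr_eq0 opprK; apply/eqP.
  rewrite (Rintegral_itv_split KK); last exact: ic.
  rewrite (Rintegral_itv_split KK (i2 _ _)).
  have EL : \int[leb]_(x in `[- (K + 1), 0]) (u' x * psi x) =
      - \int[leb]_(x in `[- (K + 1), 0]) (Z `|x| * psi x).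
    transitivity (\int[leb]_(x in `[- (K + 1), 0]) (- 1 * (Z `|x| * psi x))); last first.
      by rewrite RintegralZl ?mulN1r//; exact: ic.
    apply: eq_Rintegral_co.
    - by move=> x _ x0; rewrite u'm// ltr0_norm// mulN1r mulNr.
    - exact: i2.
    - by apply: ic => x; apply: cvgM; [exact: cvg_cst|exact: c2].
  have ER : \int[leb]_(x in `[0, K + 1]) (u' x * psi x) =
      \int[leb]_(x in `[0, K + 1]) (Z `|x| * psi x).
    apply: eq_Rintegral => x; rewrite inE/= in_itv/= => /andP[x0 _].
    by rewrite u'p// ger0_norm.
  have psi0 x : K < `|x| -> psi x = 0.
    by move=> xK; apply: s1; rewrite -ler_norml leNgt xK.
  have FR : \int[leb]_(x in `[0, K + 1]) (u x * derive1 psi x) +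
      \int[leb]_(x in `[0, K + 1]) (Z `|x| * psi x) = - (a * psi 0).
    rewrite -RintegralD//; [|exact: ic|exact: ic].
    rewrite (_ : - (a * psi 0) = Y (K + 1) * psi (K + 1) - Y 0 * psi 0); last first.
      by rewrite Y0 (psi0 (K + 1)) ?mulr0 ?sub0r// ger0_norm// ltrDl.
    apply: (@integral_derive _ _ (fun x => Y x * psi x)) => //.
      move=> x /andP[x0 _]; have dYx := dY x x0; have dpx := dpsi x.
      by rewrite up// ger0_norm//; eapply is_derive_congr; [derivs|rewrite /=; ring].
    by move=> x _; apply: cvgD; [exact: c1|exact: c2].
  have FL : \int[leb]_(x in `[- (K + 1), 0]) (u x * derive1 psi x) -
      \int[leb]_(x in `[- (K + 1), 0]) (Z `|x| * psi x) = a * psi 0.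
    rewrite -RintegralB//; [|exact: ic|exact: ic].
    rewrite (_ : a * psi 0 = Y (- 0) * psi 0 - Y (- - (K + 1)) * psi (- (K + 1))); last first.
      by rewrite oppr0 Y0 (psi0 (- (K + 1))) ?mulr0 ?subr0// normrN ger0_norm ?ltrDl.
    apply: (@integral_derive _ _ (fun x => Y (- x) * psi x)) => //.
      move=> x /andP[_ x0]; have dpx := dpsi x.
      have dYx : is_derive x 1 (fun x => Y (- x)) (Z (- x) * - 1).
        have x0' : 0 <= - x by rewrite oppr_ge0.
        exact: (@is_deriveR_comp _ Y (fun x => - x) x _ _ (dY _ x0')
          (is_deriveR_N (is_deriveR_id x))).
      by rewrite um// ler0_norm//; eapply is_derive_congr; [derivs|rewrite /=; ring].
    by move=> x _; apply: cvgB; [exact: c1|exact: c2].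
  by rewrite EL ER addrACA FL FR subrr.
have uH : is_H1 u u' by split.
split => //; last first.
  by rewrite Lnorm2_sqr// u2E.
exists u' => // phi phi' phiH; have [cphi phiL phi'L _] := phiH.
have ia : leb.-integrable setT (EFin \o (fun x => u' x * phi' x)).
  exact: Lfun2_integrable_mul.
have ib : leb.-integrable setT (EFin \o (fun x => u x * phi x)).
  exact: Lfun2_integrable_mul.
have ic : leb.-integrable setT (EFin \o (fun x => signed_power p (u x) * phi x)).
  apply: (@le_integrable_real _ _ _ (fun x => a `^ (p - 2) * `|u x * phi x|)) => //.
  - apply: continuous_measurable_fun => x.
    by apply: cvgM; [exact: csp|exact: cphi].
  - move=> x _; have /andP[ux0 uxa] := ua x.
    rewrite /signed_power -mulrA normrM; apply: ler_wpM2r => //.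
    rewrite ger0_norm ?powR_ge0// gtr0_norm//.
    by apply: ge0_ler_powR; rewrite ?nnegrE ?(ltW ux0) ?(ltW a0)//; lra.
  - apply: (@integrableZl _ _ _ leb setT measurableT (a `^ (p - 2))
      (EFin \o (fun x => `|u x * phi x|))).
    exact: integrable_norm.
pose F x := g x * phi x + u' x * phi' x.
have ilb : leb.-integrable setT (EFin \o (fun x => l * (u x * phi x))).
  exact: (@integrableZl _ _ _ leb setT measurableT l (EFin \o (fun x => u x * phi x))).
have ig : leb.-integrable setT (EFin \o (fun x => g x * phi x)).
  rewrite (_ : (fun x => g x * phi x) =
    (fun x => l * (u x * phi x) + signed_power p (u x) * phi x)); last first.
    by apply/funext => x; rewrite /g mulrDl mulrA.
  exact: (@integrableD _ _ _ leb _ _ (EFin \o (fun x => l * (u x * phi x)))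
    (EFin \o (fun x => signed_power p (u x) * phi x))).
have iF : leb.-integrable setT (EFin \o F).
  exact: (@integrableD _ _ _ leb _ _ (EFin \o (fun x => g x * phi x))
    (EFin \o (fun x => u' x * phi' x))).
have FE : \int[leb]_(x in setT) F x = \int[leb]_(x in setT) (u' x * phi' x) +
    \int[leb]_(x in setT) (signed_power p (u x) * phi x) +
    l * \int[leb]_(x in setT) (u x * phi x).
  have E1 : \int[leb]_(x in setT) (g x * phi x) =
      l * \int[leb]_(x in setT) (u x * phi x) +
      \int[leb]_(x in setT) (signed_power p (u x) * phi x).
    transitivity (\int[leb]_(x in setT) (l * (u x * phi x) + signed_power p (u x) * phi x)).
      by apply: eq_Rintegral => x _; rewrite /g mulrDl mulrA.
    by rewrite RintegralD// RintegralZl.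
  rewrite [LHS]RintegralD// E1 [LHS]addrC -addrA; congr (_ + _); exact: addrC.
(* Integration by parts on each side of 0: the outer boundary terms combine because [u'] is odd away
   from 0, and the two at 0 add up to the jump. *)
have Fn n : \int[leb]_(x in `[- n.+1%:R, n.+1%:R]) F x =
    (phi n.+1%:R + phi (- n.+1%:R)) * Z n.+1%:R - 2 * phi 0 * Z 0.
  set T : R := n.+1%:R; have T0 : 0 < T by rewrite ltr0n.
  have TT : - T <= 0 <= T by apply/andP; split; lra.
  have iFT b c : leb.-integrable `[b, c] (EFin \o F) by exact: integrableS iF.
  rewrite (Rintegral_itv_split TT)//.
  have dv k (x : R) : is_derive x 1 (fun x => k + G x) (g x).
    by have dGx := dG x; eapply is_derive_congr; [derivs|rewrite /=; ring].
  have cv k : continuous (fun x => k + G x).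
    by move=> x; exact: is_derive_continuous (dv k x).
  have iv k b c : leb.-integrable `[b, c]
      (EFin \o (fun x => phi x * g x + phi' x * (k + G x))).
    apply: (@integrableD _ _ _ leb _ _ (EFin \o (fun x => phi x * g x))
      (EFin \o (fun x => phi' x * (k + G x)))) => //.
      by apply: continuous_integrable_itv => x _; apply: cvgM; [exact: cphi|exact: cg].
    by apply: integrable_mul_cont => //; exact: Lfun2_integrable_itv.
  have ER := H1_parts phiH (dv (Z 0)) cg T0.
  have NT0 : - T < 0 by lra.
  have EL := H1_parts phiH (dv (- Z 0)) cg NT0.
  have -> : \int[leb]_(x in `[0, T]) F x =
      \int[leb]_(x in `[0, T]) (phi x * g x + phi' x * (Z 0 + G x)).
    apply: eq_Rintegral => x; rewrite inE/= in_itv/= => /andP[x0 _].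
    by rewrite /F u'p// GE//; ring.
  have -> : \int[leb]_(x in `[- T, 0]) F x =
      \int[leb]_(x in `[- T, 0]) (phi x * g x + phi' x * (- Z 0 + G x)).
    apply: eq_Rintegral_co => // x _ x0.
    by rewrite /F u'm// GEm ?(ltW x0)//; ring.
  rewrite ER EL G0 -GEm ?(ltW NT0)// -GE ?(ltW T0)// opprK; ring.
have lim1 := Rintegral_growing_cvg iF.
have [A HA] := H1_linear_growth phiH.
have cvgZ := profile_derive_cvg p2 l0 YZ Ypos ZE cvgY.
have lim3 : (phi n.+1%:R + phi (- n.+1%:R)) * Z n.+1%:R @[n --> \oo] --> (0 : R).
  apply/cvgrPdist_le => /= e e0.
  pose D := 2 * (`|A| + 1); have D0 : 0 < D by rewrite mulr_gt0// ltr_wpDl.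
  have e' : 0 < e / D by rewrite divr_gt0.
  have := cvgZ; move/cvgrPdist_le => /(_ _ e') [N [_ HN]].
  near=> n; set T : R := n.+1%:R.
  have T1 : 1 <= T by rewrite ler1n.
  have NT : N < T.
    by apply: (@lt_trans _ _ n%:R); [near: n; exact: nbhs_infty_gtr|rewrite ltr_nat].
  have := HN T NT; rewrite !sub0r !normrN normrM (ger0_norm (le_trans ler01 T1)) => h.
  rewrite normrM.
  have h1 : `|phi T + phi (- T)| <= D * T.
    rewrite /D; apply: (le_trans (ler_normD _ _)).
    have := HA T; have := HA (- T); rewrite normrN (ger0_norm (le_trans ler01 T1)).
    have := ler_norm A; have := normr_ge0 A; nra.
  apply: (le_trans (ler_wpM2r (normr_ge0 (Z T)) h1)).
  by rewrite -(mulrA D) mulrC -ler_pdivlMr.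
have lim2 : \int[leb]_(x in `[- n%:R, n%:R]) F x @[n --> \oo] --> - (2 * phi 0 * Z 0).
  have lim4 : (phi n.+1%:R + phi (- n.+1%:R)) * Z n.+1%:R + - (2 * phi 0 * Z 0)
      @[n --> \oo] --> 0 + - (2 * phi 0 * Z 0).
    by apply: cvgD; [exact: lim3|exact: cvg_cst].
  rewrite -(@cvg_shiftS _ (fun n => \int[leb]_(x in `[- n%:R, n%:R]) F x)).
  rewrite (_ : (fun n => _) =
    (fun n => (phi n.+1%:R + phi (- n.+1%:R)) * Z n.+1%:R + - (2 * phi 0 * Z 0))).
    by rewrite add0r in lim4; exact: lim4.
  by apply/funext => n; exact: Fn.
have FJ : \int[leb]_(x in setT) F x = - (2 * phi 0 * Z 0).
  exact: (cvg_unique _ lim1 lim2).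
have ZJ : - (2 * Z 0) = signed_power q (u 0).
  by rewrite up// Y0 signed_power_pos// -jump ZE// Y0; ring.
rewrite FE in FJ; rewrite -/(u 0) -ZJ.
exact: weak_of_total FJ.
Unshelve. all: by end_near. Qed.

End solution.

(** * Reduction to the height at the origin *)

Section necessity.
Context {R : realType}.
Local Notation leb := (@lebesgue_measure R).
Implicit Types (u v Y Z W L : R -> R) (x a l m p q T e : R).

Lemma Rintegral_itv_le (f : R -> R) (A : set R) : measurable A -> (forall x, 0 <= f x) ->
  leb.-integrable setT (EFin \o f) ->
  \int[leb]_(x in A) f x <= \int[leb]_(x in setT) f x.
Proof.
move=> mA f0 fi; rewrite [leLHS]Rintegral_mkcond; apply: le_Rintegral => //.
  rewrite -restrict_EFin; apply: (proj1 (@integrable_mkcond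
         _ _ R leb A (EFin \o f) mA)).
  exact: integrableS fi.
by move=> x _; rewrite patchE; case: ifP.
Qed.

Lemma odeN p l Y Z : ode p l Y Z -> ode p l (fun x => - Y x) (fun x => - Z x).
Proof.
move=> YZ x /YZ[dY dZ]; split; first exact: is_deriveR_N.
by apply: (is_derive_congr (is_deriveR_N dZ)); rewrite signed_powerN; ring.
Qed.

Lemma solves_mass p q m u l : solves p q m u l -> [/\ continuous u,
  leb.-integrable setT (EFin \o (fun x => u x ^+ 2)) &
  m = \int[leb]_(x in setT) u x ^+ 2].
Proof.
move=> [_ [u' [cu uL _ _] _]]; have ui := Lfun2_integrable_sqr uL.
by rewrite Lnorm2_sqr// => -[].
Qed.

(* The integral of [Y^2] over the half-line for the profile [Y] of height [a]: the
   substitution [s = Y x] leads to [integral_0^a s / sqrt (l + 2/p s^(p-2)) ds]. *)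
Definition half_mass p l a (M : R) : Prop :=
  (0 < l /\ forall L T, mass_primitive ((p - 2) / 2) L -> 0 < T ->
     T `^ ((p - 2) / 2) = 2 / (p * l) * a `^ (p - 2) ->
     M = a ^+ 2 * L T / (2 * T * Num.sqrt l)) \/
  [/\ l = 0, p < 6 &
     M = a `^ (2 - (p - 2) / 2) / ((2 - (p - 2) / 2) * Num.sqrt (2 / p))].

Definition profile p l a Y : Prop :=
  [/\ Y 0 = a, (forall x, 0 <= x -> 0 < Y x) &
      (forall x, 0 <= x -> is_derive x 1 Y (- speed p l (Y x)))].

Lemma ode_profile p l a m Y Z W : 2 < p -> 0 <= l -> 0 < a -> ode p l Y Z -> Y 0 = a ->
  (forall x, 0 <= x -> is_derive x 1 W (Y x ^+ 2)) -> W 0 = 0 ->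
  (forall x, 0 <= x -> W x <= m) ->
  [/\ profile p l a Y, Z 0 = - speed p l a &
    exists2 M, half_mass p l a M & W x @[x --> +oo] --> M].
Proof.
move=> p2 l0 a0 YZ Y0 dW W0 Wm.
have Ypos := ode_pos p2 l0 YZ dW W0 Wm a0 Y0.
have ZE := ode_speed p2 l0 YZ dW W0 Wm a0 Y0.
have dY x : 0 <= x -> is_derive x 1 Y (- speed p l (Y x)).
  by move=> x0; rewrite -ZE//; have [] := YZ x x0.
have cY := ode_decay_cvg (ode_sqr_decay l0 YZ dW W0 Wm).
split=> //; first by rewrite ZE// Y0.
move: l0; rewrite le_eqVlt => /predU1P[lE|lpos].
  have p6 : p < 6.
    rewrite ltNge; apply/negP => p6.
    by apply: (mass_zero_frequency_infinite p2 Ypos Y0 dY cY dW W0 _ p6 Wm).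
  exists (a `^ (2 - (p - 2) / 2) / ((2 - (p - 2) / 2) * Num.sqrt (2 / p))).
    by right.
  exact: (mass_zero_frequency p2 Ypos Y0 dY cY dW W0 _ p6).
have n0 : 0 < (p - 2) / 2 by lra.
have [L LP] := @mass_primitive_exists R _ n0.
pose T := (2 / (p * l) * a `^ (p - 2)) `^ ((p - 2) / 2)^-1.
have TT0 : 0 < 2 / (p * l) * a `^ (p - 2).
  by rewrite mulr_gt0 ?powR_gt0// divr_gt0// mulr_gt0//; lra.
have T0 : 0 < T by rewrite powR_gt0.
have TE : T `^ ((p - 2) / 2) = 2 / (p * l) * a `^ (p - 2).
  by rewrite -powRrM mulVf ?gt_eqF// powRr1// ltW.
have lim L' T' : mass_primitive ((p - 2) / 2) L' -> 0 < T' ->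
    T' `^ ((p - 2) / 2) = 2 / (p * l) * a `^ (p - 2) ->
    W x @[x --> +oo] --> a ^+ 2 * L' T' / (2 * T' * Num.sqrt l).
  by move=> *; exact: (mass_positive_frequency p2 (ltW lpos) Ypos Y0 dY cY dW W0 lpos).
exists (a ^+ 2 * L T / (2 * T * Num.sqrt l)); last exact: lim.
left; split => // L' T' LP' T'0 T'E.
exact: (cvg_unique _ (lim _ _ LP T0 TE) (lim _ _ LP' T'0 T'E)).
Qed.

(** After the sign of [u 0] is factored out, each half-line carries a positive profile of the same
    height and frequency. Since [half_mass] determines its value from [l] and [a], the two masses
    agree, whence the factor 2. *)
Lemma solution_profile p q m u l : 2 < p -> 2 < q -> 0 < m -> solves p q m u l ->
  exists e a Yp Ym, [/\ (e = 1 \/ e = - 1) /\ 0 < a,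
    profile p l a Yp /\ profile p l a Ym,
    (forall x, 0 <= x -> u x = e * Yp x) /\ (forall x, 0 <= x -> u (- x) = e * Ym x),
    2 * speed p l a = a `^ (q - 1) & exists2 M, half_mass p l a M & m = 2 * M].
Proof.
move=> p2 q2 m0 sol; have [cu ui mE] := solves_mass sol.
have [l0 weak _] := sol.
have [Yp [Zp [Ym [Zm [odep odem Ep Em jump]]]]] := weak_solution_classical p2 weak.
have cu2 : continuous (fun x => u x ^+ 2) by move=> x; apply: continuous_sqr; exact: cu.
have [W [W0 dW]] := primitive_exists cu2.
have WI a b : a <= b -> \int[leb]_(x in `[a, b]) u x ^+ 2 = W b - W a.
  by move=> ab; apply: integral_derive => // x _; exact: cu2.
have Wle a b : a <= b -> W b - W a <= m.
  move=> ab; rewrite -WI// mE; apply: Rintegral_itv_le => // x; exact: sqr_ge0.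
have dWp x : 0 <= x -> is_derive x 1 W (Yp x ^+ 2) by move=> x0; rewrite Ep.
have Wpm x : 0 <= x -> W x <= m by move=> /Wle; rewrite W0 subr0.
have dWm x : 0 <= x -> is_derive x 1 (fun x => - W (- x)) (Ym x ^+ 2).
  move=> x0; rewrite Em//.
  apply: (is_derive_congr (is_deriveR_N
    (is_deriveR_comp (g := fun x => - x) (dW (- x)) (is_deriveR_N (is_deriveR_id x))))).
  by ring.
have Wm0 : - W (- 0) = 0 by rewrite oppr0 W0 oppr0.
have Wmm x : 0 <= x -> - W (- x) <= m.
  by move=> x0; have := Wle (- x) 0; rewrite W0 sub0r oppr_le0; exact.
have total (M1 M2 : R) : W x @[x --> +oo] --> M1 -> - W (- x) @[x --> +oo] --> M2 -> m = M1 + M2.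
  move=> c1 c2; have c1n := proj1 (cvg_pinftyP _ _) c1 (fun n => n%:R) cvgr_idn.
  have c2n := proj1 (cvg_pinftyP _ _) c2 (fun n => n%:R) cvgr_idn.
  have cs : (fun n : nat => W n%:R + - W (- n%:R)) @ \oo --> M1 + M2 by exact: cvgD c1n c2n.
  have := Rintegral_growing_cvg ui; rewrite -mE => cm.
  have nE : (fun n : nat => \int[leb]_(x in `[- n%:R, n%:R]) u x ^+ 2) =
      (fun n : nat => W n%:R + - W (- n%:R)).
    by apply/funext => n; rewrite WI// ge0_cp.
  rewrite nE in cm; exact: (cvg_unique _ cm cs).
have sgn : exists e, (e = 1 \/ e = - 1) /\ u 0 = e * `|u 0|.
  have [h|h] := leP 0 (u 0).
    by exists 1; split; [left|rewrite ger0_norm// mul1r].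
  by exists (- 1); split; [right|rewrite ltr0_norm// mulN1r opprK].
(* [u^2] is nonincreasing away from the origin, so [u 0 = 0] forces [u = 0], against a positive
   mass. *)
have [u00|u00] := eqVneq (u 0) 0.
  have Y0p : Yp 0 = 0 by rewrite Ep.
  have Y0m : Ym 0 = 0 by rewrite Em// oppr0.
  have z x : u x ^+ 2 <= 0.
    have [x0|x0] := leP 0 x.
      have := ode_sqr_nonincreasing l0 odep dWp W0 Wpm (lexx 0) x0.
      by rewrite Y0p expr0n/= Ep.
    have x0' : 0 <= - x by rewrite oppr_ge0 ltW.
    have := ode_sqr_nonincreasing l0 odem dWm Wm0 Wmm (lexx 0) x0'.
    by rewrite Y0m expr0n/= Em// opprK.
  suff : m = 0 by move=> mm; rewrite mm ltxx in m0.
  rewrite mE (@eq_Rintegral _ _ _ _ setT (fun _ => 0)).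
    by rewrite Rintegral_cst ?mul0r.
  by move=> x _; apply/eqP; rewrite eq_le z sqr_ge0.
have [e [ee ue]] := sgn; pose a := `|u 0|.
have a0 : 0 < a by rewrite normr_gt0.
have e2 : e * e = 1 by case: ee => ->; ring.
have eode Y Z : ode p l Y Z -> ode p l (fun x => e * Y x) (fun x => e * Z x).
  case: ee => -> h; last first.
    rewrite (_ : (fun x => - 1 * Y x) = fun x => - Y x); last by apply/funext => x; rewrite mulN1r.
    rewrite (_ : (fun x => - 1 * Z x) = fun x => - Z x); last by apply/funext => x; rewrite mulN1r.
    exact: odeN.
  rewrite (_ : (fun x => 1 * Y x) = Y); last by apply/funext => x; rewrite mul1r.
  by rewrite (_ : (fun x => 1 * Z x) = Z)//; apply/funext => x; rewrite mul1r.
have esq s : (e * s) ^+ 2 = s ^+ 2 by rewrite exprMn expr2 e2 mul1r.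
have ea s : s = u 0 -> e * s = a by move=> ->; rewrite ue mulrA e2 mul1r.
have dWp' x : 0 <= x -> is_derive x 1 W ((e * Yp x) ^+ 2) by rewrite esq; exact: dWp.
have dWm' x : 0 <= x -> is_derive x 1 (fun x => - W (- x)) ((e * Ym x) ^+ 2).
  by rewrite esq; exact: dWm.
have Y0p : e * Yp 0 = a by apply: ea; rewrite Ep.
have Y0m : e * Ym 0 = a by apply: ea; rewrite Em// oppr0.
have [Pp Z0p [M1 hM1 cM1]] := ode_profile p2 l0 a0 (eode _ _ odep) Y0p dWp' W0 Wpm.
have [Pm Z0m [M2 hM2 cM2]] := ode_profile p2 l0 a0 (eode _ _ odem) Y0m dWm' Wm0 Wmm.
exists e, a, (fun x => e * Yp x), (fun x => e * Ym x); split => //.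
- by split => x x0; rewrite mulrA e2 mul1r ?Ep ?Em.
- have -> : 2 * speed p l a = e * (- Zp 0 - Zm 0).
    by rewrite mulrBr mulrN Z0p Z0m; ring.
  rewrite jump ue -/a; case: ee => ->.
    by rewrite !mul1r signed_power_pos.
  by rewrite !mulN1r signed_powerN opprK signed_power_pos.
- exists M1 => //; rewrite (total _ _ cM1 cM2); suff -> : M2 = M1 by ring.
  case: hM1 hM2 => [[l1 h1]|[l1 _ h1]] [[l2 h2]|[l2 _ h2]].
  + have n0 : 0 < (p - 2) / 2 by lra.
    have [L LP] := @mass_primitive_exists R _ n0.
    pose T := (2 / (p * l) * a `^ (p - 2)) `^ ((p - 2) / 2)^-1.
    have TT0 : 0 < 2 / (p * l) * a `^ (p - 2).
      by rewrite mulr_gt0 ?powR_gt0// divr_gt0// mulr_gt0//; lra.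
    have T0 : 0 < T by rewrite powR_gt0.
    have TE : T `^ ((p - 2) / 2) = 2 / (p * l) * a `^ (p - 2).
      by rewrite -powRrM mulVf ?gt_eqF// powRr1// ltW.
    by rewrite (h1 _ _ LP T0 TE) (h2 _ _ LP T0 TE).
  + by rewrite l2 ltxx in l1.
  + by rewrite l1 ltxx in l2.
  + by rewrite h1 h2.
Qed.

Lemma profile_unique p l a (Y1 Y2 : R -> R) : 2 < p -> 0 <= l -> profile p l a Y1 ->
  profile p l a Y2 -> forall x, 0 <= x -> Y1 x = Y2 x.
Proof.
move=> p2 l0 [Y10 Y1p dY1] [Y20 Y2p dY2].
by apply: (speed_ode_unique p2 l0) => //; rewrite Y10.
Qed.

Lemma solution_exists p q l a (M : R) : 2 < p -> 0 <= l -> 0 < a ->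
  2 * speed p l a = a `^ (q - 1) -> half_mass p l a M -> admits_solution p q (2 * M).
Proof.
move=> p2 l0 a0 jump hM.
have [Y [Z [YZ Y0 Ypos ZE cY]]] := profile_exists p2 l0 a0.
have dY x : 0 <= x -> is_derive x 1 Y (- speed p l (Y x)).
  by move=> x0; rewrite -ZE//; have [] := YZ x x0.
have cu2 : continuous (fun x => Y `|x| ^+ 2).
  move=> x; apply: continuous_sqr; apply: (continuous_even_extension (Y := Y)) => y y0.
  by have [dYy _] := YZ y y0; exact: is_derive_continuous dYy.
have [W [W0 dW]] := primitive_exists cu2.
have dW' x : 0 <= x -> is_derive x 1 W (Y x ^+ 2).
  by move=> x0; have := dW x; rewrite ger0_norm.
exists (fun x => Y `|x|), l.
apply: (profile_solution p2 l0 a0 YZ Y0 Ypos ZE cY W0 dW') => //.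
case: hM => [[lpos hM]|[lE p6 ->]]; last first.
  exact: (mass_zero_frequency p2 Ypos Y0 dY cY dW' W0 lE p6).
have n0 : 0 < (p - 2) / 2 by lra.
have [L LP] := @mass_primitive_exists R _ n0.
pose T := (2 / (p * l) * a `^ (p - 2)) `^ ((p - 2) / 2)^-1.
have TT0 : 0 < 2 / (p * l) * a `^ (p - 2).
  by rewrite mulr_gt0 ?powR_gt0// divr_gt0// mulr_gt0//; lra.
have T0 : 0 < T by rewrite powR_gt0.
have TE : T `^ ((p - 2) / 2) = 2 / (p * l) * a `^ (p - 2).
  by rewrite -powRrM mulVf ?gt_eqF// powRr1// ltW.
rewrite (hM _ _ LP T0 TE).
exact: (mass_positive_frequency p2 (ltW lpos) Ypos Y0 dY cY dW' W0 lpos).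
Qed.

End necessity.

(** * Frequency and mass in terms of the height *)

Section parametrization.
Context {R : realType}.
Implicit Types (u v Y L : R -> R) (a b l m p q t n T M : R).

(* The dimensionless mass: [integral_0^1 s / sqrt (1 - t (1 - s^(p-2))) ds] for
   [n = (p - 2) / 2]; it is finite at [t = 1], i.e. at zero frequency, iff [n < 2]. *)
Definition reduced_mass n L t : R :=
  if t < 1 then L ((t / (1 - t)) `^ n^-1) / (2 * (t / (1 - t)) `^ n^-1 * Num.sqrt (1 - t))
  else (2 - n)^-1.

(* The values of [ratio] for which a positive frequency ([t < 1]), or a zero frequency
   with a square-integrable profile ([t = 1] and [p < 6]), exists. *)
Definition admissible p t : Prop := 0 < t < 1 \/ t = 1 /\ p < 6.

(* The jump condition reads [l = a^(2q-4) (1 - ratio p q a) / 4]. *)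
Definition ratio p q a : R := 8 / p * a `^ (p + 2 - 2 * q).

Lemma mass_primitive_eq n L L' x : mass_primitive n L -> mass_primitive n L' ->
  0 <= x -> L x = L' x.
Proof.
move=> [L0 dL] [L'0 dL'] x0.
by have := eq_derive_eq0 (fun y _ => dL y) (fun y _ => dL' y) x0; rewrite L0 L'0 !subr0.
Qed.

Section fixed.
Variables (p q a l : R).
Hypotheses (p2 : 2 < p) (a0 : 0 < a) (l0 : 0 <= l).
Let t := ratio p q a.
Let A := a `^ (2 * q - 4).
Let A0 : 0 < A. Proof. exact: powR_gt0. Qed.
Let p0 : 0 < p. Proof. by have p2' := p2; lra. Qed.

Let tpos : 0 < t. Proof. by rewrite mulr_gt0 ?powR_gt0// divr_gt0. Qed.

(** The radicand of the speed at height [a] is thus [l + A * t / 4], and the jump condition requires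
    it to equal [A / 4]. *)
Let powE : 2 / p * a `^ (p - 2) = A * t / 4.
Proof.
rewrite /t /ratio (_ : A * (8 / p * a `^ (p + 2 - 2 * q)) / 4 =
  2 / p * (A * a `^ (p + 2 - 2 * q))); last by field; rewrite gt_eqF.
by rewrite /A powR_mulD//; congr (_ * _ `^ _); ring.
Qed.

Lemma jump_frequency : 2 * speed p l a = a `^ (q - 1) <-> l = A * (1 - t) / 4.
Proof.
have l0' := l0.
have pA0 : 0 <= A * t / 4 by rewrite divr_ge0// mulr_ge0 ?ltW.
have -> : a `^ (q - 1) = a * a `^ (q - 2) by rewrite powR_mulS//; congr (_ `^ _); ring.
rewrite /speed powE mulrCA; have a_neq0 : a != 0 by rewrite gt_eqF.
have AE : A = (a `^ (q - 2)) ^+ 2.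
  by rewrite -(powR_mulrn 2 (powR_ge0 _ _)) -powRrM /A; congr (_ `^ _); ring.
split=> [/(mulfI a_neq0) E|lE].
  have : (2 * Num.sqrt (l + A * t / 4)) ^+ 2 = A by rewrite E AE.
  by rewrite exprMn sqr_sqrtr ?addr_ge0//; lra.
congr (_ * _); rewrite lE (_ : A * (1 - t) / 4 + A * t / 4 = (a `^ (q - 2) / 2) ^+ 2).
  by rewrite sqrtr_sqr ger0_norm ?divr_ge0 ?powR_ge0//; field.
by rewrite AE; field.
Qed.

Hypothesis lE : l = A * (1 - t) / 4.
Variable L : R -> R.
Hypothesis LP : mass_primitive ((p - 2) / 2) L.
Let n := (p - 2) / 2.
Let n0 : 0 < n. Proof. by have p2' := p2; rewrite /n; lra. Qed.

Let sqrt_l : t < 1 -> Num.sqrt l = a `^ (q - 2) * Num.sqrt (1 - t) / 2.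
Proof.
move=> t1; rewrite lE.
have -> : A * (1 - t) / 4 = (a `^ (q - 2) / 2) ^+ 2 * (1 - t).
  rewrite exprMn -(powR_mulrn 2 (powR_ge0 _ _)) -powRrM.
  by rewrite (_ : (q - 2) * 2 = 2 * q - 4) -/A; [field|ring].
rewrite sqrtrM ?sqr_ge0// sqrtr_sqr ger0_norm ?divr_ge0 ?powR_ge0//.
by rewrite mulrAC.
Qed.

Let T := (t / (1 - t)) `^ n^-1.

Let TE : t < 1 -> T `^ n = 2 / (p * l) * a `^ (p - 2).
Proof.
move=> t1; have t1' : 0 < 1 - t by rewrite subr_gt0.
rewrite /T -powRrM mulVf ?gt_eqF// powRr1; last by rewrite divr_ge0 ?ltW.
rewrite (_ : 2 / (p * l) * a `^ (p - 2) = 2 / p * a `^ (p - 2) / l); last first.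
  by rewrite invfM mulrA mulrAC.
by rewrite powE lE; field; rewrite !gt_eqF.
Qed.

Let T0 : t < 1 -> 0 < T.
Proof. by move=> t1; rewrite powR_gt0// divr_gt0// subr_gt0. Qed.

Let mass_lt1 : t < 1 ->
  a ^+ 2 * L T / (2 * T * Num.sqrt l) = 2 * a `^ (4 - q) * reduced_mass n L t.
Proof.
move=> t1; rewrite sqrt_l// /reduced_mass t1 -/T.
have -> : a ^+ 2 = a `^ (4 - q) * a `^ (q - 2).
  by rewrite powR_mulD// -(powR_mulrn 2 (ltW a0)); congr (_ `^ _); ring.
have s0 : Num.sqrt (1 - t) != 0 by rewrite gt_eqF// sqrtr_gt0 subr_gt0.
have T_neq0 : T != 0 by rewrite gt_eqF// T0.
have a_neq0 : a `^ (q - 2) != 0 by rewrite gt_eqF// powR_gt0.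
by field; rewrite ?s0 ?T_neq0 ?a_neq0.
Qed.

Let mass_eq1 : t = 1 -> p < 6 ->
  a `^ (2 - n) / ((2 - n) * Num.sqrt (2 / p)) = 2 * a `^ (4 - q) * reduced_mass n L t.
Proof.
move=> t1 p6; rewrite /reduced_mass t1 ltxx.
(* At [t = 1] the height is tied to [p]: the equation [ratio p q a = 1] turns the constant [2 / p]
   into a power of [a], so both frequency regimes share one mass formula. *)
have E : 2 / p = (a `^ (q - 1 - p / 2) / 2) ^+ 2.
  have : 8 / p * a `^ (p + 2 - 2 * q) = 1 by [].
  have b0 : 0 < a `^ (p + 2 - 2 * q) by exact: powR_gt0.
  rewrite exprMn -(powR_mulrn 2 (powR_ge0 _ _)) -powRrM.
  rewrite (_ : (q - 1 - p / 2) * 2 = - (p + 2 - 2 * q)); last by field.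
  rewrite powRN => h; apply: (mulIf (lt0r_neq0 b0)).
  rewrite [RHS]mulrAC mulVf ?gt_eqF//.
  rewrite (_ : 2 / p * a `^ (p + 2 - 2 * q) = 8 / p * a `^ (p + 2 - 2 * q) / 4); last first.
    by field; rewrite gt_eqF.
  by rewrite h; field.
rewrite E sqrtr_sqr ger0_norm ?divr_ge0 ?powR_ge0//.
have -> : a `^ (2 - n) = a `^ (4 - q) * a `^ (q - 1 - p / 2).
  by rewrite powR_mulD//; congr (_ `^ _); rewrite /n; field.
have n2 : 0 < 2 - n by rewrite /n; lra.
by field; rewrite !gt_eqF// powR_gt0.
Qed.

Lemma half_mass_ratio M : half_mass p l a M ->
  admissible p t /\ 2 * M = 4 * a `^ (4 - q) * reduced_mass n L t.
Proof.
case=> [[lpos hM]|[lz p6 ->]].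
  have t1 : t < 1.
    rewrite ltNge; apply/negP => t1; move: lpos; rewrite lE ltNge => /negP; apply.
    by rewrite pmulr_lle0 ?invr_gt0// pmulr_rle0 ?subr_le0.
  split; first by left; rewrite tpos t1.
  by rewrite (hM _ _ LP (T0 t1) (TE t1)) mass_lt1//; ring.
have t1 : t = 1.
  move: lz; rewrite lE => /eqP; rewrite !mulf_eq0 (gt_eqF A0) invr_eq0 pnatr_eq0 orbF/=.
  by rewrite subr_eq0 => /eqP.
split; first by right.
by rewrite -/n mass_eq1//; ring.
Qed.

Lemma ratio_half_mass : admissible p t ->
  half_mass p l a (2 * a `^ (4 - q) * reduced_mass n L t).
Proof.
case=> [/andP[_ t1]|[t1 p6]]; last first.
  right; split=> //; first by rewrite lE t1 subrr mulr0 mul0r.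
  by rewrite -/n mass_eq1.
left; split; first by rewrite lE divr_gt0// mulr_gt0// subr_gt0.
move=> L' T' LP' T'0 T'E; rewrite -mass_lt1//.
have -> : T' = T.
  apply: (powR_injective n0); rewrite ?inE ?nnegrE ?(ltW T'0) ?(ltW (T0 t1))//.
  by rewrite TE.
by rewrite (mass_primitive_eq LP LP' (ltW (T0 t1))).
Qed.

End fixed.

Lemma admits_ratio p q m L : 2 < p -> 2 < q -> 0 < m ->
  mass_primitive ((p - 2) / 2) L ->
  (admits_solution p q m <-> exists2 a, 0 < a & admissible p (ratio p q a) /\
     m = 4 * a `^ (4 - q) * reduced_mass ((p - 2) / 2) L (ratio p q a)).
Proof.
move=> p2 q2 m0 LP; split=> [[u [l sol]]|[a a0 [adm mE]]].
  have [l0 _ _] := sol.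
  have [e [a [Yp [Ym [[_ a0] _ _ jump [M hM ->]]]]]] := solution_profile p2 q2 m0 sol.
  have lE := proj1 (jump_frequency q p2 a0 l0) jump.
  by exists a => //; exact: (half_mass_ratio p2 a0 lE LP hM).
pose l := a `^ (2 * q - 4) * (1 - ratio p q a) / 4.
have l0 : 0 <= l.
  rewrite /l divr_ge0// mulr_ge0 ?powR_ge0// subr_ge0.
  by case: adm => [/andP[_ /ltW]//|[->]].
have jump := proj2 (jump_frequency q p2 a0 l0) erefl.
have hM := ratio_half_mass p2 a0 (erefl l) LP adm.
have := solution_exists p2 l0 a0 jump hM.
by rewrite mE; congr (admits_solution p q _); ring.
Qed.

(** The height determines the frequency by the jump condition, and both determine the profile on
    each half-line; only the sign at 0 remains free. *)
Lemma unique_ratio p q m L : 2 < p -> 2 < q -> 0 < m ->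
  mass_primitive ((p - 2) / 2) L ->
  (forall a b, 0 < a -> 0 < b -> admissible p (ratio p q a) -> admissible p (ratio p q b) ->
     a `^ (4 - q) * reduced_mass ((p - 2) / 2) L (ratio p q a) =
     b `^ (4 - q) * reduced_mass ((p - 2) / 2) L (ratio p q b) -> a = b) ->
  unique_up_to_sign p q m.
Proof.
move=> p2 q2 m0 LP inj u l v k sol1 sol2.
have [l0 _ _] := sol1; have [k0 _ _] := sol2.
have [e [a [Yp [Ym [[ee a0] [Pp Pm] [up um] jump [M hM mE]]]]]] :=
  solution_profile p2 q2 m0 sol1.
have [f [b [Xp [Xm [[ff b0] [Qp Qm] [vp vm] jump' [M' hM' mE']]]]]] :=
  solution_profile p2 q2 m0 sol2.
have lE := proj1 (jump_frequency q p2 a0 l0) jump.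
have kE := proj1 (jump_frequency q p2 b0 k0) jump'.
have [adm1 m1] := half_mass_ratio p2 a0 lE LP hM.
have [adm2 m2] := half_mass_ratio p2 b0 kE LP hM'.
have ab : a = b.
  apply: inj => //; apply: (@mulfI _ 4); first by rewrite pnatr_eq0.
  by rewrite !mulrA -m1 -m2 -mE -mE'.
subst b; have kl : k = l by rewrite lE kE.
split=> //; rewrite kl in Qp Qm.
have e2 : f * f = 1 by case: ff => ->; ring.
have vE x : v x = f * e * u x.
  have ee2 : e * e = 1 by case: ee => ->; ring.
  have [x0|x0] := leP 0 x.
    rewrite vp// up// -(profile_unique p2 l0 Pp Qp x0).
    by rewrite mulrA -(mulrA f) ee2 mulr1.
  have x0' : 0 <= - x by rewrite oppr_ge0 ltW.
  have := vm _ x0'; have := um _ x0'; rewrite !opprK => -> ->.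
  rewrite -(profile_unique p2 l0 Pm Qm x0').
  by rewrite mulrA -(mulrA f) ee2 mulr1.
have : f * e = 1 \/ f * e = - 1.
  by case: ee ff => -> [] ->; [left|right|right|left]; ring.
case=> fe; [left|right]; apply/funext => x; rewrite vE fe ?mul1r//.
by rewrite mulN1r.
Qed.

End parametrization.

(** * The range of the mass *)

Section reduced_mass.
Context {R : realType}.
Implicit Types (s t r x y m : R) (H : R -> R).
Variables (n : R) (L : R -> R).
Hypotheses (n0 : 0 < n) (LP : mass_primitive n L).

Let G := reduced_mass n L.

Definition mass_density k t s : R := (2 * Num.sqrt (1 - t + t * s `^ k))^-1.

Let h := mass_density n.

(** Rescaling the variable of [L] by [T], where [T^n = t / (1 - t)], fixes the interval [[0, 1]] for
    all [t]; different values of [t] are then compared through their densities. *)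
Lemma reduced_mass_primitive t : 0 < t < 1 -> exists H, [/\ H 0 = 0, H 1 = G t &
  forall s, 0 <= s -> is_derive s 1 H (h t s)].
Proof.
move=> /andP[t0 t1]; have [L0 dL] := LP; have n0' := n0.
have t1' : 0 < 1 - t by rewrite subr_gt0.
pose T := (t / (1 - t)) `^ n^-1.
have T0 : 0 < T by rewrite powR_gt0// divr_gt0.
have TE : T `^ n = t / (1 - t).
  by rewrite /T -powRrM mulVf ?gt_eqF// powRr1// ltW// divr_gt0.
have q0 : 0 < Num.sqrt (1 - t) by rewrite sqrtr_gt0.
exists (fun s => L (T * s) / (2 * T * Num.sqrt (1 - t))); split.
- by rewrite mulr0 L0 mul0r.
- by rewrite mulr1 /G /reduced_mass t1.
- move=> s s0; have dLs := is_deriveR_comp (f := L) (g := fun x => T * x)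
    (dL _) (is_deriveR_M (is_deriveR_cst T s) (is_deriveR_id s)).
  eapply is_derive_congr; first by derivs.
  have s_n : 0 <= s `^ n by exact: powR_ge0.
  rewrite ger0_norm; last by rewrite mulr_ge0// ltW.
  rewrite powRM ?(ltW T0)// TE /h /mass_density.
  have -> : 1 - t + t * s `^ n = (1 - t) * (1 + t / (1 - t) * s `^ n).
    by field; rewrite gt_eqF.
  rewrite sqrtrM ?(ltW t1')//.
  have S0 : Num.sqrt (1 + t / (1 - t) * s `^ n) != 0.
    rewrite gt_eqF// sqrtr_gt0 ltr_pwDl// mulr_ge0// divr_ge0 ?ltW//.
  have q_neq0 : Num.sqrt (1 - t) != 0 by rewrite gt_eqF.
  have T_neq0 : T != 0 by rewrite gt_eqF.
  by rewrite /=; field; rewrite ?S0 ?q_neq0 ?T_neq0.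
Qed.

Let argpos t s : 0 < t -> t < 1 -> 0 < 1 - t + t * s `^ n.
Proof.
move=> t0 t1; have := mulr_ge0 (ltW t0) (powR_ge0 s n); lra.
Qed.

Let hpos t s : 0 < t -> t < 1 -> 0 < h t s.
Proof. by move=> t0 t1; rewrite invr_gt0 mulr_gt0// sqrtr_gt0 argpos. Qed.

Let pow01 s : 0 <= s -> s <= 1 -> 0 <= s `^ n <= 1.
Proof.
move=> s0 s1; rewrite powR_ge0/=; have -> : 1 = 1 `^ n :> R by rewrite powR1.
by apply: ge0_ler_powR; rewrite ?nnegrE ?(ltW n0).
Qed.

(** Strictness is asked only on [[0, 1/2]] because at [s = 1] every density takes the value 1/2. *)
Lemma primitive_lt H1 H2 (h1 h2 : R -> R) : H1 0 = 0 -> H2 0 = 0 ->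
  (forall s, 0 <= s -> is_derive s 1 H1 (h1 s)) ->
  (forall s, 0 <= s -> is_derive s 1 H2 (h2 s)) ->
  (forall s, 0 <= s -> s <= 1 -> h1 s <= h2 s) ->
  (forall s, 0 <= s -> s <= 2^-1 -> h1 s < h2 s) -> H1 1 < H2 1.
Proof.
move=> H10 H20 d1 d2 hle hlt.
have half0 : 0 <= 2^-1 :> R by rewrite invr_ge0.
have half1 : 2^-1 <= 1 :> R by lra.
have dD12 s : 0 <= s <= 2^-1 -> is_derive s 1 (fun x => H2 x - H1 x) (h2 s - h1 s).
  by move=> /andP[s0 _]; exact: (is_deriveR_D (d2 _ s0) (is_deriveR_N (d1 _ s0))).
have [c /andP[c0 c2]] := mean_value half0 dD12.
rewrite H10 H20 !subr0 => E.
have step1 : 0 < H2 2^-1 - H1 2^-1.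
  by rewrite E mulr_gt0 ?invr_gt0// subr_gt0 hlt.
have e1 s : 2^-1 <= s <= 1 -> is_derive s 1 H1 (h1 s).
  by move=> /andP[s0 _]; apply: d1; exact: le_trans s0.
have e2 s : 2^-1 <= s <= 1 -> is_derive s 1 H2 (h2 s).
  by move=> /andP[s0 _]; apply: d2; exact: le_trans s0.
have := le_derive_le half1 e1 e2.
have hh s : 2^-1 <= s <= 1 -> h1 s <= h2 s.
  by move=> /andP[s0 s1]; apply: hle => //; exact: le_trans s0.
by move=> /(_ hh); lra.
Qed.

Lemma reduced_mass_lt t t' : 0 < t -> t < t' -> t' < 1 -> G t < G t'.
Proof.
move=> t0 tt t1; have t'0 := lt_trans t0 tt; have t1' := lt_trans tt t1.
have [|H [H0 <- dH]] := @reduced_mass_primitive t; first by rewrite t0.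
have [|H' [H'0 <- dH']] := @reduced_mass_primitive t'; first by rewrite t'0.
apply: (primitive_lt H0 H'0 dH dH') => s s0 s1.
  have /andP[y0 y1] := pow01 s0 s1.
  rewrite /h /mass_density lef_pV2 ?posrE ?mulr_gt0 ?sqrtr_gt0 ?argpos// ler_pM2l//.
  apply: ler_wsqrtr; nra.
have s1' : s < 1 by apply: (le_lt_trans s1); rewrite invf_lt1// ltr1n.
have /andP[y0 y1] := pow01 s0 (ltW s1').
have y1' : s `^ n < 1.
  have -> : 1 = 1 `^ n :> R by rewrite powR1.
  by apply: gt0_ltr_powR; rewrite ?nnegrE.
rewrite /h /mass_density ltf_pV2 ?posrE ?mulr_gt0 ?sqrtr_gt0 ?argpos// ltr_pM2l//.
by rewrite ltr_sqrt ?argpos//; nra.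
Qed.

Lemma reduced_mass_gt_half t : 0 < t -> t < 1 -> 2^-1 < G t.
Proof.
move=> t0 t1; have [|H [H0 <- dH]] := @reduced_mass_primitive t; first by rewrite t0.
have dlin (s : R) : 0 <= s -> is_derive s 1 (fun x => x / 2) 2^-1.
  by move=> _; eapply is_derive_congr; [derivs|rewrite /=; ring].
have : (fun x : R => x / 2) 1 < H 1; last by rewrite mul1r.
apply: (primitive_lt _ H0 dlin dH); first by rewrite mul0r.
  move=> s s0 s1; have /andP[y0 y1] := pow01 s0 s1.
  rewrite /h /mass_density lef_pV2 ?posrE ?mulr_gt0 ?sqrtr_gt0 ?argpos//.
  rewrite -[leRHS]mulr1 ler_pM2l// -[leRHS]sqrtr1; apply: ler_wsqrtr; nra.
move=> s s0 s1.
have s1' : s < 1 by apply: (le_lt_trans s1); rewrite invf_lt1// ltr1n.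
have y1' : s `^ n < 1.
  have -> : 1 = 1 `^ n :> R by rewrite powR1.
  by apply: gt0_ltr_powR; rewrite ?nnegrE.
rewrite /h /mass_density ltf_pV2 ?posrE ?mulr_gt0 ?sqrtr_gt0 ?argpos//.
by rewrite -[ltRHS]mulr1 ltr_pM2l// -[ltRHS]sqrtr1 ltr_sqrt//; nra.
Qed.

(** The density is largest at [s = 0]. The bound tends to 1/2 with [t] tending to 0 and so matches
    [reduced_mass_gt_half]. *)
Lemma reduced_mass_le t : 0 < t -> t < 1 -> G t <= (2 * Num.sqrt (1 - t))^-1.
Proof.
move=> t0 t1; have [|H [H0 <- dH]] := @reduced_mass_primitive t; first by rewrite t0.
have t1' : 0 < 1 - t by rewrite subr_gt0.
pose C := (2 * Num.sqrt (1 - t))^-1.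
have d1 s : 0 <= s <= 1 -> is_derive s 1 H (h t s) by move=> /andP[s0 _]; exact: dH.
have d2 (s : R) : 0 <= s <= 1 -> is_derive s 1 (fun x => C * x) C.
  by move=> _; eapply is_derive_congr; [derivs|rewrite /=; ring].
have := le_derive_le ler01 d1 d2; rewrite H0 mulr1 mulr0 !subr0; apply.
move=> s _; rewrite /h /mass_density /C.
rewrite lef_pV2 ?posrE ?mulr_gt0 ?sqrtr_gt0 ?argpos// ler_pM2l//.
by apply: ler_wsqrtr; rewrite lerDl mulr_ge0 ?powR_ge0// ltW.
Qed.

(** For [n >= 2] the radicand is at most [r^2 + s^2 <= (r + s)^2], and [1 / (2 (r + s))] integrates
    to a logarithm that diverges as [t] tends to 1. *)
Lemma reduced_mass_ge_ln t : 2 <= n -> 0 < t -> t < 1 ->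
  - (ln (Num.sqrt (1 - t)) / 2) <= G t.
Proof.
move=> n2 t0 t1; have [|H [H0 <- dH]] := @reduced_mass_primitive t; first by rewrite t0.
pose r := Num.sqrt (1 - t).
have r0 : 0 < r by rewrite sqrtr_gt0 subr_gt0.
have r2 : r ^+ 2 = 1 - t by rewrite sqr_sqrtr// subr_ge0 ltW.
have d1 s : 0 <= s <= 1 -> is_derive s 1 H (h t s) by move=> /andP[s0 _]; exact: dH.
have d2 s : 0 <= s <= 1 -> is_derive s 1 (fun x => ln (r + x) / 2) (2 * (r + s))^-1.
  move=> /andP[s0 _]; have rs : 0 < r + s by rewrite ltr_pwDl.
  have dl := is_deriveR_ln (f := fun x => r + x) rs
    (is_deriveR_D (is_deriveR_cst r s) (is_deriveR_id s)).
  eapply is_derive_congr; first by derivs.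
  by rewrite /=; field; rewrite gt_eqF.
have := le_derive_le ler01 d2 d1; rewrite H0 subr0 addr0 => hle.
apply: (@le_trans _ _ (ln (r + 1) / 2 - ln r / 2)).
  by rewrite lerDr divr_ge0// ln_ge0// lerDr ltW.
apply: hle => s /andP[s0 s1]; rewrite /h /mass_density.
have rs : 0 < r + s by rewrite ltr_pwDl.
rewrite lef_pV2 ?posrE ?mulr_gt0 ?sqrtr_gt0 ?argpos// ler_pM2l//.
rewrite -[leRHS](ger0_norm (ltW rs)) -sqrtr_sqr; apply: ler_wsqrtr; rewrite -r2.
have : s `^ n <= s ^+ 2.
  move: s0; rewrite le_eqVlt => /predU1P[<-|s0].
    by rewrite powR0 ?expr0n ?gt_eqF.
  rewrite -(powR_mulrn 2 (ltW s0)); apply: ger_powR => //.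
  by rewrite s0.
have := powR_ge0 s n; set y := _ `^ _ => y0 ys.
have := mulr_ge0 (ltW r0) s0; nra.
Qed.

Let powder s : 0 < s -> n < 2 ->
  is_derive s 1 (fun x => x `^ (1 - n / 2) / (2 - n)) (2 * Num.sqrt (s `^ n))^-1.
Proof.
move=> s0 n2; have n2' : 2 - n != 0 by rewrite gt_eqF// subr_gt0.
have dp := is_deriveR_powR (f := fun x => x) (1 - n / 2) s0 (is_deriveR_id s).
eapply is_derive_congr; first by derivs.
rewrite /= sqrt_powR invfM -powRN (_ : 1 - n / 2 - 1 = - (n / 2)); last by ring.
by field.
Qed.

(** The density is at most its limit at [t = 1], but the primitive of that limit is not
    differentiable at 0. The interval is cut at a small [d], with the crude bound [C * d] below
    it. *)
Lemma reduced_mass_le1 t : n < 2 -> 0 < t -> t < 1 -> G t <= (2 - n)^-1.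
Proof.
move=> n2 t0 t1; have [|H [H0 <- dH]] := @reduced_mass_primitive t; first by rewrite t0.
have n2' : 0 < 2 - n by rewrite subr_gt0.
have t1' : 0 < 1 - t by rewrite subr_gt0.
pose C := (2 * Num.sqrt (1 - t))^-1.
have C0 : 0 < C by rewrite invr_gt0 mulr_gt0// sqrtr_gt0.
have bound d : 0 < d -> d <= 1 -> H 1 <= (2 - n)^-1 + C * d.
  move=> d0 d1.
  have e1 s : 0 <= s <= d -> is_derive s 1 H (h t s) by move=> /andP[s0 _]; exact: dH.
  have e2 (s : R) : 0 <= s <= d -> is_derive s 1 (fun x => C * x) C.
    by move=> _; eapply is_derive_congr; [derivs|rewrite /=; ring].
  have := le_derive_le (ltW d0) e1 e2; rewrite H0 mulr0 !subr0 => Hd.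
  have {}Hd : H d <= C * d.
    apply: Hd => s _; rewrite /h /mass_density /C.
    rewrite lef_pV2 ?posrE ?mulr_gt0 ?sqrtr_gt0 ?argpos// ler_pM2l//.
    by apply: ler_wsqrtr; rewrite lerDl mulr_ge0 ?powR_ge0// ltW.
  have e3 s : d <= s <= 1 -> is_derive s 1 H (h t s).
    by move=> /andP[ds _]; apply: dH; exact: le_trans (ltW d0) ds.
  have e4 s : d <= s <= 1 -> is_derive s 1 (fun x => x `^ (1 - n / 2) / (2 - n))
      (2 * Num.sqrt (s `^ n))^-1.
    by move=> /andP[ds _]; apply: powder => //; exact: lt_le_trans ds.
  have H1d : H 1 - H d <= 1 `^ (1 - n / 2) / (2 - n) - d `^ (1 - n / 2) / (2 - n).
    apply: (le_derive_le d1 e3 e4) => s /andP[ds s1].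
    have s0 : 0 < s by exact: lt_le_trans ds.
    have /andP[y0 y1] := pow01 (ltW s0) s1.
    rewrite /h /mass_density.
    rewrite lef_pV2 ?posrE ?mulr_gt0 ?sqrtr_gt0 ?argpos ?powR_gt0// ler_pM2l//.
    by apply: ler_wsqrtr; nra.
  have : 0 <= d `^ (1 - n / 2) / (2 - n) by rewrite divr_ge0 ?powR_ge0// ltW.
  by move: H1d; rewrite powR1 mul1r; lra.
apply/ler_addgt0Pr => e e0.
have m0 : 0 < Num.min 1 (e / C) by rewrite lt_min ltr01 divr_gt0.
have m1 : Num.min 1 (e / C) <= 1 by rewrite ge_min lexx.
apply: (le_trans (bound _ m0 m1)); rewrite lerD2l.
rewrite mulrC -ler_pdivlMr// ge_min lexx orbT//.
Qed.

(** Above the cut [d = r^(1/n)] one has [r <= s^n], which makes the density at least [1 - r] times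
    its limit at [t = 1]; below the cut only its sign is used. *)
Lemma reduced_mass_ge1 t (r := Num.sqrt (1 - t) : R) : n < 2 -> 0 < t -> t < 1 ->
  (1 - r) * (1 - r `^ ((1 - n / 2) / n)) * (2 - n)^-1 <= G t.
Proof.
move=> n2 t0 t1; have [|H [H0 <- dH]] := @reduced_mass_primitive t; first by rewrite t0.
have n2' : 0 < 2 - n by rewrite subr_gt0.
have t1' : 0 < 1 - t by rewrite subr_gt0.
have r0 : 0 < r by rewrite sqrtr_gt0.
have r2 : r ^+ 2 = 1 - t by rewrite sqr_sqrtr// ltW.
have r1 : r < 1.
  by rewrite -(ltr_pXn2r (ltn0Sn 1)) ?nnegrE ?(ltW r0)// expr1n r2; lra.
pose d := r `^ n^-1.
have d0 : 0 < d by rewrite powR_gt0.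
have dn : d `^ n = r by rewrite -powRrM mulVf ?gt_eqF// powRr1// ltW.
have d1 : d <= 1.
  have -> : 1 = 1 `^ n^-1 :> R by rewrite powR1.
  by apply: ge0_ler_powR; rewrite ?nnegrE ?invr_ge0 ?(ltW n0) ?(ltW r0) ?(ltW r1).
have Hd : 0 <= H d.
  have e1 s : 0 <= s <= d -> is_derive s 1 H (h t s) by move=> /andP[s0 _]; exact: dH.
  by rewrite -H0; apply: (ge0_derive_le (ltW d0) e1) => s _; exact: ltW (hpos _ _ _).
have e3 s : d <= s <= 1 -> is_derive s 1 H (h t s).
  by move=> /andP[ds _]; apply: dH; exact: le_trans (ltW d0) ds.
have e4 s : d <= s <= 1 ->
    is_derive s 1 (fun x => (1 - r) * (x `^ (1 - n / 2) / (2 - n)))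
      ((1 - r) * (2 * Num.sqrt (s `^ n))^-1).
  move=> /andP[ds _]; have s0 := lt_le_trans d0 ds.
  apply: (is_derive_congr (is_deriveR_M (is_deriveR_cst (1 - r) s) (powder s0 n2))).
  by rewrite mul0r addr0.
have H1d : (1 - r) * (1 `^ (1 - n / 2) / (2 - n)) - (1 - r) * (d `^ (1 - n / 2) / (2 - n))
    <= H 1 - H d.
  apply: (le_derive_le d1 e4 e3) => s /andP[ds s1].
  have s0 := lt_le_trans d0 ds.
  have ry : r <= s `^ n.
    by rewrite -dn; apply: ge0_ler_powR; rewrite ?nnegrE ?(ltW n0) ?(ltW d0) ?(ltW s0).
  rewrite /h /mass_density; set y := s `^ n in ry *.
  have y0 : 0 < y by exact: lt_le_trans ry.
  rewrite -ler_pdivlMr ?invr_gt0 ?mulr_gt0 ?sqrtr_gt0// invrK.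
  rewrite mulrC ler_pdivlMr ?mulr_gt0 ?sqrtr_gt0 ?argpos//.
  rewrite mulrCA ler_pM2l//.
  have -> : (1 - r) * Num.sqrt (1 - t + t * y) = Num.sqrt ((1 - r) ^+ 2 * (1 - t + t * y)).
    by rewrite sqrtrM ?sqr_ge0// sqrtr_sqr ger0_norm// subr_ge0 ltW.
  apply: ler_wsqrtr; rewrite -r2.
  have b1 : r ^+ 2 + t * y <= (1 + r) * y.
    have : t * y <= y by rewrite -[leRHS]mul1r; apply: ler_wpM2r; exact: ltW.
    have : r * r <= r * y by apply: ler_wpM2l => //; exact: ltW.
    by rewrite expr2; lra.
  apply: (le_trans (ler_wpM2l (sqr_ge0 _) b1)).
  rewrite mulrA -[leRHS]mul1r; apply: ler_wpM2r; first exact: ltW.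
  rewrite (_ : (1 - r) ^+ 2 * (1 + r) = 1 - (r + r * r * (1 - r))); last by ring.
  by rewrite gerBl addr_ge0 ?(ltW r0)// !mulr_ge0 ?(ltW r0)// subr_ge0 ltW.
have dE : d `^ (1 - n / 2) = r `^ ((1 - n / 2) / n) by rewrite -powRrM mulrC.
by move: H1d; rewrite powR1 dE; lra.
Qed.

Lemma reduced_mass_continuous t : 0 < t -> t < 1 -> {for t, continuous G}.
Proof.
move=> t0 t1; have [L0 dL] := LP.
pose f s := L ((s / (1 - s)) `^ n^-1) / (2 * (s / (1 - s)) `^ n^-1 * Num.sqrt (1 - s)).
have fG : {near t, f =1 G}.
  near=> s; rewrite /f /G /reduced_mass ifT//; near: s; exact: lt_nbhsl.
have t1' : 0 < 1 - t by rewrite subr_gt0.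
have c1 : {for t, continuous (fun s => 1 - s)}.
  by apply: cvgB; [exact: cvg_cst|exact: cvg_id].
have cT : {for t, continuous (fun s => (s / (1 - s)) `^ n^-1)}.
  apply: (@continuous_comp _ _ _ (fun s => s / (1 - s)) (fun s => s `^ n^-1)).
    by apply: cvgM; [exact: cvg_id|apply: cvgV => //; rewrite gt_eqF].
  by apply: powR_continuous; rewrite divr_gt0.
have cf : {for t, continuous f}.
  apply: cvgM.
    apply: (@continuous_comp _ _ _ (fun s => (s / (1 - s)) `^ n^-1) L) => //.
    exact: is_derive_continuous (dL _).
  apply: cvgV.
    by rewrite !mulf_neq0 ?gt_eqF ?powR_gt0 ?divr_gt0 ?sqrtr_gt0.
  apply: cvgM; first by apply: cvgM => //; exact: cvg_cst.
  apply: (@continuous_comp _ _ _ (fun s => 1 - s) (fun s => Num.sqrt s)) => //.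
  exact: sqrt_continuous.
rewrite /prop_for /continuous_at -(nbhs_singleton fG).
apply: cvg_trans cf; apply: near_eq_cvg; first [exact: fG|near=> s; apply/esym; near: s; exact: fG].
Unshelve. all: by end_near. Qed.

Lemma reduced_mass_continuous1 : n < 2 -> {for 1, continuous G}.
Proof.
move=> n2; have n2' : 0 < 2 - n by rewrite subr_gt0.
have G1 t : 1 <= t -> G t = (2 - n)^-1.
  by move=> t1; rewrite /G /reduced_mass ltNge t1.
pose b := (1 - n / 2) / n.
have b0 : 0 < b by rewrite divr_gt0//; lra.
(* [Num.sqrt] is 0 on negative numbers, so [lo] equals the limit for [t >= 1] and the squeeze is
   two-sided. *)
pose lo t := (1 - Num.sqrt (1 - t)) * (1 - `|Num.sqrt (1 - t)| `^ b) * (2 - n)^-1.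
have cs : {for 1, continuous (fun t : R => Num.sqrt (1 - t))}.
  apply: (@continuous_comp _ _ _ (fun t => 1 - t) (fun t => Num.sqrt t)).
    by apply: cvgB; [exact: cvg_cst|exact: cvg_id].
  exact: sqrt_continuous.
have clo : {for 1, continuous lo}.
  apply: cvgM; last exact: cvg_cst.
  apply: cvgM; first by apply: cvgB; [exact: cvg_cst|exact: cs].
  apply: cvgB; first exact: cvg_cst.
  apply: (@continuous_comp _ _ _ (fun t => Num.sqrt (1 - t)) (fun s : R => `|s| `^ b)) => //.
  exact: continuous_norm_powR.
have lo1 : lo 1 = (2 - n)^-1.
  by rewrite /lo subrr sqrtr0 normr0 powR0 ?gt_eqF// !subr0 !mul1r.
rewrite /prop_for /continuous_at G1//.
apply: (@squeeze_cvgr _ _ _ _ lo (fun _ => (2 - n)^-1)).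
- near=> t.
  have t0 : 0 < t by near: t; apply: lt_nbhsr; exact: ltr01.
  have [t1|t1] := ltP t 1.
    rewrite reduced_mass_le1// andbT /lo ger0_norm ?sqrtr_ge0//.
    exact: reduced_mass_ge1.
  by rewrite G1// lexx andbT /lo ler0_sqrtr ?subr_le0// normr0 powR0 ?gt_eqF// !subr0 !mul1r.
- by move: clo; rewrite /prop_for /continuous_at lo1.
- exact: cvg_cst.
Unshelve. all: by end_near. Qed.

Lemma reduced_mass_gt0 t : n < 2 \/ t < 1 -> 0 < t -> 0 < G t.
Proof.
move=> n2 t0; have [t1|t1] := ltP t 1.
  by apply: lt_trans (reduced_mass_gt_half t0 t1); rewrite invr_gt0.
by case: n2 => [n2|]; [rewrite /G /reduced_mass (ltNge t) t1/= invr_gt0 subr_gt0|rewrite ltNge t1].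
Qed.

End reduced_mass.

(** * Values taken by [t^k G t] over the admissible parameters *)

Section range.
Context {R : realType}.
Implicit Types (s t v x : R).
Variables (p : R) (L : R -> R).
Hypotheses (p2 : 2 < p) (LP : mass_primitive ((p - 2) / 2) L).

Let n := (p - 2) / 2.
Let n0 : 0 < n. Proof. by have p2' := p2; rewrite /n; lra. Qed.
Let G := reduced_mass n L.

Lemma admissible_le s t : 0 < s -> s <= t -> admissible p t -> admissible p s.
Proof.
move=> s0 st [/andP[t0 t1]|[t1 p6]].
  by left; rewrite s0 (le_lt_trans st t1).
have [s1|s1] := ltP s 1; first by left; rewrite s0.
by right; split=> //; apply/eqP; rewrite eq_le s1 -t1 st.
Qed.

Let adm_pos t : admissible p t -> 0 < t.
Proof. by case=> [/andP[]//|[-> _]]. Qed.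

Let adm_le1 t : admissible p t -> t <= 1.
Proof. by case=> [/andP[_ /ltW]//|[-> _]]. Qed.

Let n2 : p < 6 -> n < 2.
Proof. by rewrite /n; lra. Qed.

Let Gpos t : admissible p t -> 0 < G t.
Proof.
move=> adm; apply: (reduced_mass_gt0 n0 LP) (adm_pos adm).
by case: adm => [/andP[_ ?]|[_ /n2]]; [right|left].
Qed.

Let Glt s t : 0 < s -> s < t -> admissible p t -> G s < G t.
Proof.
move=> s0 st [/andP[_ t1]|[t1 p6]]; first exact: (reduced_mass_lt n0 LP).
(* The comparison with [G 1] is only a weak inequality; passing through the midpoint [u] makes it
   strict. *)
rewrite t1 in st *; pose u := (s + 1) / 2.
have su : s < u by rewrite /u; lra.
have u1 : u < 1 by rewrite /u; lra.
apply: (lt_le_trans (reduced_mass_lt n0 LP s0 su u1)).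
have -> : G 1 = (2 - n)^-1 by rewrite /G /reduced_mass ltxx.
exact: (reduced_mass_le1 n0 LP (n2 p6) (lt_trans s0 su) u1).
Qed.

Let Ghalf t : admissible p t -> 2^-1 < G t.
Proof.
move=> adm; have t0 := adm_pos adm.
have half : t / 2 < t by lra.
have t20 : 0 < t / 2 by lra.
apply: lt_trans (Glt t20 half adm); apply: (reduced_mass_gt_half n0 LP) => //.
by have := adm_le1 adm; lra.
Qed.

Let Gcont t : admissible p t -> {for t, continuous G}.
Proof.
case=> [/andP[t0 t1]|[-> p6]]; first exact: (reduced_mass_continuous LP t0 t1).
exact: (reduced_mass_continuous1 n0 LP (n2 p6)).
Qed.

Definition scaled_mass k t : R := t `^ k * G t.

Lemma scaled_mass_gt0 k t : admissible p t -> 0 < scaled_mass k t.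
Proof. by move=> adm; rewrite mulr_gt0 ?Gpos// powR_gt0// adm_pos. Qed.

Lemma scaled_mass_lt k s t : 0 <= k -> 0 < s -> s < t -> admissible p t ->
  scaled_mass k s < scaled_mass k t.
Proof.
move=> k0 s0 st adm; apply: (@le_lt_trans _ _ (t `^ k * G s)).
  apply: ler_wpM2r.
    by apply: ltW; apply: Gpos; exact: admissible_le (ltW st) adm.
  by apply: ge0_ler_powR; rewrite ?nnegrE ?(ltW s0) ?(ltW st) ?(ltW (lt_trans s0 st)).
by rewrite ltr_pM2l ?Glt// powR_gt0// (lt_trans s0).
Qed.

Lemma scaled_mass_inj k s t : 0 <= k -> admissible p s -> admissible p t ->
  scaled_mass k s = scaled_mass k t -> s = t.
Proof.
move=> k0 As At E; have [st|ts|//] := ltgtP s t.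
  by have := scaled_mass_lt k0 (adm_pos As) st At; rewrite E ltxx.
by have := scaled_mass_lt k0 (adm_pos At) ts As; rewrite E ltxx.
Qed.

Lemma scaled_mass_continuous k t : admissible p t -> {for t, continuous (scaled_mass k)}.
Proof.
move=> adm; apply: cvgM; last exact: Gcont.
by apply: powR_continuous; exact: adm_pos.
Qed.

Lemma scaled_mass_intermediate k s t v : 0 < s -> s <= t -> admissible p t ->
  (scaled_mass k s <= v <= scaled_mass k t) || (scaled_mass k t <= v <= scaled_mass k s) ->
  exists2 c, admissible p c & scaled_mass k c = v.
Proof.
move=> s0 st adm vin.
have cont x : s <= x <= t -> {for x, continuous (scaled_mass k)}.
  move=> /andP[sx xt]; apply: scaled_mass_continuous.
  by apply: (admissible_le _ xt adm); exact: lt_le_trans sx.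
have [c /andP[sc ct] E] := continuous_intermediate st cont vin.
by exists c => //; apply: (admissible_le _ ct adm); exact: lt_le_trans sc.
Qed.

(** For [s <= t] the factor [G s] is at most [G t], so it is enough to solve [s^k = v / G t] and cap
    the result at [t]. *)
Lemma scaled_mass_small k t v : 0 < k -> 0 < v -> admissible p t ->
  exists s, [/\ 0 < s, s <= t & scaled_mass k s <= v].
Proof.
move=> k0 v0 adm; have t0 := adm_pos adm; have Gt := Gpos adm.
have w0 : 0 < (v / G t) `^ k^-1 by rewrite powR_gt0// divr_gt0.
exists (Num.min t ((v / G t) `^ k^-1)); set s := Num.min _ _.
have s0 : 0 < s by rewrite lt_min t0.
have st : s <= t by rewrite ge_min lexx.
split => //.
have Gst : G s <= G t.
  by move: st; rewrite le_eqVlt => /predU1P[->//|st]; apply: ltW; exact: Glt.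
apply: (@le_trans _ _ (s `^ k * G t)); first by apply: ler_wpM2l; rewrite ?powR_ge0.
rewrite -ler_pdivlMr//.
have -> : v / G t = ((v / G t) `^ k^-1) `^ k.
  by rewrite -powRrM mulVf ?gt_eqF// powRr1// ltW// divr_gt0.
apply: ge0_ler_powR; rewrite ?nnegrE ?(ltW k0) ?(ltW s0) ?(ltW w0)//.
by rewrite ge_min lexx orbT.
Qed.

Let powR_neg_le k s t : k < 0 -> 0 < s -> s <= t -> t `^ k <= s `^ k.
Proof.
move=> k0 s0 st; have t0 := lt_le_trans s0 st.
have powE x : x `^ k = (x `^ (- k))^-1 by rewrite powRN invrK.
rewrite !powE lef_pV2 ?posrE ?powR_gt0//.
by apply: ge0_ler_powR; rewrite ?nnegrE ?oppr_ge0 ?(ltW k0) ?(ltW s0) ?(ltW t0).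
Qed.

Lemma scaled_mass_large_near0 k v : k < 0 ->
  exists2 d, 0 < d & forall s, admissible p s -> s <= d -> v < scaled_mass k s.
Proof.
(* The factor 2 offsets the lower bound 1/2 of [G]. *)
move=> k0; have w0 : 0 < 2 * (`|v| + 1) by rewrite mulr_gt0// ltr_wpDl.
exists ((2 * (`|v| + 1)) `^ k^-1); first by rewrite powR_gt0.
move=> s adm sd; have s0 := adm_pos adm.
have := powR_neg_le k0 s0 sd.
rewrite -powRrM mulVf ?lt_eqF// powRr1 ?(ltW w0)// => h.
have := Ghalf adm; have := ler_norm v; have := normr_ge0 v.
rewrite /scaled_mass; set A := s `^ k in h *; nra.
Qed.

Lemma reduced_mass_large_near1 v : 6 <= p ->
  exists t, [/\ 2^-1 <= t, t < 1 & forall s, t <= s -> s < 1 -> v <= G s].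
Proof.
(* The logarithmic lower bound reaches [|v|] as soon as [sqrt (1 - s) <= E]. *)
move=> p6; pose E := expR (- (2 * `|v|)).
have E0 : 0 < E by exact: expR_gt0.
exists (Num.max 2^-1 (1 - E ^+ 2)); split.
- by rewrite le_max lexx.
- by rewrite gt_max; apply/andP; split; [lra|rewrite ltrBlDr ltrDl exprn_gt0].
- move=> s; rewrite ge_max => /andP[s2 sE] s1.
  have s0 : 0 < s by lra.
  have n2' : 2 <= n by rewrite /n; lra.
  apply: le_trans (reduced_mass_ge_ln n0 LP n2' s0 s1).
  have r0 : 0 < Num.sqrt (1 - s) by rewrite sqrtr_gt0 subr_gt0.
  have rE : Num.sqrt (1 - s) <= E.
    rewrite -[leRHS](ger0_norm (ltW E0)) -sqrtr_sqr; apply: ler_wsqrtr; lra.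
  have : ln (Num.sqrt (1 - s)) <= ln E by rewrite ler_ln.
  by rewrite /E expRK; have := ler_norm v; lra.
Qed.

Lemma range_increasing_closed k v : p < 6 -> 0 < k -> 0 < v ->
  (exists2 t, admissible p t & scaled_mass k t = v) <-> v <= scaled_mass k 1.
Proof.
move=> p6 k0 v0; have adm1 : admissible p 1 by right.
split=> [[t adm <-]|v1].
  have := adm_le1 adm; rewrite le_eqVlt => /predU1P[->//|t1].
  by apply: ltW; exact: (scaled_mass_lt (ltW k0) (adm_pos adm) t1 adm1).
have [s [s0 s1 sv]] := scaled_mass_small k0 v0 adm1.
by apply: (scaled_mass_intermediate s0 s1 adm1); rewrite sv v1.
Qed.

Lemma range_increasing_open k v : 6 <= p -> 0 < k -> 0 < v ->
  exists2 t, admissible p t & scaled_mass k t = v.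
Proof.
move=> p6 k0 v0.
have h0 : 0 < 2^-1 `^ k :> R by rewrite powR_gt0// invr_gt0.
have [t [t2 t1 tG]] := reduced_mass_large_near1 (v / 2^-1 `^ k) p6.
have adm : admissible p t by left; apply/andP; split => //; lra.
have [s [s0 st sv]] := scaled_mass_small k0 v0 adm.
apply: (scaled_mass_intermediate s0 st adm); apply/orP; left; rewrite sv/=.
have := tG t (lexx t) t1; rewrite ler_pdivrMr// mulrC => h.
apply: (le_trans h); apply: ler_wpM2r; first exact: ltW (Gpos adm).
by apply: ge0_ler_powR; rewrite ?nnegrE ?(ltW k0) ?invr_ge0 ?(ltW (adm_pos adm)).
Qed.

Lemma range_decreasing_power k : k < 0 ->
  exists2 c, 0 < c &
    forall v, (exists2 t, admissible p t & scaled_mass k t = v) <-> c <= v.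
Proof.
move=> k0; have [d d0 Hd] := scaled_mass_large_near0 (scaled_mass k 2^-1) k0.
have [t2 [t2h adm2 Ht2]] : exists t2, [/\ 2^-1 <= t2, admissible p t2 &
    forall s, admissible p s -> t2 < s -> scaled_mass k 2^-1 <= scaled_mass k s].
  have [p6|p6] := ltP p 6.
    exists 1; split; [lra|by right|].
    by move=> s /adm_le1 s1; rewrite ltNge s1.
  have [t [th t1 HG]] := reduced_mass_large_near1 (scaled_mass k 2^-1) p6.
  exists t; split=> //; first by left; apply/andP; split => //; lra.
  move=> s [/andP[s0 s1]|[_ ]]; last by rewrite ltNge p6.
  move=> ts; apply: (le_trans (HG s (ltW ts) s1)).
  have -> : G s = 1 `^ k * G s by rewrite powR1 mul1r.
  apply: ler_wpM2r; last exact: powR_neg_le (ltW s1).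
  by apply: ltW; apply: Gpos; left; rewrite s0.
pose t1 := Num.min d 2^-1.
have t10 : 0 < t1 by rewrite lt_min d0 invr_gt0/=.
have t1h : t1 <= 2^-1 by rewrite ge_min lexx orbT.
have t12 : t1 <= t2 by exact: le_trans t2h.
have cont : {within `[t1, t2], continuous (scaled_mass k)}.
  apply: continuous_in_subspaceT => x; rewrite inE/= in_itv/= => /andP[t1x xt2].
  by apply: scaled_mass_continuous; apply: (admissible_le _ xt2 adm2); exact: lt_le_trans t1x.
have [c] := EVT_min t12 cont; rewrite in_itv/= => /andP[t1c ct2] cmin.
have c0 : 0 < c by exact: lt_le_trans t1c.
have admc : admissible p c by exact: admissible_le ct2 adm2.
have glob s : admissible p s -> scaled_mass k c <= scaled_mass k s.
  move=> adms; have ch : scaled_mass k c <= scaled_mass k 2^-1.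
    by apply: cmin; rewrite in_itv/= t1h.
  have [st1|st1] := ltP s t1.
    apply: (le_trans ch); apply: ltW; apply: Hd => //.
    by apply: (le_trans (ltW st1)); rewrite ge_min lexx.
  have [st2|st2] := leP s t2; first by apply: cmin; rewrite in_itv/= st1.
  by apply: (le_trans ch); exact: Ht2.
exists (scaled_mass k c); first exact: scaled_mass_gt0.
move=> v; split=> [[t admt <-]|cv]; first exact: glob.
have [d' d'0 Hd'] := scaled_mass_large_near0 v k0.
have s0 : 0 < Num.min d' c by rewrite lt_min d'0.
have sc : Num.min d' c <= c by rewrite ge_min lexx orbT.
apply: (scaled_mass_intermediate s0 sc admc); apply/orP; right; rewrite cv/=.
apply: ltW; apply: Hd'; first exact: admissible_le sc admc.
by rewrite ge_min lexx.
Qed.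

Let scaled_mass0 t : scaled_mass 0 t = G t.
Proof. by rewrite /scaled_mass powRr0 mul1r. Qed.

Lemma reduced_mass_near_half v : 2^-1 < v ->
  exists t, [/\ 0 < t, t < 1 & G t <= v].
Proof.
move=> v2; have v0 : 0 < v by lra.
have w0 : 0 < (2 * v)^-1 by rewrite invr_gt0 mulr_gt0.
have w1 : (2 * v)^-1 < 1 by rewrite invf_lt1 ?mulr_gt0//; lra.
have ww : (2 * v)^-1 ^+ 2 < 1 by rewrite exprn_ilt1// ltW.
have ww0 : 0 < (2 * v)^-1 ^+ 2 by rewrite exprn_gt0.
(* This [t] solves [(2 * Num.sqrt (1 - t))^-1 = v], the upper bound of [reduced_mass_le]. *)
exists (1 - (2 * v)^-1 ^+ 2); split; [lra|lra|].
have t0 : 0 < 1 - (2 * v)^-1 ^+ 2 by lra.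
have t1 : 1 - (2 * v)^-1 ^+ 2 < 1 by lra.
apply: (le_trans (reduced_mass_le n0 LP t0 t1)).
rewrite opprB addrC subrK sqrtr_sqr ger0_norm ?(ltW w0)// le_eqVlt; apply/orP; left.
by apply/eqP; field; rewrite gt_eqF.
Qed.

Lemma range_constant_closed v : p < 6 ->
  (exists2 t, admissible p t & scaled_mass 0 t = v) <-> 2^-1 < v <= scaled_mass 0 1.
Proof.
move=> p6; have adm1 : admissible p 1 by right.
split=> [[t adm <-]|/andP[v2 v1]].
  rewrite !scaled_mass0 Ghalf//=.
  have := adm_le1 adm; rewrite le_eqVlt => /predU1P[->//|t1].
  by apply: ltW; exact: (Glt (adm_pos adm) t1 adm1).
have [s [s0 s1 sv]] := reduced_mass_near_half v2.
by apply: (scaled_mass_intermediate s0 (ltW s1) adm1); rewrite scaled_mass0 sv v1.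
Qed.

Lemma range_constant_open v : 6 <= p ->
  (exists2 t, admissible p t & scaled_mass 0 t = v) <-> 2^-1 < v.
Proof.
move=> p6; split=> [[t adm <-]|v2]; first by rewrite scaled_mass0 Ghalf.
have [s [s0 s1 sv]] := reduced_mass_near_half v2.
have [t [t2 t1 tG]] := reduced_mass_large_near1 v p6.
have adm : admissible p t by left; apply/andP; split => //; lra.
have [st|ts] := leP s t.
  apply: (scaled_mass_intermediate (k := 0) s0 st adm); rewrite !scaled_mass0 sv/=.
  by rewrite (tG t (lexx t) t1).
(* When [t < s], monotonicity gives [v <= G t <= G s <= v], so [s] itself realizes [v]. *)
exists s; first by left; rewrite s0.
rewrite scaled_mass0; apply/eqP; rewrite eq_le sv/=.
by apply: (le_trans (tG t (lexx t) t1)); apply: ltW; apply: Glt;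
  [exact: adm_pos|exact: ts|left; rewrite s0].
Qed.

Variable q : R.
Hypothesis q2 : 2 < q.
Let e := p + 2 - 2 * q.
Let k := (4 - q) / e.

Let p0 : 0 < p. Proof. by have p2' := p2; lra. Qed.

(* [a^(4-q) = (p / 8)^k (ratio p q a)^k] turns the mass [4 a^(4-q) G t] into
   [mass_unit * scaled_mass k t]. *)
Definition mass_unit : R := 4 * (p / 8) `^ k.

Lemma mass_unit_gt0 : 0 < mass_unit.
Proof. by rewrite mulr_gt0// powR_gt0// divr_gt0. Qed.

Let ratio_power a : e != 0 -> 0 < a -> a `^ (4 - q) = (p / 8) `^ k * ratio p q a `^ k.
Proof.
move=> e0 a0.
rewrite -powRM ?divr_ge0 ?(ltW p0)//; last first.
  by rewrite /ratio mulr_ge0 ?powR_ge0// divr_ge0 ?(ltW p0).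
have -> : p / 8 * ratio p q a = a `^ e.
  by rewrite /ratio mulrA -/e; rewrite (_ : p / 8 * (8 / p) = 1) ?mul1r//; field; rewrite gt_eqF.
by rewrite -powRrM /k mulrC divfK.
Qed.

(** For [e != 0] the ratio is a bijection of the positive reals, with inverse [(p * t / 8)^(1/e)],
    so [t] can replace the height as the parameter. *)
Lemma admits_scaled_mass m : e != 0 -> 0 < m ->
  admits_solution p q m <->
  exists2 t, admissible p t & scaled_mass k t = m / mass_unit.
Proof.
move=> e0 m0; have mu0 := mass_unit_gt0.
have scal t : 4 * ((p / 8) `^ k * t `^ k) * G t = mass_unit * scaled_mass k t.
  by rewrite /mass_unit /scaled_mass; ring.
split=> [/(admits_ratio p2 q2 m0 LP)[a a0 [adm mE]]|[t adm tE]].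
  exists (ratio p q a) => //; apply/eqP; rewrite eq_sym; apply/eqP.
  by rewrite mE ratio_power// -/n -/G scal mulrC mulKf ?gt_eqF.
apply/(admits_ratio p2 q2 m0 LP).
have t0 := adm_pos adm; have pt0 : 0 < p * t / 8 by rewrite divr_gt0// mulr_gt0.
have rE : ratio p q ((p * t / 8) `^ e^-1) = t.
  rewrite /ratio -/e -powRrM mulVf// powRr1 ?(ltW pt0)//.
  by field; rewrite gt_eqF.
exists ((p * t / 8) `^ e^-1); first by rewrite powR_gt0.
rewrite ratio_power ?powR_gt0// rE; split => //.
by rewrite -/n -/G scal tE mulrC divfK// gt_eqF.
Qed.

Lemma unique_scaled_mass m : e != 0 -> 0 <= k -> 0 < m -> unique_up_to_sign p q m.
Proof.
move=> e0 k0 m0; apply: (unique_ratio p2 q2 m0 LP) => a b a0 b0 adma admb.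
rewrite !ratio_power// -/n -/G -!mulrA => /mulfI E.
have tt : ratio p q a = ratio p q b.
  by apply: (scaled_mass_inj k0 adma admb); apply: E; rewrite gt_eqF// powR_gt0// divr_gt0.
have c0 : 8 / p != 0 by rewrite gt_eqF// divr_gt0.
move: tt; rewrite /ratio -/e => /(mulfI c0) ab.
rewrite -(powRr1 (ltW a0)) -(powRr1 (ltW b0)) -(mulfV e0) !powRrM.
by rewrite ab.
Qed.

(** The ratio is frozen at [8 / p]; the value 1 would mean [p = 8], against [p < 6], so
    admissibility is [8 < p]. Then [q > 5], and [a^(4-q)] sweeps all positive values. *)
Lemma admits_critical m : e = 0 -> 0 < m ->
  admits_solution p q m <-> 8 < p.
Proof.
move=> e0 m0; have rE a : ratio p q a = 8 / p.
  by rewrite /ratio -/e e0 powRr0 mulr1.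
have p2' := p2.
split=> [/(admits_ratio p2 q2 m0 LP)[a a0 [+ _]]|p8].
  rewrite rE => -[/andP[_]|[]].
    by rewrite ltr_pdivrMr// mul1r.
  by move=> /(congr1 (fun x => x * p)); rewrite divfK ?gt_eqF// mul1r; lra.
have adm : admissible p (8 / p).
  by left; rewrite divr_gt0//= ltr_pdivrMr// mul1r.
have G0 := Gpos adm.
have q4 : 4 - q != 0 by rewrite lt_eqF//; move: e0; rewrite /e; lra.
apply/(admits_ratio p2 q2 m0 LP).
have mG : 0 < m / (4 * G (8 / p)) by rewrite divr_gt0// mulr_gt0.
exists ((m / (4 * G (8 / p))) `^ (4 - q)^-1); first by rewrite powR_gt0.
rewrite rE; split=> //; rewrite -powRrM mulVf// powRr1 ?(ltW mG)//.
by rewrite -/n -/G; field; rewrite gt_eqF.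
Qed.

Lemma unique_critical m : e = 0 -> 8 < p -> 0 < m -> unique_up_to_sign p q m.
Proof.
move=> e0 p8 m0; apply: (unique_ratio p2 q2 m0 LP) => a b a0 b0 adma _.
have rE c : ratio p q c = 8 / p by rewrite /ratio -/e e0 powRr0 mulr1.
have G0 := Gpos adma.
have q4 : 4 - q != 0 by rewrite lt_eqF//; move: e0; rewrite /e; lra.
rewrite !rE in G0 *; move=> /(mulIf (lt0r_neq0 G0)) ab.
rewrite -(powRr1 (ltW a0)) -(powRr1 (ltW b0)) -(mulfV q4) !powRrM.
by rewrite ab.
Qed.

End range.

(** * The cases of the theorem, by the sign of the exponent [k] *)

Lemma quotient_gt0 (R : realType) (x y : R) :
  (0 < x /\ 0 < y) \/ (x < 0 /\ y < 0) -> 0 < x / y.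
Proof. by case=> -[x0 y0]; [rewrite divr_gt0|rewrite nmulr_rgt0// invr_lt0]. Qed.

Unset Implicit Arguments.
Local Close Scope classical_set_scope.

Theorem theorem1p2 (R : realType) (p q : R) (hp : 2 < p) (hq : 2 < q) :
  (* (i) *)
  ((2 < p < 6 /\ 2 < q < p / 2 + 1) \/ (2 < p < 6 /\ 4 < q) ->
     exists2 mpq : R, 0 < mpq &
       forall m : R, 0 < m -> (admits_solution p q m <-> m <= mpq))
  /\
  (* (ii) *)
  ((6 <= p /\ 2 < q < 4) \/ (6 <= p /\ p / 2 + 1 < q) ->
     forall m : R, 0 < m -> admits_solution p q m)
  /\
  (* (iii) *)
  ((6 < p /\ 4 < q < p / 2 + 1) \/ (2 < p < 6 /\ p / 2 + 1 < q < 4) ->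
     exists2 mpq : R, 0 < mpq &
       forall m : R, 0 < m -> (admits_solution p q m <-> mpq <= m))
  /\
  (* (iv) *)
  (2 < p < 6 /\ q = 4 ->
     exists2 mp4 : R, 2 < mp4 &
       forall m : R, 0 < m -> (admits_solution p q m <-> 2 < m <= mp4))
  /\
  (* (v) *)
  (6 < p /\ q = 4 ->
     forall m : R, 0 < m -> (admits_solution p q m <-> 2 < m))
  /\
  (* (vi) *)
  (2 < p /\ q = p / 2 + 1 ->
     (p <= 8 -> forall m : R, 0 < m -> ~ admits_solution p q m) /\
     (8 < p -> forall m : R, 0 < m -> admits_solution p q m))
  /\
  (* uniqueness up to sign in cases (i), (ii), (iv), (v), (vi) *)
  ([\/ (2 < p < 6 /\ 2 < q < p / 2 + 1) \/ (2 < p < 6 /\ 4 < q),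
       (6 <= p /\ 2 < q < 4) \/ (6 <= p /\ p / 2 + 1 < q),
       2 < p < 6 /\ q = 4
     | (6 < p /\ q = 4) \/ (2 < p /\ q = p / 2 + 1)] ->
     forall m : R, 0 < m -> admits_solution p q m -> unique_up_to_sign p q m).
Proof.
have n0 : 0 < (p - 2) / 2 by lra.
have [L LP] := mass_primitive_exists n0.
have mu0 : 0 < mass_unit p q := mass_unit_gt0 hp q.
have unit_div (m : R) : 0 < m -> 0 < m / mass_unit p q by move=> m0; rewrite divr_gt0.
have admits (m : R) : p + 2 - 2 * q != 0 -> 0 < m -> _ :=
  fun e0 m0 => admits_scaled_mass hp LP hq e0 m0.
(* [p < 6] means [p / 2 + 1 < 4]. In (i) and (ii) [q] lies on one side of both numbers, so numerator
   and denominator of [k] have the same sign; in (iii) it lies between them. *)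
have case1 : (2 < p < 6 /\ 2 < q < p / 2 + 1) \/ (2 < p < 6 /\ 4 < q) ->
    p + 2 - 2 * q != 0 /\ 0 < (4 - q) / (p + 2 - 2 * q).
  case=> -[/andP[_ p6]].
    move=> /andP[_ qp]; split; first by rewrite gt_eqF//; lra.
    by apply: quotient_gt0; left; lra.
  move=> q4; split; first by rewrite lt_eqF//; lra.
  by apply: quotient_gt0; right; lra.
have case2 : (6 <= p /\ 2 < q < 4) \/ (6 <= p /\ p / 2 + 1 < q) ->
    p + 2 - 2 * q != 0 /\ 0 < (4 - q) / (p + 2 - 2 * q).
  case=> -[p6].
    move=> /andP[_ q4]; split; first by rewrite gt_eqF//; lra.
    by apply: quotient_gt0; left; lra.
  move=> qp; split; first by rewrite lt_eqF//; lra.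
  by apply: quotient_gt0; right; lra.
have k4 : q = 4 -> (4 - q) / (p + 2 - 2 * q) = 0 by move=> ->; rewrite subrr mul0r.
have mu4 : q = 4 -> mass_unit p q = 4.
  by move=> q4; rewrite /mass_unit k4// powRr0 mulr1.
(* The threshold 2 at [q = 4] is the infimum 1/2 of [G] times the mass unit 4. *)
have half (m : R) : (2^-1 < m / 4) = (2 < m).
  by rewrite ltr_pdivlMr// (_ : 2^-1 * 4 = 2 :> R)//; field.
split=> [c1|].
  have [e0 k0] := case1 c1.
  have p6 : p < 6 by case: c1 => -[/andP[]].
  exists (mass_unit p q * scaled_mass p L ((4 - q) / (p + 2 - 2 * q)) 1).
    by rewrite mulr_gt0// (scaled_mass_gt0 hp LP)//; right.
  move=> m m0; rewrite (admits m e0 m0) (range_increasing_closed hp LP p6 k0 (unit_div m m0)).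
  by rewrite ler_pdivrMr// mulrC.
split=> [c2 m m0|].
  have [e0 k0] := case2 c2; have p6 : 6 <= p by case: c2 => -[].
  apply/(admits m e0 m0); exact: (range_increasing_open hp LP p6 k0 (unit_div m m0)).
split=> [c3|].
  have [e0 k0] : p + 2 - 2 * q != 0 /\ (4 - q) / (p + 2 - 2 * q) < 0.
    rewrite -oppr_gt0 -[X in 0 < X]mulNr opprB; case: c3 => -[_ /andP[q1 q2]].
      split; first by rewrite gt_eqF//; lra.
      by apply: quotient_gt0; left; lra.
    split; first by rewrite lt_eqF//; lra.
    by apply: quotient_gt0; right; lra.
  have [c c0 range] := range_decreasing_power hp LP k0.
  exists (mass_unit p q * c); first exact: mulr_gt0.
  move=> m m0; rewrite (admits m e0 m0) range.
  by rewrite ler_pdivlMr// mulrC.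
split=> [[/andP[_ p6] q4]|].
  have e0 : p + 2 - 2 * q != 0 by rewrite lt_eqF//; lra.
  exists (4 * scaled_mass p L 0 1).
    (* The end point value lies in its own range, whose strict lower bound 1/2 yields [2 < mp4]. *)
    have := (range_constant_closed hp LP (scaled_mass p L 0 1) p6).1.
    by move=> /(_ (ex_intro2 _ _ _ (or_intror (conj erefl p6)) erefl)); lra.
  move=> m m0; rewrite (admits m e0 m0) k4// mu4// range_constant_closed//.
  by rewrite half ler_pdivrMr// mulrC.
split=> [[p6 q4] m m0|].
  have e0 : p + 2 - 2 * q != 0 by rewrite gt_eqF//; lra.
  by rewrite (admits m e0 m0) k4// mu4// range_constant_open ?half// ltW.
split=> [[_ qp]|].
  have e0 : p + 2 - 2 * q = 0 by lra.
  split=> p8 m m0; last by apply/(admits_critical hp LP hq e0 m0).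
  by move=> /(admits_critical hp LP hq e0 m0); rewrite ltNge p8.
move=> c m m0 adm.
have unique : p + 2 - 2 * q != 0 -> 0 <= (4 - q) / (p + 2 - 2 * q) ->
  unique_up_to_sign p q m := fun e0 k0 => unique_scaled_mass hp LP hq e0 k0 m0.
case: c => [/case1[e0 /ltW]|/case2[e0 /ltW]|[/andP[_ p6] q4]|[[p6 q4]|[_ qp]]].
- exact: unique.
- exact: unique.
- by apply: unique; [rewrite lt_eqF//; lra|rewrite k4].
- by apply: unique; [rewrite gt_eqF//; lra|rewrite k4].
- have e0 : p + 2 - 2 * q = 0 by lra.
  exact: (unique_critical hp LP hq e0 ((admits_critical hp LP hq e0 m0).1 adm) m0).
Qed.
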